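(* Let $d\ge2$. The quantum $(2,2,2)$-behaviours are exactly those that can be realised by binary-outcome bipartite $\mathrm{SO}(d)\times\mathrm{SO}(d)$-boxes that transform fundamentally locally and are locally unbiased, restricted to two choices of input direction per party per box, and statistically mixed via shared randomness. That is, the set of quantum $(2,2,2)$-behaviours equals the set of all finite convex combinations of behaviours of the form $$\big(\mathrm P(a,b\,|\,\vec x_r,\vec y_t)\big)_{a,b\in\{\pm1\},\ r,t\in\{1,2\}},$$ where $\mathrm P(a,b|\vec x,\vec y)$ ($a,b\in\{\pm1\}$, $\vec x,\vec y\in S^{d-1}$) is a no-signalling bipartite box that transforms fundamentally locally and is locally unbiased, and $\vec x_1,\vec x_2,\vec y_1,\vec y_2\in S^{d-1}$ are arbitrary directions (the box and the directions may differ between the terms of the convex combination).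
   Context: A bipartite box is a family of probability distributions $\mathrm P(a,b|\vec x,\vec y)$ on pairs of outcomes $(a,b)$, indexed by inputs $\vec x,\vec y\in S^{d-1}$ (unit sphere in $\mathbb R^d$), on which $\mathrm{SO}(d)$ acts by rotation for each party. It is no-signalling if $\mathrm P_A(a|\vec x):=\sum_b\mathrm P(a,b|\vec x,\vec y)$ does not depend on $\vec y$ and $\mathrm P_B(b|\vec y):=\sum_a\mathrm P(a,b|\vec x,\vec y)$ does not depend on $\vec x$. Its conditional boxes are $\mathrm P_A^{b,\vec y}(a|\vec x):=\mathrm P(a,b|\vec x,\vec y)/\mathrm P_B(b|\vec y)$ (for fixed $b,\vec y$ with $\mathrm P_B(b|\vec y)>0$) and $\mathrm P_B^{a,\vec x}(b|\vec y):=\mathrm P(a,b|\vec x,\vec y)/\mathrm P_A(a|\vec x)$ (for fixed $a,\vec x$ with $\mathrm P_A(a|\vec x)>0$). A single-party box $\mathrm P(a|\vec x)$, $\vec x\in S^{d-1}$, transforms fundamentally if, for a fixed $\vec x_0\in S^{d-1}$, there are real constants $c_0^a,c_{ij}^a$ such that $\mathrm P(a|R\vec x_0)=c_0^a+\sum_{i,j=1}^dR_{ij}c^a_{ij}$ for all $R\in\mathrm{SO}(d)$ and all $a$ (the choice of $\vec x_0$ is immaterial). It is unbiased if the Haar average $\int_{\mathrm{SO}(d)}\mathrm P(a|R\vec x)\,dR$ is the same for all outcomes $a$. A no-signalling bipartite box transforms fundamentally locally (is locally unbiased) if all its conditional boxes transform fundamentally (are unbiased). A quantum $(2,2,2)$-behaviour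 is a family $(\mathrm P(a,b|r,t))_{a,b\in\{\pm1\},r,t\in\{1,2\}}$ for which there are Hilbert spaces $H_A,H_B$, a density operator $\rho$ on $H_A\otimes H_B$, and two-outcome POVMs $\{E_r^{(a)}\}_{a=\pm1}$ on $H_A$ ($r=1,2$) and $\{F_t^{(b)}\}_{b=\pm1}$ on $H_B$ ($t=1,2$) with $\mathrm P(a,b|r,t)=\mathrm{Tr}[\rho\,(E_r^{(a)}\otimes F_t^{(b)})]$. *)

(* Defs.v *)
From HB Require Import structures.
From mathcomp Require Import all_boot all_order all_algebra.
From mathcomp Require Import finmap sesquilinear complex.
From mathcomp Require Import all_classical all_reals all_analysis.
From mathcomp Require Import summability.

Set Implicit Arguments.
Unset Strict Implicit.
Unset Printing Implicit Defensive.

Import Order.TTheory GRing.Theory Num.Theory.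
Import numFieldNormedType.Exports.

Local Open Scope classical_set_scope.
Local Open Scope ring_scope.

Section Directions.
Variables (R : realType) (d : nat).

Definition sphere : set 'cV[R]_d := [set x | \sum_(i < d) x i 0 ^+ 2 = 1].

Definition SO : set 'M[R]_d := [set Q | Q *m Q^T = 1%:M /\ \det Q = 1].

Definition borel_mx : measurableType (@open 'M[R]_d).-sigma :=
  g_sigma_algebraType (@open 'M[R]_d).

(* The normalised Haar measure of the group SO(d), presented as the Borel
   probability measure on all d x d matrices that is carried by SO(d) and is
   invariant under left translations by SO(d). *)
Definition haar_SO (mu : probability borel_mx R) : Prop :=
  mu SO = 1%E /\
  forall (Q : 'M[R]_d) (A : set borel_mx), SO Q -> measurable A ->
    mu ((fun M : borel_mx => (Q *m M : borel_mx)) @^-1` A) = mu A.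

End Directions.
Arguments sphere {R d}.
Arguments SO {R d}.

(* Boxes are total functions of vectors in R^d; only their values at unit
   vectors are ever constrained or used. *)
Section SingleParty.
Variables (R : realType) (d : nat) (A : finType).

Definition transforms_fundamentally (P : A -> 'cV[R]_d -> R) : Prop :=
  exists2 x0 : 'cV[R]_d, sphere x0 &
  exists (c0 : A -> R) (c : A -> 'M[R]_d),
  forall (a : A) (Q : 'M[R]_d), SO Q ->
    P a (Q *m x0) = c0 a + \sum_(i < d) \sum_(j < d) Q i j * c a i j.

Definition unbiased (mu : probability (borel_mx R d) R)
    (P : A -> 'cV[R]_d -> R) : Prop :=
  forall x : 'cV[R]_d, sphere x -> forall a a' : A,
    (\int[mu]_(Q in SO) (P a (Q *m x))%:E =
     \int[mu]_(Q in SO) (P a' (Q *m x))%:E)%E.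

End SingleParty.

Section Bipartite.
Variables (R : realType) (d : nat) (A B : finType).
Implicit Type P : A -> B -> 'cV[R]_d -> 'cV[R]_d -> R.

Definition bipartite_box P : Prop :=
  forall x y, sphere x -> sphere y ->
    (forall a b, 0 <= P a b x y) /\ \sum_(a : A) \sum_(b : B) P a b x y = 1.

(* Without the no-signalling condition each marginal may depend on both
   inputs; under it, the other party's input is irrelevant. *)
Definition marginalA P (a : A) (x y : 'cV[R]_d) : R := \sum_(b : B) P a b x y.
Definition marginalB P (b : B) (x y : 'cV[R]_d) : R := \sum_(a : A) P a b x y.

Definition no_signalling P : Prop :=
  (forall a x y y', sphere x -> sphere y -> sphere y' ->
     marginalA P a x y = marginalA P a x y') /\
  (forall b y x x', sphere y -> sphere x -> sphere x' ->
     marginalB P b x y = marginalB P b x' y).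

Definition conditionalA P (b : B) (y : 'cV[R]_d) : A -> 'cV[R]_d -> R :=
  fun a x => P a b x y / marginalB P b x y.
Definition conditionalB P (a : A) (x : 'cV[R]_d) : B -> 'cV[R]_d -> R :=
  fun b y => P a b x y / marginalA P a x y.

Definition all_conditional_boxes
    (prop : forall C : finType, (C -> 'cV[R]_d -> R) -> Prop) P : Prop :=
  (forall b y, sphere y -> (forall x, sphere x -> 0 < marginalB P b x y) ->
     prop A (conditionalA P b y)) /\
  (forall a x, sphere x -> (forall y, sphere y -> 0 < marginalA P a x y) ->
     prop B (conditionalB P a x)).

End Bipartite.

(* The outcomes +1 and -1 are encoded as true and false, the two inputs of each
   party as the elements of 'I_2; p a b r t is P(a, b | r, t). *)
Definition behaviour (R : realType) := bool -> bool -> 'I_2 -> 'I_2 -> R.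

Definition convex_hull (R : realType) (S : set (behaviour R)) :
    set (behaviour R) :=
  [set p | exists (n : nat) (w : 'I_n -> R) (q : 'I_n -> behaviour R),
    [/\ forall k, 0 <= w k, \sum_(k < n) w k = 1, forall k, S (q k) &
        forall a b r t, p a b r t = \sum_(k < n) w k * q k a b r t]].

Definition box_behaviours (R : realType) (d : nat)
    (mu : probability (borel_mx R d) R) : set (behaviour R) :=
  [set p | exists P : bool -> bool -> 'cV[R]_d -> 'cV[R]_d -> R,
    [/\ bipartite_box P, no_signalling P,
        all_conditional_boxes (@transforms_fundamentally R d) P,
        all_conditional_boxes (fun C => @unbiased R d C mu) P &
        exists x y : 'I_2 -> 'cV[R]_d,
          [/\ forall r, sphere (x r), forall t, sphere (y t) &
              forall a b r t, p a b r t = P a b (x r) (y t)]]].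

(* Inner products are linear in the first argument and conjugate-linear in the
   second. *)
Record hilbertSpace (R : realType) := HilbertSpace {
  hilbert_sort :> completeNormedModType R[i];
  hdot : {dot hilbert_sort for @Num.conj R[i]};
  hdotE : forall u : hilbert_sort, hdot u u = `|u| ^+ 2
}.
Arguments hdot {R h}.

Section Operators.
Variables (R : realType) (H : hilbertSpace R).

Definition lin_span (S : set H) : set H :=
  [set u | exists (n : nat) (c : 'I_n -> R[i]) (v : 'I_n -> H),
    (forall k, S (v k)) /\ u = \sum_(k < n) c k *: v k].

(* Indexed by an arbitrary type: the space need not be separable. *)
Definition orthonormal_basis (I : choiceType) (e : I -> H) : Prop :=
  (forall i j, hdot (e i) (e j) = (i == j)%:R) /\ dense (lin_span (range e)).

(* The sum over the basis is the limit of the net of finite partial sums. For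
   trace-class operators the sum converges and does not depend on the basis. *)
Definition is_trace (T : H -> H) (z : R[i]) : Prop :=
  exists (I : choiceType) (e : I -> H), orthonormal_basis e /\
    partial_sum (fun i => hdot (T (e i)) (e i) : R[i]^o) @ totally
      --> (z : R[i]^o).

(* In R[i], 0 <= z means that z is real and nonnegative; on a complex space
   positive operators are therefore self-adjoint. *)
Definition positive_op (T : {linear H -> H}) : Prop :=
  continuous T /\ forall u : H, 0 <= hdot (T u) u.

Definition density_op (rho : {linear H -> H}) : Prop :=
  positive_op rho /\ is_trace rho 1.

Definition povm (E : bool -> {linear H -> H}) : Prop :=
  (forall a, positive_op (E a)) /\ (forall u : H, \sum_(a : bool) E a u = u).

End Operators.

Section Tensor.
Variables (R : realType) (HA HB H : hilbertSpace R).
Variable tau : {bilinear HA -> HB -> H}.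

(* H, with elementary tensors tau u v, is the (completed) tensor product of HA
   and HB; this determines (H, tau) up to a unique unitary isomorphism. *)
Definition hilbert_tensor : Prop :=
  (forall u u' v v',
     hdot (tau u v) (tau u' v') = hdot u u' * hdot v v') /\
  dense (lin_span [set w | exists u v, w = tau u v]).

(* T is E (x) F, the unique bounded operator with this action on elementary
   tensors. *)
Definition tensor_op (E : {linear HA -> HA}) (F : {linear HB -> HB})
    (T : {linear H -> H}) : Prop :=
  continuous T /\ forall u v, T (tau u v) = tau (E u) (F v).

End Tensor.

Definition quantum_behaviours (R : realType) : set (behaviour R) :=
  [set p | exists (HA HB H : hilbertSpace R) (tau : {bilinear HA -> HB -> H})
      (rho : {linear H -> H}) (E : 'I_2 -> bool -> {linear HA -> HA})
      (F : 'I_2 -> bool -> {linear HB -> HB}),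
    [/\ hilbert_tensor tau, density_op rho,
        forall r, povm (E r), forall t, povm (F t) &
        forall a b r t, exists T : {linear H -> H},
          tensor_op tau (E r a) (F t b) T /\
          is_trace (fun u => rho (T u)) (p a b r t)%:C%C]].
Arguments quantum_behaviours : clear implicits.

(* Main.v *)
(* Both inclusions pass through finite-dimensional models
   [P(a, b | r, t) = tr (E_r^a c F_t^b c^t* )], with POVMs [E_r], [F_t] and a
   matrix [c] encoding a bipartite pure state.

   A quantum behaviour is approximated by such models: truncate the density
   operator to finitely many basis vectors, control the error by AM-GM for the
   form [<rho u, v>], and approximate the resulting vectors by sums of
   elementary tensors.  After a Naimark dilation the observables [A_1], [A_2] of
   each party are involutions; [A_1 A_2 + A_2 A_1] commutes with both, and on
   each of its eigenspaces they are [x_r . sigma] for unit vectors [x_r] in the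
   plane and anticommuting [sigma_1], [sigma_2].  This splits the model into a
   sum of boxes that are affine in the directions.  The set of convex
   combinations of their behaviours is closed by Caratheodory's theorem and
   compactness, so nothing is lost in the limit.

   Conversely, a function on the sphere that transforms fundamentally is affine,
   and unbiasedness makes its constant term 1/2.  Hence for fixed [a] and [r] the
   conditional distributions of the second party define a positive 2x2 matrix
   [sigma_{a|r}] (after projection onto the plane of [y_1], [y_2]), whose sum
   over [a] is a matrix [rho] independent of [r].  If [rho = Z^t* Z] with [Z]
   invertible, then the [Z^-t* sigma_{a|r} Z^-1] form a POVM of the first party
   that realises the box with [c = Z]; if [rho] is singular it has rank one and
   the box is a product. *)
Require Import Defs.
From HB Require Import structures.
From mathcomp Require Import all_boot all_order all_algebra.
From mathcomp Require Import finmap complex.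
From mathcomp Require Import all_classical all_reals all_analysis.
From mathcomp Require Import measurable_realfun.
From mathcomp Require Import summability.
From mathcomp Require Import ring lra.

Set Implicit Arguments.
Unset Strict Implicit.
Unset Printing Implicit Defensive.

Import Order.TTheory GRing.Theory Num.Theory.
Import numFieldNormedType.Exports.

Local Open Scope classical_set_scope.
Local Open Scope ring_scope.
Local Open Scope sesquilinear_scope.

Local Notation "x %:C" := (real_complex _ x) : ring_scope.
Local Notation "''[' u , v ]" := (hdot u v) : ring_scope.

Local Existing Instance totally_filter.

(** * Positive semidefinite matrices *)

Section Matrices.
Variable C : numClosedFieldType.

(** On an infinite-dimensional space [A_1 A_2 + A_2 A_1] may have continuous spectrum and no
    eigenspaces. This forces the compression to matrices, and with it the approximation error that
    closedness has to absorb. Closedness is proved for mixtures of the boxes [ball_box] because such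
    a box is given by finitely many parameters which positivity alone keeps bounded.

    Weights are never normalised on the way: [cone K w q] and [fd_model w q] carry the total weight
    [w]. Truncated states, eigenspace blocks of weight zero and the members of a mixture can then be
    added without dividing by a possibly vanishing weight. On the matrix side a mixture is a direct
    sum, in which the block label plays the shared randomness; this is why a single vector [c] can
    replace a density matrix.

    The bound [2 <= d] provides a plane of directions for each Clifford pair, and rotations that
    reverse a given coordinate, which makes the Haar averages of linear functions vanish. *)

Lemma adjmxM m n p (A : 'M[C]_(m, n)) (B : 'M[C]_(n, p)) :
  (A *m B)^t* = B^t* *m A^t*.
Proof. by rewrite trmx_mul map_mxM. Qed.

Lemma adjmxD m n (A B : 'M[C]_(m, n)) : (A + B)^t* = A^t* + B^t*.
Proof. by rewrite linearD map_mxD. Qed.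

Lemma adjmxB m n (A B : 'M[C]_(m, n)) : (A - B)^t* = A^t* - B^t*.
Proof. by rewrite linearB map_mxB. Qed.

Lemma adjmxZ m n a (A : 'M[C]_(m, n)) : (a *: A)^t* = a^* *: A^t*.
Proof. by rewrite linearZ map_mxZ. Qed.

Lemma adjmx1 n : (1%:M : 'M[C]_n)^t* = 1%:M.
Proof. by rewrite trmx1 map_mx1. Qed.

Lemma adjmx0 m n : (0 : 'M[C]_(m, n))^t* = 0.
Proof. by rewrite trmx0 map_mx0. Qed.

Lemma adjmx_diag n (D : 'rV[C]_n) :
  (forall i, D 0 i \is Num.real) -> (diag_mx D)^t* = diag_mx D.
Proof.
move=> Dr; apply/matrixP => i j; rewrite !mxE.
case: (eqVneq j i) => [->|]; last by rewrite !mulr0n rmorph0.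
by rewrite !mulr1n; exact: conj_Creal.
Qed.

Lemma mxtrace_adj n (A : 'M[C]_n) : \tr (A^t*) = (\tr A)^*.
Proof. by rewrite /mxtrace rmorph_sum; apply: eq_bigr => i _; rewrite !mxE. Qed.

Lemma trace_mulmx_adj m n (A : 'M[C]_(m, n)) :
  \tr (A *m A^t*) = \sum_i \sum_j `|A i j| ^+ 2.
Proof.
apply: eq_bigr => i _; rewrite mxE; apply: eq_bigr => j _.
by rewrite !mxE normCK.
Qed.

Lemma trace_mulmx_adj_ge0 m n (A : 'M[C]_(m, n)) : 0 <= \tr (A *m A^t*).
Proof.
by rewrite trace_mulmx_adj; do 2!apply: sumr_ge0 => ? _; rewrite exprn_ge0.
Qed.

Lemma trace_mulmx_adj_eq0 m n (A : 'M[C]_(m, n)) :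
  \tr (A *m A^t*) = 0 -> A = 0.
Proof.
rewrite trace_mulmx_adj => /eqP; rewrite psumr_eq0; last first.
  by move=> i _; apply: sumr_ge0 => j _; rewrite exprn_ge0.
move=> /allP A0; apply/matrixP => i j; rewrite mxE.
have /A0 : i \in index_enum _ by rewrite mem_index_enum.
rewrite /= psumr_eq0; last by move=> k _; rewrite exprn_ge0.
move=> /allP /(_ j); rewrite mem_index_enum => /(_ isT) /=.
by rewrite expf_eq0 /= normr_eq0 => /eqP.
Qed.

Lemma trace_sandwich_ge0 m n (X : 'M[C]_m) (Y : 'M[C]_n) (c : 'M[C]_(m, n)) :
  X^t* = X -> Y^t* = Y -> 0 <= \tr (X *m X *m c *m (Y *m Y) *m c^t*).
Proof.
move=> hX hY; have := trace_mulmx_adj_ge0 (X *m c *m Y).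
rewrite !adjmxM hX hY.
have -> : X *m X *m c *m (Y *m Y) *m c^t* = X *m (X *m c *m Y *m (Y *m c^t*)).
  by rewrite !mulmxA.
by rewrite [X in _ -> 0 <= X]mxtrace_mulC !mulmxA.
Qed.

Definition psd n (X : 'M[C]_n) : Prop :=
  X^t* = X /\ forall u : 'cV[C]_n, 0 <= (u^t* *m X *m u) 0 0.

Lemma psd_mul_adj m n (A : 'M[C]_(m, n)) : psd (A^t* *m A).
Proof.
split=> [|u]; first by rewrite adjmxM trmxCK.
have -> : u^t* *m (A^t* *m A) *m u = (A *m u)^t* *m (A *m u).
  by rewrite adjmxM !mulmxA.
rewrite mxE; apply: sumr_ge0 => i _; rewrite !mxE mulrC -normCK.
by rewrite exprn_ge0.
Qed.

Lemma psdD n (X Y : 'M[C]_n) : psd X -> psd Y -> psd (X + Y).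
Proof.
move=> [hX pX] [hY pY]; split=> [|u]; first by rewrite adjmxD hX hY.
by rewrite mulmxDr mulmxDl mxE addr_ge0.
Qed.

Lemma psdZ n a (X : 'M[C]_n) : 0 <= a -> psd X -> psd (a *: X).
Proof.
move=> a0 [hX pX]; split=> [|u].
  by rewrite adjmxZ hX conj_Creal // ger0_real.
by rewrite -scalemxAr -scalemxAl mxE mulr_ge0.
Qed.

Lemma psd_sandwich m n (X : 'M[C]_n) (A : 'M[C]_(n, m)) :
  psd X -> psd (A^t* *m X *m A).
Proof.
move=> [hX pX]; split=> [|u]; first by rewrite !adjmxM trmxCK hX mulmxA.
by have := pX (A *m u); rewrite adjmxM !mulmxA.
Qed.

Lemma herm_spectral n (X : 'M[C]_n) : X^t* = X ->
  exists (U : 'M[C]_n) (D : 'rV[C]_n),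
    [/\ U *m U^t* = 1%:M, U^t* *m U = 1%:M, forall i, D 0 i \is Num.real &
        X = U^t* *m diag_mx D *m U].
Proof.
move=> hX.
have hh : X \is hermsymmx.
  by apply/is_hermitianmxP; rewrite expr0 scale1r hX.
have /mxOverP Dr := hermitian_spectral_diag_real hh.
have /hermitian_normalmx /orthomx_spectralP E := hh.
have uU := spectral_unitarymx X.
exists (spectralmx X), (spectral_diag X); split.
- exact/unitarymxP.
- by rewrite -invmx_unitary // mulVmx // spectral_unit.
- by move=> i; apply: Dr.
- by rewrite -invmx_unitary.
Qed.

(** An eigenvalue is the value of the form at its eigenvector, the [i]-th column of the adjoint of
    [U]; positivity of a form thus yields the signs of the eigenvalues. *)
Lemma spectral_coef n (U : 'M[C]_n) (D : 'rV[C]_n) X i :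
  U *m U^t* = 1%:M -> X = U^t* *m diag_mx D *m U ->
  D 0 i = ((U^t* *m (delta_mx i 0 : 'cV[C]_n))^t* *m X *m
             (U^t* *m (delta_mx i 0 : 'cV[C]_n))) 0 0.
Proof.
move=> UU ->; rewrite adjmxM trmxCK.
rewrite -!mulmxA (mulmxA U (U^t*)) UU mul1mx !mulmxA.
rewrite -(mulmxA _ U (U^t*)) UU mulmx1.
have -> : (delta_mx i 0 : 'cV[C]_n)^t* = delta_mx 0 i.
  by rewrite trmx_delta map_delta_mx.
rewrite -colE -rowE !mxE eqxx mulr1n //.
Qed.

Lemma psd_factor n (X : 'M[C]_n) : psd X -> exists Z : 'M[C]_n, X = Z^t* *m Z.
Proof.
move=> [hX pX]; have [U [D [UU UU' Dr E]]] := herm_spectral hX.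
have D0 i : 0 <= D 0 i by rewrite (spectral_coef i UU E).
pose S : 'rV[C]_n := \row_i sqrtC (D 0 i).
exists (diag_mx S *m U); rewrite adjmxM adjmx_diag; last first.
  by move=> i; rewrite mxE ger0_real // sqrtC_ge0.
rewrite !mulmxA -(mulmxA (U^t*) (diag_mx S) (diag_mx S)) mulmx_diag [LHS]E.
congr (_ *m diag_mx _ *m _); apply/rowP => i.
by rewrite !mxE -expr2 sqrtCK.
Qed.

(** [S] is the defect operator, the square root of [1 - A^2]. It is formed in an eigenbasis of [A],
    hence commutes with [A]; the two hypotheses put the eigenvalues of [A] in [-1, 1]. *)
Lemma contraction_dilation n (A : 'M[C]_n) : psd (1%:M - A) -> psd (1%:M + A) ->
  exists S : 'M[C]_n,
    [/\ S^t* = S, A *m S = S *m A & A *m A + S *m S = 1%:M].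
Proof.
move=> [h1 p1] [_ p2].
have hA : A^t* = A by move: h1; rewrite adjmxB adjmx1 => /addrI/oppr_inj.
have [U [D [UU UU' Dr E]]] := herm_spectral hA.
have E1 : 1%:M - A = U^t* *m diag_mx (const_mx 1 - D) *m U.
  by rewrite linearB /= diag_const_mx mulmxBr mulmxBl mulmx1 UU' -E.
have E2 : 1%:M + A = U^t* *m diag_mx (const_mx 1 + D) *m U.
  by rewrite linearD /= diag_const_mx mulmxDr mulmxDl mulmx1 UU' -E.
have D1 i : D 0 i <= 1.
  by have := p1 _; move=> /(_ (U^t* *m delta_mx i 0)); rewrite -(spectral_coef i UU E1)
    !mxE subr_ge0.
have D2 i : -1 <= D 0 i.
  have := p2 (U^t* *m delta_mx i 0); rewrite -(spectral_coef i UU E2) !mxE.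
  by rewrite -lerBlDl sub0r.
have D3 i : 0 <= 1 - D 0 i ^+ 2.
  have -> : 1 - D 0 i ^+ 2 = (1 - D 0 i) * (1 + D 0 i) by ring.
  by rewrite mulr_ge0 // ?subr_ge0 // -lerBlDl sub0r.
pose S : 'rV[C]_n := \row_i sqrtC (1 - D 0 i ^+ 2).
have mulU (F G : 'rV[C]_n) : (U^t* *m diag_mx F *m U) *m (U^t* *m diag_mx G *m U)
    = U^t* *m diag_mx (\row_i (F 0 i * G 0 i)) *m U.
  by rewrite -!mulmxA (mulmxA U) UU mul1mx -mulmx_diag !mulmxA.
exists (U^t* *m diag_mx S *m U); split.
- rewrite !adjmxM trmxCK adjmx_diag ?mulmxA // => i.
  by rewrite mxE ger0_real // sqrtC_ge0.
- rewrite E !mulU; congr (_ *m diag_mx _ *m _).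
  by apply/rowP => i; rewrite !mxE mulrC.
- rewrite E !mulU -mulmxDl -mulmxDr -linearD /=.
  rewrite -[RHS]UU' -[X in _ = X *m _]mulmx1 -diag_const_mx.
  congr (_ *m diag_mx _ *m _); apply/rowP => i.
  by rewrite !mxE -!expr2 sqrtCK addrC subrK.
Qed.

(** Projections onto full eigenspaces rather than single eigenvectors: only these commute with
    everything that commutes with [G]. *)
Lemma spectral_projections n (G : 'M[C]_n) : G^t* = G ->
  exists (P : 'I_n -> 'M[C]_n) (l : 'I_n -> C),
  [/\ forall k, (P k)^t* = P k /\ P k *m P k = P k,
      forall k k', k != k' -> P k *m P k' = 0,
      \sum_k P k = 1%:M,
      forall k, l k \is Num.real /\ G *m P k = l k *: P k &
      forall k (X : 'M[C]_n), X *m G = G *m X -> X *m P k = P k *m X].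
Proof.
move=> hG; have [U [D [UU UU' Dr E]]] := herm_spectral hG.
(* A canonical index for each eigenvalue. [P k] projects onto the eigenspace of [D 0 k] if [k] is
   canonical and is zero otherwise, so all of ['I_n] can serve as index set. *)
pose rep (i : 'I_n) : 'I_n := odflt i [pick j | D 0 j == D 0 i].
have repD i : D 0 (rep i) = D 0 i.
  by rewrite /rep; case: pickP => [j /eqP|].
have repE i j : D 0 i = D 0 j -> rep i = rep j.
  move=> ij; rewrite /rep ij.
  by case: pickP => // /(_ j); rewrite eqxx.
pose p k : 'rV[C]_n := \row_i (rep i == k)%:R.
have pr k i : p k 0 i \is Num.real by rewrite mxE realn.
have mulU (F H : 'rV[C]_n) : (U^t* *m diag_mx F *m U) *m (U^t* *m diag_mx H *m U)
    = U^t* *m diag_mx (\row_i (F 0 i * H 0 i)) *m U.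
  by rewrite -!mulmxA (mulmxA U) UU mul1mx -mulmx_diag !mulmxA.
exists (fun k => U^t* *m diag_mx (p k) *m U), (fun k => D 0 k); split.
- move=> k; split; first by rewrite !adjmxM trmxCK adjmx_diag ?mulmxA.
  rewrite mulU; congr (_ *m diag_mx _ *m _); apply/rowP => i.
  by rewrite !mxE -natrM mulnb andbb.
- move=> k k' kk'; rewrite mulU.
  rewrite (_ : (\row_i _) = 0) ?linear0 ?mulmx0 ?mul0mx //.
  apply/rowP => i; rewrite !mxE -natrM mulnb.
  by case: eqP => //= ->; rewrite (negbTE kk').
- rewrite -mulmx_suml -mulmx_sumr -linear_sum /=.
  rewrite (_ : \sum_k p k = const_mx 1) ?diag_const_mx ?mulmx1 //.
  apply/rowP => i; rewrite summxE !mxE (bigD1 (rep i)) //= mxE eqxx.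
  by rewrite big1 ?addr0 // => k; rewrite mxE eq_sym => /negbTE ->.
- move=> k; split; first exact: Dr.
  rewrite E mulU scalemxAl scalemxAr -linearZ /=.
  congr (_ *m diag_mx _ *m _); apply/rowP => i; rewrite !mxE.
  case: (eqVneq (rep i) k) => [<-|_]; first by rewrite repD.
  by rewrite !mulr0.
- move=> k X.
  have [Y EX] : exists Y, X = U^t* *m Y *m U.
    exists (U *m X *m U^t*).
    by rewrite -!mulmxA UU' mulmx1 !mulmxA UU' mul1mx.
  have conjU (F H : 'M[C]_n) :
      U^t* *m F *m U *m (U^t* *m H *m U) = U^t* *m (F *m H) *m U.
    by rewrite -!mulmxA (mulmxA U) UU mul1mx.
  have injU (F H : 'M[C]_n) : U^t* *m F *m U = U^t* *m H *m U -> F = H.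
    move=> /(congr1 (fun Z => U *m Z *m U^t*)).
    by rewrite !mulmxA UU !mul1mx -!mulmxA UU !mulmx1.
  rewrite EX E !conjU => /injU YD; congr (_ *m _ *m _).
  (* In the eigenbasis commutation reads [Y i j * D 0 j = D 0 i * Y i j], so [Y i j] vanishes unless
     the two eigenvalues, and hence their representatives, agree. *)
  apply/matrixP => i j; have := congr1 (fun Z : 'M[C]_n => Z i j) YD.
  rewrite !mul_mx_diag !mul_diag_mx {YD} => YD; move: YD.
  rewrite !mxE => YD.
  have [->|Y0] := eqVneq (Y i j) 0; first by rewrite mulr0 mul0r.
  have /repE -> : D 0 i = D 0 j by apply: (mulfI Y0); rewrite YD mulrC.
  by rewrite mulrC.
Qed.

End Matrices.

(** * Pairs of involutions on an eigenspace of their anticommutator *)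

Section Clifford.
Variable R : realType.
Local Notation C := R[i].

Lemma conj_rC (x : R) : (x%:C)^* = x%:C.
Proof. by apply: conj_Creal; rewrite complex_real. Qed.

Definition pm {K : pzRingType} (a : bool) : K := if a then 1 else -1.

Lemma quad_scalar n (X Y P : 'M[C]_n) (a b p q r : C) :
  X *m X *m P = p *: P -> Y *m Y *m P = q *: P ->
  (X *m Y + Y *m X) *m P = r *: P ->
  (a *: X + b *: Y) *m (a *: X + b *: Y) *m P
    = (a ^+ 2 * p + b ^+ 2 * q + a * b * r) *: P.
Proof.
move=> EX EY; rewrite mulmxDl => EXY.
have sq (u v : C) U V : (u *: U) *m (v *: V) *m P = (u * v) *: (U *m V *m P).
  by rewrite -scalemxAl -scalemxAr scalerA -scalemxAl.
rewrite mulmxDl [in X in X + _]mulmxDr [in X in _ + X]mulmxDr.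
rewrite !(mulmxDl _ _ P) !sq EX EY (mulrC b a) !scalerDl -!scalerA -EXY !scalerDr.
rewrite !(scalerA, expr2) -!addrA; congr (_ + _).
by rewrite addrA addrC.
Qed.

(** The trace of [P X] times its adjoint is nonnegative and equals [e * \tr P], where
    [\tr P > 0]. *)
Lemma scalar_square_ge0 n (X P : 'M[C]_n) (e : C) :
  X^t* = X -> P^t* = P -> P *m P = P -> P != 0 ->
  X *m X *m P = e *: P -> 0 <= e.
Proof.
move=> hX hP PP P0 E.
have tP : 0 < \tr P.
  have := trace_mulmx_adj_ge0 P; rewrite hP PP le_eqVlt => /orP[/eqP|//].
  move=> t0; have := trace_mulmx_adj_eq0 (A := P); rewrite hP PP => /(_ (esym t0)) P00.
  by rewrite P00 eqxx in P0.
have := trace_mulmx_adj_ge0 (P *m X); rewrite adjmxM hX hP.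
have -> : P *m X *m (X *m P) = P *m (X *m X *m P) by rewrite !mulmxA.
by rewrite E -scalemxAr PP mxtraceZ pmulr_lge0.
Qed.

(** Gram-Schmidt for the inner product given by half the anticommutator: [g = l / 2] is the cosine
    between [A] and [B], and [B - g A] is orthogonal to [A], that is, anticommutes with it on [P].
    If [B = g A] there, the inverse of zero makes [S] zero; hence the square [e] of [S], which is 0
    or 1. *)
Lemma clifford_plane n (A B : 'M[C]_n) (P : 'M[C]_n) (l : C) :
  A^t* = A -> B^t* = B -> A *m A = 1%:M -> B *m B = 1%:M ->
  P^t* = P -> P *m P = P -> P != 0 -> l \is Num.real ->
  (A *m B + B *m A) *m P = l *: P ->
  exists (S : 'M[C]_n) (g h e : R),
    [/\ S^t* = S /\ g ^+ 2 + h ^+ 2 = 1,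
        B *m P = (g%:C *: A + h%:C *: S) *m P,
        0 <= e <= 1, S *m S *m P = e%:C *: P & (A *m S + S *m A) *m P = 0].
Proof.
move=> hA hB AA BB hP PP P0 lr E.
have [g Eg] : exists g : R, l = (2 * g)%:C.
  exists (complex.Re l / 2); rewrite mulrC divfK ?pnatr_eq0 //.
  by rewrite RRe_real.
have AAP : A *m A *m P = 1 *: P by rewrite AA mul1mx scale1r.
have BBP : B *m B *m P = 1 *: P by rewrite BB mul1mx scale1r.
have bound (a b : R) : 0 <= a ^+ 2 + b ^+ 2 + a * b * (2 * g).
  have hX : (a%:C *: A + b%:C *: B)^t* = a%:C *: A + b%:C *: B.
    by rewrite adjmxD !adjmxZ hA hB !conj_rC.
  have := scalar_square_ge0 hX hP PP P0 (quad_scalar a%:C b%:C AAP BBP E).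
  by rewrite !mulr1 Eg -!rmorphXn -!rmorphM -!rmorphD /= ler0c.
have g2 : 0 <= 1 - g ^+ 2.
  have := bound (- g) 1; congr (_ <= _); ring.
set h := Num.sqrt (1 - g ^+ 2).
have h2 : h ^+ 2 = 1 - g ^+ 2 by rewrite sqr_sqrtr.
pose X := (- g)%:C *: A + 1%:C *: B.
have hX : X^t* = X by rewrite adjmxD !adjmxZ hA hB !conj_rC.
have XXP : X *m X *m P = (h ^+ 2)%:C *: P.
  rewrite (quad_scalar _ _ AAP BBP E) Eg h2 !mulr1 -!rmorphXn -!rmorphM -!rmorphD.
  by congr (real_complex _ _ *: _); ring.
have BE : B = g%:C *: A + X.
  by rewrite /X rmorphN scaleNr addrA subrr add0r rmorph1 scale1r.
have XA : (A *m X + X *m A) *m P = 0.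
  have -> : A *m X + X *m A = (- (2 * g))%:C *: 1%:M + (A *m B + B *m A).
    rewrite /X mulmxDl mulmxDr -!scalemxAl -!scalemxAr AA rmorph1 !scale1r.
    by rewrite addrACA -scalerDl -rmorphD; congr (real_complex _ _ *: _ + _); ring.
  by rewrite mulmxDl E Eg -scalemxAl mul1mx -scalerDl -rmorphD addNr scale0r.
clearbody X.
exists ((h^-1)%:C *: X), g, h, (h^-1 ^+ 2 * h ^+ 2); split.
- by rewrite adjmxZ hX conj_rC h2; split => //; ring.
- rewrite scalerA -rmorphM.
  (* In the degenerate case [X] vanishes on [P], because [P X X P = h ^+ 2 P = 0]. *)
  have [h0|h0] := eqVneq h 0; last by rewrite divff // scale1r -BE.
  have XP : X *m P = 0.
    have : (X *m P)^t* *m (X *m P) = 0.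
      by rewrite adjmxM hX hP mulmxA -(mulmxA P) -mulmxA XXP h0 expr0n scale0r mulmx0.
    move=> T0; have := trace_mulmx_adj_eq0 (A := (X *m P)^t*).
    rewrite trmxCK T0 mxtrace0 => /(_ erefl) T1.
    by rewrite -[LHS]trmxCK T1 adjmx0.
  by rewrite {1}BE !mulmxDl -!scalemxAl XP scaler0.
- have [->|h0] := eqVneq h 0; first by rewrite expr0n mulr0 lexx ler01.
  by rewrite exprVn mulVf ?expf_neq0 // ler01 lexx.
- rewrite -!scalemxAl -!scalemxAr -scalemxAl XXP !scalerA -!rmorphM.
  by congr (real_complex _ _ *: _); ring.
- by rewrite -scalemxAl -scalemxAr -scalerDr -scalemxAl XA scaler0.
Qed.

End Clifford.

(** * Ball boxes *)

Section BallBoxes.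
Variable R : realType.
Local Notation C := R[i].

Definition dotc d (u x : 'cV[R]_d) : R := \sum_i u i 0 * x i 0.

Definition bilc d (T : 'M[R]_d) (x y : 'cV[R]_d) : R :=
  \sum_i \sum_j x i 0 * T i j * y j 0.

(** [u] and [v] are the local Bloch vectors and [T] is the correlation tensor: this is the general
    affine box whose marginals have constant term 1/2. *)
Definition ball_box d (u v : 'cV[R]_d) (T : 'M[R]_d) (a b : bool)
    (x y : 'cV[R]_d) : R :=
  4^-1 * (1 + pm a * dotc u x + pm b * dotc v y + pm a * pm b * bilc T x y).

Definition ball_behaviours d : set (behaviour R) :=
  [set p | exists (u v : 'cV[R]_d) (T : 'M[R]_d) (x y : 'I_2 -> 'cV[R]_d),
    [/\ forall r, sphere (x r), forall t, sphere (y t),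
        forall a b x y, sphere x -> sphere y -> 0 <= ball_box u v T a b x y &
        forall a b r t, p a b r t = ball_box u v T a b (x r) (y t)]].

(** Nonnegative combinations of members of [K], with the total weight as index; at weight 1 this is
    the convex hull, by [cone1_convex_hull]. *)
Inductive cone (K : set (behaviour R)) : R -> behaviour R -> Prop :=
| cone_nil q : (forall a b r t, q a b r t = 0) -> cone K 0 q
| cone_cons w z q k q' : 0 <= w -> K k -> cone K z q ->
    (forall a b r t, q' a b r t = w * k a b r t + q a b r t) ->
    cone K (w + z) q'.

Lemma cone_add K w q w' q' q'' : cone K w q -> cone K w' q' ->
  (forall a b r t, q'' a b r t = q a b r t + q' a b r t) -> cone K (w + w') q''.
Proof.
move=> c; elim: c w' q' q'' => {w q} [q q0|w z q k q1 w0 Kk _ IH E1] w' q' q'' c' E.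
  rewrite add0r; rewrite (_ : q'' = q') //.
  by do 4!apply/funext => ?; rewrite E q0 add0r.
rewrite -addrA; apply: (cone_cons (q := fun a b r t => q a b r t + q' a b r t) w0 Kk).
  exact: (IH _ _ _ c').
by move=> a b r t; rewrite E E1 addrA.
Qed.

Lemma cone_sum K (I : finType) (w : I -> R) (q : I -> behaviour R) :
  (forall i, cone K (w i) (q i)) ->
  cone K (\sum_i w i) (fun a b r t => \sum_i q i a b r t).
Proof.
move=> H; rewrite -big_enum.
rewrite (_ : (fun _ => _) = (fun a b r t => \sum_(i <- enum I) q i a b r t)); last first.
  by do 4!apply/funext => ?; rewrite big_enum.
elim: (enum I) => [|i s IH]; first by rewrite big_nil; apply: cone_nil => *; rewrite big_nil.
rewrite big_cons; apply: (cone_add (H i) IH) => *; by rewrite big_cons.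
Qed.

Lemma cone_scale K s w q q' : 0 <= s -> cone K w q ->
  (forall a b r t, q' a b r t = s * q a b r t) -> cone K (s * w) q'.
Proof.
move=> s0 c; elim: c q' => {w q} [q q0|w z q k q1 w0 Kk _ IH E1] q' E.
  by rewrite mulr0; apply: cone_nil => *; rewrite E q0 mulr0.
rewrite mulrDr; apply: (cone_cons (q := fun a b r t => s * q a b r t) _ Kk).
- exact: mulr_ge0.
- exact: IH.
- by move=> *; rewrite E E1 mulrDr mulrA.
Qed.

Lemma cone1_convex_hull K q : cone K 1 q <-> convex_hull K q.
Proof.
split=> [c|[n [w [k [w0 w1 Kk E]]]]].
  suff H z : cone K z q -> exists (n : nat) (w : 'I_n -> R) (k : 'I_n -> behaviour R),
    [/\ forall i, 0 <= w i, \sum_(i < n) w i = z, forall i, K (k i) &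
        forall a b r t, q a b r t = \sum_(i < n) w i * k i a b r t] by exact: H.
  elim=> {c q z} [q q0|w z q k q1 w0 Kk _ [n [w' [k' [w'0 w'1 Kk' E']]]] E].
    exists 0%N, (fun=> 0), (fun=> q); split => [//||[]//|*]; rewrite big_ord0 //.
  exists n.+1, (fun i => oapp w' w (unlift ord0 i)),
    (fun i => oapp k' k (unlift ord0 i)); split.
  - by move=> i; case: unliftP => [j _|_] /=.
  - rewrite big_ord_recl unlift_none /= -w'1; congr (_ + _).
    by apply: eq_bigr => i _; rewrite liftK.
  - by move=> i; case: unliftP => [j _|_] /=.
  - move=> a b r t; rewrite big_ord_recl unlift_none /= E E'; congr (_ + _).
    by apply: eq_bigr => i _; rewrite liftK.
rewrite -w1 (_ : q = fun a b r t => \sum_(i < n) w i * k i a b r t); last first.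
  by do 4!apply/funext => ?; exact: E.
apply: (cone_sum (q := fun i a b r t => w i * k i a b r t)) => i.
rewrite -[X in cone _ X]addr0; apply: (cone_cons (q := fun _ _ _ _ => 0) (w0 i) (Kk i)).
  by apply: cone_nil.
by move=> *; rewrite addr0.
Qed.

Definition vecmx d n (s : 'I_d -> 'M[C]_n) (x : 'cV[R]_d) : 'M[C]_n :=
  \sum_i (x i 0)%:C *: s i.

Lemma vecmx_herm d n (s : 'I_d -> 'M[C]_n) x :
  (forall i, (s i)^t* = s i) -> (vecmx s x)^t* = vecmx s x.
Proof.
move=> hs; rewrite /vecmx raddf_sum /= map_mx_sum; apply: eq_bigr => i _.
by rewrite adjmxZ hs conj_rC.
Qed.

(** The plane of [clifford_plane] is placed on the first two axes and the other axes get the zero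
    matrix. A unit vector [y] partly outside the plane therefore squares to less than 1; the defect
    [k] collects those coordinates and a degenerate [S]. *)
Lemma clifford_sphere d n (A : 'I_2 -> 'M[C]_n) (P : 'M[C]_n) (l : C) :
  (1 < d)%N ->
  (forall r, (A r)^t* = A r) -> (forall r, A r *m A r = 1%:M) ->
  P^t* = P -> P *m P = P -> P != 0 -> l \is Num.real ->
  (A 0 *m A 1 + A 1 *m A 0) *m P = l *: P ->
  exists (s : 'I_d -> 'M[C]_n) (x : 'I_2 -> 'cV[R]_d),
    [/\ forall i, (s i)^t* = s i, forall r, sphere (x r),
        forall r, A r *m P = vecmx s (x r) *m P &
        forall y, sphere y -> exists2 k : R, 0 <= k &
          vecmx s y *m vecmx s y *m P = (1 - k)%:C *: P].
Proof.
case: d => [|[|d]] // _ hA AA hP PP P0 lr E.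
have [S [g [h [e [[hS gh] A1 /andP[e0 e1] SS AS]]]]] :=
  clifford_plane (hA 0) (hA 1) (AA 0) (AA 1) hP PP P0 lr E.
pose s (i : 'I_d.+2) := if i == 0 then A 0 else if i == 1 then S else 0.
have sE (y : 'cV[R]_d.+2) : vecmx s y = (y 0 0)%:C *: A 0 + (y 1 0)%:C *: S.
  rewrite /vecmx !big_ord_recl /s eqxx /= big1 ?addr0; last first.
    by move=> i _; rewrite scaler0.
  by rewrite (_ : lift ord0 ord0 = 1) //; apply/val_inj.
have sphE (y : 'cV[R]_d.+2) : \sum_i y i 0 ^+ 2 =
    y 0 0 ^+ 2 + y 1 0 ^+ 2 + \sum_(i < d) y (lift ord0 (lift ord0 i)) 0 ^+ 2.
  rewrite !big_ord_recl addrA; congr (_ + _ ^+ 2 + _).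
  by congr (y _ _); apply/val_inj.
pose x (r : 'I_2) : 'cV[R]_d.+2 := \col_i (if i == 0 then (if r == 0 then 1 else g)
   else if i == 1 then (if r == 0 then 0 else h) else 0).
exists s, x; split.
- move=> i; rewrite /s; case: ifP => // _; case: ifP => // _.
  by rewrite adjmx0.
- move=> r; rewrite /sphere /= sphE big1 ?addr0; last by move=> i _; rewrite mxE /= expr0n.
  by rewrite !mxE /=; case: ifP => _; rewrite ?gh // expr1n expr0n addr0.
- move=> r; rewrite sE !mxE /=.
  have /orP[/eqP->|/eqP->] : (r == 0) || (r == 1).
  + by case: r => [[|[|]]].
  + by rewrite eqxx rmorph1 rmorph0 scale1r scale0r addr0.
  + by rewrite /= A1.
- move=> y; rewrite /sphere /= sphE => y1.
  have AAP : A 0 *m A 0 *m P = 1 *: P by rewrite AA mul1mx scale1r.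
  have ASP : (A 0 *m S + S *m A 0) *m P = 0 *: P by rewrite AS scale0r.
  have t0 : 0 <= \sum_(i < d) y (lift ord0 (lift ord0 i)) 0 ^+ 2.
    by apply: sumr_ge0 => i _; rewrite sqr_ge0.
  exists (1 - (y 0 0 ^+ 2 + y 1 0 ^+ 2 * e)).
    rewrite subr_ge0 -y1 -[leLHS]addr0 lerD // lerD2l.
    by rewrite -[leRHS]mulr1 ler_wpM2l // sqr_ge0.
  rewrite sE (quad_scalar _ _ AAP SS ASP) mulr0 addr0 mulr1.
  by rewrite -!rmorphXn -!rmorphM -!rmorphD subKr.
Qed.

End BallBoxes.

(** * Finite-dimensional models *)

Section FiniteModels.
Variable R : realType.
Local Notation C := R[i].

(** The expectation of [X] tensor the transpose of [Y] in the bipartite vector with coefficient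
    matrix [c]. *)
Definition corr n m (c : 'M[C]_(n, m)) (X : 'M[C]_n) (Y : 'M[C]_m) : C :=
  \tr (X *m c *m Y *m c^t*).

Lemma corrDl n m c (X X' : 'M[C]_n) (Y : 'M[C]_m) :
  corr c (X + X') Y = corr c X Y + corr c X' Y.
Proof. by rewrite /corr !mulmxDl mxtraceD. Qed.

Lemma corrZl n m c a (X : 'M[C]_n) (Y : 'M[C]_m) :
  corr c (a *: X) Y = a * corr c X Y.
Proof. by rewrite /corr -!scalemxAl mxtraceZ. Qed.

Lemma corrDr n m c (X : 'M[C]_n) (Y Y' : 'M[C]_m) :
  corr c X (Y + Y') = corr c X Y + corr c X Y'.
Proof. by rewrite /corr mulmxDr mulmxDl mxtraceD. Qed.

Lemma corrZr n m c a (X : 'M[C]_n) (Y : 'M[C]_m) :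
  corr c X (a *: Y) = a * corr c X Y.
Proof. by rewrite /corr -scalemxAr -scalemxAl mxtraceZ. Qed.

Lemma corr_vecl d n m c (s : 'I_d -> 'M[C]_n) x (Y : 'M[C]_m) :
  corr c (vecmx s x) Y = \sum_i (x i 0)%:C * corr c (s i) Y.
Proof.
rewrite /corr /vecmx !mulmx_suml raddf_sum; apply: eq_bigr => i _.
by rewrite -corrZl.
Qed.

Lemma corr_vecr d n m c (X : 'M[C]_n) (s : 'I_d -> 'M[C]_m) y :
  corr c X (vecmx s y) = \sum_i (y i 0)%:C * corr c X (s i).
Proof.
rewrite /corr /vecmx !mulmx_sumr mulmx_suml raddf_sum; apply: eq_bigr => i _.
by rewrite -corrZr.
Qed.

Lemma corr_real n m c (X : 'M[C]_n) (Y : 'M[C]_m) : X^t* = X -> Y^t* = Y ->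
  corr c X Y = (complex.Re (corr c X Y))%:C.
Proof.
move=> hX hY; rewrite RRe_real //; apply/CrealP; rewrite /corr -mxtrace_adj.
by rewrite !adjmxM trmxCK hX hY !mulmxA mxtrace_mulC !mulmxA.
Qed.

Lemma corr_eq n m (c : 'M[C]_(n, m)) X X' Y Y' : X *m c = X' *m c ->
  c *m Y = c *m Y' -> corr c X Y = corr c X' Y'.
Proof. by move=> E E'; rewrite /corr E -(mulmxA X') E' mulmxA. Qed.

Lemma corr_square_ge0 n m (c : 'M[C]_(n, m)) X Y : X^t* = X -> Y^t* = Y ->
  0 <= corr c (X *m X) (Y *m Y).
Proof. exact: trace_sandwich_ge0. Qed.

(* [1 + S = ((1 + S)^2 + (1 - S^2)) / 2] reduces the positivity of [1 + S] on the
   support of [c] to that of squares. *)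
Lemma one_plus_half_square n m (c : 'M[C]_(n, m)) (S : 'M[C]_n) (k : C) :
  S *m S *m c = (1 - k) *: c ->
  (1%:M + S) *m c =
    (2^-1 *: ((1%:M + S) *m (1%:M + S)) + (k / 2) *: (1%:M *m 1%:M)) *m c.
Proof.
move=> E; rewrite !mulmxDl !mulmxDr !mul1mx !mulmx1 -!scalemxAl !mulmxDl E !mul1mx.
apply/matrixP => i j; rewrite !mxE; move: (\sum_ _ _) => z; by field.
Qed.

(** The squares of [S] and [S'] are controlled only on the support of [c], so [1 + S] need not be a
    positive matrix. By [corr_eq] it may be replaced by an operator that agrees with it on that
    support, here a positive combination of squares. *)
Lemma corr_one_plus_ge0 n m (c : 'M[C]_(n, m)) (S : 'M[C]_n) (S' : 'M[C]_m)
    (k k' : R) : S^t* = S -> S'^t* = S' -> 0 <= k -> 0 <= k' ->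
  S *m S *m c = (1 - k)%:C *: c -> S' *m S' *m c^t* = (1 - k')%:C *: c^t* ->
  0 <= corr c (1%:M + S) (1%:M + S').
Proof.
move=> hS hS' k0 k'0; rewrite !rmorphB !rmorph1 => E E'.
have h1 j (Z : 'M[C]_j) : Z^t* = Z -> (1%:M + Z)^t* = 1%:M + Z.
  by move=> hZ; rewrite adjmxD adjmx1 hZ.
have hh j (Z : 'M[C]_j) (z : R) : Z^t* = Z ->
    (2^-1 *: (Z *m Z) + (z%:C / 2) *: (1%:M *m 1%:M))^t* =
     2^-1 *: (Z *m Z) + (z%:C / 2) *: (1%:M *m 1%:M).
  move=> hZ; rewrite adjmxD !adjmxZ !adjmxM adjmx1 hZ.
  by rewrite !conj_Creal // ?realM ?realV ?realn ?complex_real.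
have /(congr1 (fun M => M^t*)) := one_plus_half_square E'.
rewrite !adjmxM trmxCK h1 // hh ?h1 // => E'2.
rewrite (corr_eq (one_plus_half_square E) E'2).
rewrite !corrDl !corrDr !corrZl !corrZr.
have p2 : 0 <= 2^-1 :> C by rewrite invr_ge0 ler0n.
have pk z : 0 <= z -> 0 <= z%:C / 2 :> C by move=> z0; rewrite mulr_ge0 // ler0c.
by do ?[exact: p2 | exact: pk | apply: corr_square_ge0; rewrite ?h1 ?adjmx1 //
  | apply: addr_ge0 | apply: mulr_ge0].
Qed.

Lemma pm_real (a : bool) : (pm a : C) = (pm a : R)%:C.
Proof. by case: a; rewrite /pm ?rmorphN ?rmorph1. Qed.

Lemma ball_box_corr d n m (c : 'M[C]_(n, m)) (w : R) (s : 'I_d -> 'M[C]_n)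
    (s' : 'I_d -> 'M[C]_m) a b x y : w != 0 ->
  w%:C = corr c 1%:M 1%:M ->
  (forall i, (s i)^t* = s i) -> (forall i, (s' i)^t* = s' i) ->
  (4 * w * ball_box (\col_i (complex.Re (corr c (s i) 1%:M) / w))
    (\col_i (complex.Re (corr c 1%:M (s' i)) / w))
    (\matrix_(i, j) (complex.Re (corr c (s i) (s' j)) / w)) a b x y)%:C =
  corr c (1%:M + pm a *: vecmx s x) (1%:M + pm b *: vecmx s' y).
Proof.
move=> w0 wE hs hs'; rewrite corrDl !corrDr !corrZl !corrZr -wE.
rewrite [corr _ (vecmx _ _) 1%:M]corr_vecl corr_vecr corr_vecl.
have -> : (\sum_i (y i 0)%:C * corr c 1%:M (s' i)) =
    (\sum_i y i 0 * complex.Re (corr c 1%:M (s' i)))%:C.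
  rewrite rmorph_sum; apply: eq_bigr => i _.
  by rewrite (corr_real _ (adjmx1 _ _) (hs' i)) rmorphM.
have -> : (\sum_i (x i 0)%:C * corr c (s i) 1%:M) =
    (\sum_i x i 0 * complex.Re (corr c (s i) 1%:M))%:C.
  rewrite rmorph_sum; apply: eq_bigr => i _.
  by rewrite (corr_real _ (hs i) (adjmx1 _ _)) rmorphM.
have -> : (\sum_i (x i 0)%:C * corr c (s i) (vecmx s' y)) =
    (\sum_i \sum_j x i 0 * complex.Re (corr c (s i) (s' j)) * y j 0)%:C.
  rewrite rmorph_sum; apply: eq_bigr => i _; rewrite corr_vecr rmorph_sum mulr_sumr.
  apply: eq_bigr => j _.
  by rewrite (corr_real _ (hs i) (hs' j)) !rmorphM mulrA mulrAC.
rewrite !pm_real -!rmorphM -!rmorphD; congr (real_complex _ _).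
rewrite /ball_box.
have -> : dotc (\col_i (complex.Re (corr c (s i) 1%:M) / w)) x =
    (\sum_i x i 0 * complex.Re (corr c (s i) 1%:M)) / w.
  by rewrite mulr_suml; apply: eq_bigr => i _; rewrite mxE mulrC mulrA.
have -> : dotc (\col_i (complex.Re (corr c 1%:M (s' i)) / w)) y =
    (\sum_i y i 0 * complex.Re (corr c 1%:M (s' i))) / w.
  by rewrite mulr_suml; apply: eq_bigr => i _; rewrite mxE mulrC mulrA.
have -> : bilc (\matrix_(i, j) (complex.Re (corr c (s i) (s' j)) / w)) x y =
    (\sum_i \sum_j x i 0 * complex.Re (corr c (s i) (s' j)) * y j 0) / w.
  rewrite mulr_suml; apply: eq_bigr => i _; rewrite mulr_suml.
  by apply: eq_bigr => j _; rewrite mxE; ring.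
by field.
Qed.

(** One pair of eigenspaces contributes a single box. The behaviour only probes the directions [x r]
    and [y t], but the box must be positive at all unit vectors, which is what the defect bounds of
    [clifford_sphere] supply. *)
Lemma block_cone d n m (A : 'I_2 -> 'M[C]_n) (B : 'I_2 -> 'M[C]_m)
    (c : 'M[C]_(n, m)) P Q (l l' : C) (w : R) (q : behaviour R) : (1 < d)%N ->
  (forall r, (A r)^t* = A r) -> (forall r, A r *m A r = 1%:M) ->
  P^t* = P -> P *m P = P -> l \is Num.real ->
  (A 0 *m A 1 + A 1 *m A 0) *m P = l *: P ->
  (forall r, (B r)^t* = B r) -> (forall r, B r *m B r = 1%:M) ->
  Q^t* = Q -> Q *m Q = Q -> l' \is Num.real ->
  (B 0 *m B 1 + B 1 *m B 0) *m Q = l' *: Q ->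
  P *m c = c -> c *m Q = c -> w%:C = corr c 1%:M 1%:M ->
  (forall a b r t, (4 * q a b r t)%:C =
     corr c (1%:M + pm a *: A r) (1%:M + pm b *: B t)) ->
  cone (ball_behaviours d) w q.
Proof.
move=> d1 hA AA hP PP lr E hB BB hQ QQ l'r E' Pc cQ wE qE.
(* An empty block cannot be normalised to a box; it contributes weight zero. *)
have [c0|c0] := eqVneq c 0.
  have -> : w = 0.
    by apply: complexI; rewrite wE c0 /corr mulmx0 !mul0mx mxtrace0.
  apply: cone_nil => a b r t; apply/eqP.
  have : 4 * q a b r t = 0.
    by apply: complexI; rewrite qE c0 /corr mulmx0 !mul0mx mxtrace0.
  by move/eqP; rewrite mulf_eq0 pnatr_eq0.
have P0 : P != 0 by apply: contra c0 => /eqP P0; rewrite -Pc P0 mul0mx.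
have Q0 : Q != 0 by apply: contra c0 => /eqP Q0; rewrite -cQ Q0 mulmx0.
have Qc : Q *m c^t* = c^t* by rewrite -[in RHS]cQ adjmxM hQ.
have w0 : 0 < w.
  have : 0 <= w%:C by rewrite wE /corr mul1mx mulmx1 trace_mulmx_adj_ge0.
  rewrite ler0c le_eqVlt => /orP[/eqP w0|//].
  have := trace_mulmx_adj_eq0 (A := c); move: wE; rewrite -w0 /corr mul1mx mulmx1 => <-.
  by move=> /(_ erefl) c00; rewrite c00 eqxx in c0.
have [s [x [hs sx Ax sP]]] := clifford_sphere d1 hA AA hP PP P0 lr E.
have [s' [y [hs' sy By sQ]]] := clifford_sphere d1 hB BB hQ QQ Q0 l'r E'.
have boxE := ball_box_corr _ _ _ _ (lt0r_neq0 w0) wE hs hs'.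
set u := \col_i _ in boxE; set v := \col_i _ in boxE; set T := \matrix_(i, j) _ in boxE.
rewrite -[w]addr0; apply: (cone_cons (q := fun _ _ _ _ => 0) (ltW w0)
  (k := fun a b r t => ball_box u v T a b (x r) (y t))).
- exists u, v, T, x, y; split => // a b x' y' sx' sy'.
  have := boxE a b x' y'; set z := ball_box _ _ _ _ _ _ _ => zE.
  have [k k0 sPk] := sP _ sx'; have [k' k'0 sQk] := sQ _ sy'.
  suff : 0 <= (4 * w * z)%:C by rewrite ler0c pmulr_rge0 // mulr_gt0.
  rewrite zE; apply: (corr_one_plus_ge0 (k := k) (k' := k')) => //.
  + by rewrite adjmxZ vecmx_herm // pm_real conj_rC.
  + by rewrite adjmxZ vecmx_herm // pm_real conj_rC.
  + rewrite -!scalemxAl -!scalemxAr -!scalemxAl scalerA -expr2 (_ : pm a ^+ 2 = 1) ?scale1r.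
      by rewrite -{1}Pc mulmxA sPk -scalemxAl Pc.
    by case: a {zE z}; rewrite /pm ?sqrrN expr1n.
  + rewrite -!scalemxAl -!scalemxAr -!scalemxAl scalerA -expr2 (_ : pm b ^+ 2 = 1) ?scale1r.
      by rewrite -{1}Qc mulmxA sQk -scalemxAl Qc.
    by case: b {zE z}; rewrite /pm ?sqrrN expr1n.
- exact: cone_nil.
- move=> a b r t; rewrite addr0.
  suff E4 : 4 * q a b r t = 4 * (w * ball_box u v T a b (x r) (y t)).
    by apply: (mulfI _ E4); rewrite pnatr_eq0.
  apply: complexI; rewrite mulrA boxE qE; apply: corr_eq.
    rewrite !mulmxDl -!scalemxAl; congr (_ + _ *: _).
    by rewrite -{1}Pc mulmxA Ax -mulmxA Pc.
  rewrite !mulmxDr -!scalemxAr; congr (_ + _ *: _).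
  rewrite -[LHS]trmxCK adjmxM hB -Qc mulmxA By -mulmxA Qc.
  by rewrite adjmxM trmxCK vecmx_herm.
Qed.

End FiniteModels.

Section FiniteModelsCone.
Variable R : realType.
Local Notation C := R[i].

Lemma corr_decomposition n m (c : 'M[C]_(n, m)) X Y
    (P : 'I_n -> 'M[C]_n) (Q : 'I_m -> 'M[C]_m) :
  (forall k, (P k)^t* = P k /\ P k *m P k = P k) ->
  (forall k, (Q k)^t* = Q k /\ Q k *m Q k = Q k) ->
  \sum_k P k = 1%:M -> \sum_k Q k = 1%:M ->
  (forall k, X *m P k = P k *m X) -> (forall k, Y *m Q k = Q k *m Y) ->
  corr c X Y = \sum_(kl : 'I_n * 'I_m) corr (P kl.1 *m c *m Q kl.2) X Y.
Proof.
move=> hP hQ P1 Q1 XP YQ.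
rewrite -(pair_bigA _ (fun k l => corr (P k *m c *m Q l) X Y)) /=.
(* One resolution of the identity is inserted on each side of [c]. Idempotence then doubles each
   projection, and commutation with [X] and [Y] moves the copy next to the adjoint of [c], so no
   cross terms arise. *)
have -> : corr c X Y = \tr (\sum_k \sum_l X *m P k *m c *m (Q l *m (Y *m c^t*))).
  under eq_bigr => k _ do rewrite -mulmx_sumr -mulmx_suml Q1 mul1mx.
  by rewrite -mulmx_suml -mulmx_suml -mulmx_sumr P1 mulmx1 /corr !mulmxA.
rewrite raddf_sum; apply: eq_bigr => k _; rewrite raddf_sum; apply: eq_bigr => l _.
have [hPk PPk] := hP k; have [hQl QQl] := hQ l.
rewrite /corr !adjmxM hPk hQl.
have -> : X *m (P k *m c *m Q l) *m Y *m (Q l *m (c^t* *m P k)) =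
    (X *m P k *m c *m (Q l *m Y *m Q l) *m c^t*) *m P k by rewrite !mulmxA.
rewrite [RHS]mxtrace_mulC !mulmxA -XP -(mulmxA X (P k) (P k)) PPk.
by rewrite -(mulmxA _ Y (Q l)) YQ mulmxA -(mulmxA _ (Q l) (Q l)) QQl.
Qed.

Lemma involution_cone d n m (A : 'I_2 -> 'M[C]_n) (B : 'I_2 -> 'M[C]_m)
    (c : 'M[C]_(n, m)) (w : R) (q : behaviour R) : (1 < d)%N ->
  (forall r, (A r)^t* = A r) -> (forall r, A r *m A r = 1%:M) ->
  (forall r, (B r)^t* = B r) -> (forall r, B r *m B r = 1%:M) ->
  w%:C = corr c 1%:M 1%:M ->
  (forall a b r t, (4 * q a b r t)%:C =
     corr c (1%:M + pm a *: A r) (1%:M + pm b *: B t)) ->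
  cone (ball_behaviours d) w q.
Proof.
move=> d1 hA AA hB BB wE qE.
have hG k (Z : 'I_2 -> 'M[C]_k) : (forall r, (Z r)^t* = Z r) ->
    (Z 0 *m Z 1 + Z 1 *m Z 0)^t* = Z 0 *m Z 1 + Z 1 *m Z 0.
  by move=> hZ; rewrite adjmxD !adjmxM !hZ addrC.
(* For [r = 0] both sides are [Z 1 + Z 0 *m Z 1 *m Z 0], because [Z 0] squares to 1; [r = 1] is
   symmetric. *)
have ZG k (Z : 'I_2 -> 'M[C]_k) r : (forall r, Z r *m Z r = 1%:M) ->
    Z r *m (Z 0 *m Z 1 + Z 1 *m Z 0) = (Z 0 *m Z 1 + Z 1 *m Z 0) *m Z r.
  move=> ZZ; have /orP[/eqP->|/eqP->] : (r == 0) || (r == 1) by case: r => [[|[|]]].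
    by rewrite mulmxDr mulmxDl !mulmxA ZZ -(mulmxA (Z 1) (Z 0) (Z 0)) ZZ mul1mx mulmx1 addrC.
  by rewrite mulmxDr mulmxDl !mulmxA ZZ -(mulmxA (Z 0) (Z 1) (Z 1)) ZZ mul1mx mulmx1 addrC.
have [P [l [hP _ P1 lP PX]]] := spectral_projections (hG _ _ hA).
have [Q [l' [hQ _ Q1 lQ QX]]] := spectral_projections (hG _ _ hB).
have dec X Y := corr_decomposition c (X := X) (Y := Y) hP hQ P1 Q1.
have h1 k (Z : 'I_2 -> 'M[C]_k) a r : (forall r, (Z r)^t* = Z r) ->
    (1%:M + pm a *: Z r)^t* = 1%:M + pm a *: Z r.
  by move=> hZ; rewrite adjmxD adjmx1 adjmxZ pm_real conj_rC hZ.
have comm1 k (X Z : 'M[C]_k) a : X *m Z = Z *m X ->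
    (1%:M + pm a *: X) *m Z = Z *m (1%:M + pm a *: X).
  by move=> XZ; rewrite mulmxDl mulmxDr mul1mx mulmx1 -scalemxAl -scalemxAr XZ.
have A1P a r k : (1%:M + pm a *: A r) *m P k = P k *m (1%:M + pm a *: A r).
  by apply: PX; apply: comm1; apply: ZG.
have B1Q b t k : (1%:M + pm b *: B t) *m Q k = Q k *m (1%:M + pm b *: B t).
  by apply: QX; apply: comm1; apply: ZG.
pose ckl (kl : 'I_n * 'I_m) := P kl.1 *m c *m Q kl.2.
pose wkl kl := complex.Re (corr (ckl kl) 1%:M 1%:M).
pose qkl kl a b r t :=
  complex.Re (corr (ckl kl) (1%:M + pm a *: A r) (1%:M + pm b *: B t)) / 4.
have -> : w = \sum_kl wkl kl.
  apply: complexI; rewrite wE dec; try by move=> k; rewrite mulmx1 mul1mx.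
  by rewrite rmorph_sum; apply: eq_bigr => kl _; apply: corr_real; apply: adjmx1.
have -> : q = fun a b r t => \sum_kl qkl kl a b r t.
  apply/funext => a; apply/funext => b; apply/funext => r; apply/funext => t.
  have E4 : 4 * q a b r t = 4 * \sum_kl qkl kl a b r t.
    apply: complexI; rewrite qE dec // mulr_sumr rmorph_sum.
    apply: eq_bigr => kl _.
    by rewrite /qkl mulrC divfK ?pnatr_eq0 //; apply: corr_real; apply: h1.
  by apply: (mulfI _ E4); rewrite pnatr_eq0.
apply: cone_sum => kl.
have [[hPk PPk] [lr GP]] := (hP kl.1, lP kl.1).
have [[hQl QQl] [l'r GQ]] := (hQ kl.2, lQ kl.2).
apply: (block_cone (A := A) (B := B) (c := ckl kl) d1 hA AA hPk PPk lr GP hB BB hQl QQl l'r GQ).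
- by rewrite /ckl !mulmxA PPk.
- by rewrite /ckl -!mulmxA QQl.
- by apply/esym/corr_real; apply: adjmx1.
- move=> a b r t; rewrite /qkl mulrC divfK ?pnatr_eq0 //.
  by apply/esym/corr_real; apply: h1.
Qed.

(** The weight [w] is the squared norm of [c], which need not be 1. *)
Definition fd_model (w : R) (q : behaviour R) : Prop :=
  exists n m (E : 'I_2 -> bool -> 'M[C]_n) (F : 'I_2 -> bool -> 'M[C]_m)
      (c : 'M[C]_(n, m)),
    [/\ forall r a, psd (E r a), forall t b, psd (F t b),
        forall r, E r true + E r false = 1%:M,
        forall t, F t true + F t false = 1%:M &
        w%:C = corr c 1%:M 1%:M /\
        forall a b r t, (q a b r t)%:C = corr c (E r a) (F t b)].

(** The difference [D r] of the two effects is a contraction, and its Halmos dilation is an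
    involution. The isometry [V] is the inclusion of the first summand for both [r], so a single
    dilated state serves both settings. *)
Lemma naimark n (E : 'I_2 -> bool -> 'M[C]_n) :
  (forall r a, psd (E r a)) -> (forall r, E r true + E r false = 1%:M) ->
  exists (V : 'M[C]_(n + n, n)) (A : 'I_2 -> 'M[C]_(n + n)),
  [/\ forall r, (A r)^t* = A r, forall r, A r *m A r = 1%:M, V^t* *m V = 1%:M &
      forall r a, V^t* *m (1%:M + pm a *: A r) *m V = 2 *: E r a].
Proof.
move=> pE E1; pose D r := E r true - E r false.
have DE r a : 1%:M + pm a *: D r = 2 *: E r a.
  rewrite -(E1 r) /D /pm scaler_nat mulr2n; case: a.
    by rewrite scale1r addrACA subrr addr0.
  by rewrite scaleN1r opprB addrC addrA subrK.
have p2 : 0 <= 2 :> C by rewrite ler0n.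
have pD r : psd (1%:M - D r).
  by have := DE r false; rewrite /pm scaleN1r => ->; exact: psdZ.
have pD' r : psd (1%:M + D r).
  by have := DE r true; rewrite /pm scale1r => ->; exact: psdZ.
have [S /all_and3[hS DS SS]] := choice (fun r => contraction_dilation (pD r) (pD' r)).
have hD r : (D r)^t* = D r.
  by rewrite /D adjmxB; case: (pE r true) => -> _; case: (pE r false) => -> _.
exists (col_mx 1%:M 0), (fun r => block_mx (D r) (S r) (S r) (- D r)); split.
- move=> r; rewrite tr_block_mx map_block_mx hD hS.
  by rewrite linearN map_mxN hD.
- move=> r; rewrite mulmx_block mulmxN mulNmx mulmxN mulNmx opprK SS.
  by rewrite DS addrN addrC SS -scalar_mx_block.
- by rewrite tr_col_mx map_row_mx adjmx1 adjmx0 mul_row_col mul0mx addr0 mulmx1.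
- move=> r a; rewrite tr_col_mx map_row_mx adjmx1 adjmx0 -DE.
  rewrite (scalar_mx_block n n 1) scale_block_mx add_block_mx mul_row_block mul_row_col.
  by rewrite !mul1mx !mul0mx !addr0 mulmx0 addr0 mulmx1.
Qed.

Lemma fd_cone d w q : (1 < d)%N -> fd_model w q -> cone (ball_behaviours d) w q.
Proof.
move=> d1 [n [m [E [F [c [pE pF E1 F1 [wE qE]]]]]]].
have [V [A [hA AA VV VA]]] := naimark pE E1.
have [W [B [hB BB WW WB]]] := naimark pF F1.
have corrV X Y : corr (V *m c *m W^t*) X Y = corr c (V^t* *m X *m V) (W^t* *m Y *m W).
  by rewrite /corr !adjmxM trmxCK !mulmxA mxtrace_mulC !mulmxA.
apply: (involution_cone (c := V *m c *m W^t*) d1 hA AA hB BB).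
  by rewrite corrV !mulmx1 VV WW.
move=> a b r t; rewrite corrV VA WB corrZl corrZr -qE rmorphM mulrA.
by rewrite -natrM rmorph_nat.
Qed.

End FiniteModelsCone.

(** * Density operators on Hilbert spaces *)

Section Hilbert.
Variables (R : realType) (H : hilbertSpace R).
Local Notation C := R[i].
Implicit Types (u v w : H).

Lemma hdotDl u v w : '[u + v, w] = '[u, w] + '[v, w].
Proof. exact: linearDl. Qed.
Lemma hdotDr u v w : '[w, u + v] = '[w, u] + '[w, v].
Proof. exact: linearDr. Qed.
Lemma hdotBl u v w : '[u - v, w] = '[u, w] - '[v, w].
Proof. exact: linearBl. Qed.
Lemma hdotBr u v w : '[w, u - v] = '[w, u] - '[w, v].
Proof. exact: linearBr. Qed.
Lemma hdotZl (a : C) u v : '[a *: u, v] = a * '[u, v].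
Proof. exact: linearZl_LR. Qed.
Lemma hdotZr (a : C) u v : '[u, a *: v] = a^* * '[u, v].
Proof. exact: linearZr_LR. Qed.
Lemma hdot0r u : '[u, 0] = 0. Proof. exact: linear0r. Qed.
Lemma hdot_suml (I : Type) (r : seq I) (P : pred I) (F : I -> H) v :
  '[\sum_(i <- r | P i) F i, v] = \sum_(i <- r | P i) '[F i, v].
Proof. by rewrite linear_sumlz. Qed.
Lemma hdot_sumr (I : Type) (r : seq I) (P : pred I) (F : I -> H) v :
  '[v, \sum_(i <- r | P i) F i] = \sum_(i <- r | P i) '[v, F i].
Proof. by rewrite linear_sumr. Qed.
Lemma hdotC u v : '[u, v] = ('[v, u])^*.
Proof. by rewrite hermC expr0 mul1r. Qed.
Lemma hdot_ge0 u : 0 <= '[u, u]. Proof. exact: dnorm_ge0. Qed.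

Lemma norm_le_hdot u (k : C) : 0 <= k -> '[u, u] <= k ^+ 2 -> `|u| <= k.
Proof. by move=> k0; rewrite hdotE ler_pXn2r // nnegrE. Qed.

Lemma CauchySchwarz_hdot u v : `|'[u, v]| <= `|u| * `|v|.
Proof.
have [->|v0] := eqVneq v 0; first by rewrite hdot0r !normr0 mulr0.
have nv0 : 0 < `|v| by rewrite normr_gt0.
rewrite -(@ler_pXn2r _ 2) ?nnegrE ?mulr_ge0 // exprMn -!hdotE.
have v20 : 0 < '[v, v] by rewrite hdotE exprn_gt0.
have := hdot_ge0 ('[v, v] *: u - '[u, v] *: v).
rewrite hdotBl !hdotBr !hdotZl !hdotZr (hdotC v u).
rewrite (conj_Creal (ger0_real (hdot_ge0 v))).
set p := '[u, u]; set q := '[v, v] in v20 *; set z := '[u, v].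
have -> : q * (q * p) - q * (z^* * z) - (z * (q * z^*) - z * (z^* * q))
  = q * (p * q - z * z^*) by ring.
by rewrite pmulr_rge0 // subr_ge0 -normCK.
Qed.

Lemma hdot_continuousl v : continuous (fun u => '[u, v] : C^o).
Proof.
move=> u; apply/cvgrPdist_le => e e0.
have k0 : 0 < `|v| + 1 by rewrite ltr_wpDl.
near=> w; rewrite -hdotBl (le_trans (CauchySchwarz_hdot _ _)) //.
apply: (@le_trans _ _ (e / (`|v| + 1) * (`|v| + 1))); last by rewrite divfK ?gt_eqF.
apply: ler_pM => //; last by rewrite lerDl.
by near: w; apply: cvgr_dist_le; [exact: cvg_id|exact: divr_gt0].
Unshelve. all: by end_near. Qed.

Lemma hdot_continuousr v : continuous (fun u => '[v, u] : C^o).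
Proof.
move=> u; apply/cvgrPdist_le => e e0.
have k0 : 0 < `|v| + 1 by rewrite ltr_wpDl.
near=> w; rewrite -hdotBr (le_trans (CauchySchwarz_hdot _ _)) // mulrC.
apply: (@le_trans _ _ (e / (`|v| + 1) * (`|v| + 1))); last by rewrite divfK ?gt_eqF.
apply: ler_pM => //; last by rewrite lerDl.
by near: w; apply: cvgr_dist_le; [exact: cvg_id|exact: divr_gt0].
Unshelve. all: by end_near. Qed.

(** Polarisation: realness of the form at [x + y] makes the sum of the two cross terms real, and
    replacing [u] by ['i *: u] does the same for their difference. *)
Lemma positive_op_selfadjoint (T : {linear H -> H}) : positive_op T ->
  forall u v, '[T u, v] = '[u, T v].
Proof.
move=> [_ pT] u v.
have im (x y : H) : '[T x, y] + '[T y, x] \is Num.real.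
  have := ger0_real (pT (x + y)); rewrite (linearD T) hdotDl !hdotDr.
  set p := '[T x, x]; set q := '[T y, y] => rpq.
  have -> : '[T x, y] + '[T y, x] = p + '[T x, y] + ('[T y, x] + q) - p - q by ring.
  by rewrite !realB // ger0_real // pT.
have sym (x y : H) : '[y, T x] + '[x, T y] = '[T x, y] + '[T y, x].
  rewrite (hdotC y) (hdotC x (T y)); have := conj_Creal (im x y).
  by rewrite rmorphD.
have E1 : '[T u, v] + '[T v, u] = '[u, T v] + '[v, T u] by rewrite -sym addrC.
have E2 : '[T u, v] - '[T v, u] = '[u, T v] - '[v, T u].
  have := sym ('i *: u) v; rewrite linearZ /= !hdotZl !hdotZr conjCi.
  move=> E; apply: (mulfI (neq0Ci C)).
  have -> : 'i * ('[T u, v] - '[T v, u]) = 'i * '[T u, v] + - 'i * '[T v, u] by ring.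
  by rewrite -E; ring.
apply: (@mulfI _ 2); first by rewrite pnatr_eq0.
have -> : 2 * '[T u, v] = ('[T u, v] + '[T v, u]) + ('[T u, v] - '[T v, u]) by ring.
by rewrite E1 E2; ring.
Qed.

Lemma continuous_op_bounded (T : {linear H -> H}) : continuous T ->
  exists2 K : R, 0 < K & forall u, `|T u| <= K%:C * `|u|.
Proof.
move=> /linear_bounded_continuous /linear_boundedP /pinfty_ex_gt0 [K K0 TK].
exists (complex.Re K); last by move=> u; rewrite RRe_real ?TK // gtr0_real.
by rewrite -ltcR RRe_real // gtr0_real.
Qed.

Section Orthonormal.
Variables (J : finType) (f : J -> H).
Hypothesis fJ : forall i j, '[f i, f j] = (i == j)%:R.

Definition oproj u : H := \sum_j '[u, f j] *: f j.

Lemma hdot_oproj u k : '[oproj u, f k] = '[u, f k].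
Proof.
rewrite hdot_suml (bigD1 k) //= hdotZl fJ eqxx mulr1 big1 ?addr0 // => j jk.
by rewrite hdotZl fJ (negbTE jk) mulr0.
Qed.

Lemma hdot_oprojE u v : '[oproj u, v] = \sum_j '[u, f j] * '[f j, v].
Proof. by rewrite hdot_suml; apply: eq_bigr => j _; rewrite hdotZl. Qed.

Lemma hdot_sub_oproj u : '[u - oproj u, u - oproj u] = '[u, u] - \sum_j `|'[u, f j]| ^+ 2.
Proof.
have E v : '[u - oproj u, oproj v] = 0.
  rewrite hdot_sumr big1 // => j _.
  by rewrite hdotZr hdotBl hdot_oproj subrr mulr0.
rewrite hdotBr E subr0 hdotBl hdot_oprojE; congr (_ - _).
by apply: eq_bigr => j _; rewrite (hdotC (f j)) normCK.
Qed.

Lemma bessel u : \sum_j `|'[u, f j]| ^+ 2 <= '[u, u].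
Proof. by rewrite -subr_ge0 -hdot_sub_oproj hdot_ge0. Qed.

Lemma norm_sub_oproj u : `|u - oproj u| <= `|u|.
Proof.
apply: norm_le_hdot => //; rewrite hdot_sub_oproj -hdotE gerBl.
by apply: sumr_ge0 => j _; rewrite exprn_ge0.
Qed.

End Orthonormal.

Lemma oprojB (J : finType) (f : J -> H) u v : oproj f (u - v) = oproj f u - oproj f v.
Proof. by rewrite /oproj -sumrB; apply: eq_bigr => j _; rewrite hdotBl scalerBl. Qed.

Section Basis.
Variables (I : choiceType) (e : I -> H).
Hypothesis be : orthonormal_basis e.

Lemma basis_fset (L : {fset I}) :
  forall i j : L, '[e (val i), e (val j)] = (i == j)%:R.
Proof. by move=> i j; case: be => -> _; rewrite (inj_eq val_inj). Qed.

Definition bproj (L : {fset I}) u : H := oproj (fun i : L => e (val i)) u.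

Lemma bprojE L u : bproj L u = \sum_(i <- L) '[u, e i] *: e i.
Proof. by rewrite /bproj /oproj (big_seq_fsetE _ _ xpredT (fun i => '[u, e i] *: e i)). Qed.

Lemma bproj_id (L : {fset I}) i : i \in L -> bproj L (e i) = e i.
Proof.
move=> iL; rewrite bprojE (big_fsetD1 i) //= (proj1 be) eqxx scale1r.
rewrite big_seq big1 ?addr0 // => j; rewrite !inE (proj1 be) => /andP[/negbTE ji _].
by rewrite eq_sym ji scale0r.
Qed.

(** Choose [v] in the span close to [u]. Once [L] contains the indices of [v], the error at [u] is
    the error at [u - v], which is at most its norm. *)
Lemma bproj_cvg u : (fun L => bproj L u) @ totally --> u.
Proof.
apply/cvgrPdist_le => eps eps0.
have [v [] ] : ball u eps `&` lin_span (range e) !=set0.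
  by apply: (proj2 be); [exists u; exact: ballxx | exact: ball_open].
rewrite -ball_normE /= => uv [n [c [x [xe vE]]]].
have /choice [i ie] k : exists j, x k = e j.
  by have [j _ <-] := xe k; exists j.
exists [fset i k | k in 'I_n]%fset => //= L L0.
have vL : bproj L v = v.
  have bl : linear (bproj L).
    move=> a y z; rewrite /bproj /oproj scaler_sumr -big_split /=.
    by apply: eq_bigr => j _; rewrite hdotDl hdotZl scalerDl scalerA.
  pose B := GRing.isLinear.Build _ _ _ _ (bproj L) bl.
  pose bL : {linear H -> H} := HB.pack (bproj L) B.
  rewrite vE -[bproj L]/(bL : H -> H) linear_sum; apply: eq_bigr => k _.
  rewrite linearZ /= ie bproj_id //; apply: (fsubsetP L0).
  by apply/imfsetP; exists k.
have -> : u - bproj L u = (u - v) - bproj L (u - v).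
  by rewrite /bproj oprojB -/(bproj L v) vL opprB addrA subrK.
by rewrite (le_trans (norm_sub_oproj (@basis_fset L) _)) // ltW.
Qed.

End Basis.

End Hilbert.

Section ComplexLimits.
Variable R : realType.
Local Notation C := R[i].

Lemma ReD (x y : C) : complex.Re (x + y) = complex.Re x + complex.Re y.
Proof. by case: x => ? ?; case: y. Qed.

Lemma ReN (x : C) : complex.Re (- x) = - complex.Re x.
Proof. by case: x. Qed.

Lemma Re_conj (x : C) : complex.Re (x^*) = complex.Re x.
Proof. by case: x. Qed.

Lemma Re_realM (a : R) (x : C) : complex.Re (a%:C * x) = a * complex.Re x.
Proof. by case: x => ? ? /=; rewrite mul0r subr0. Qed.

Lemma Re_sum (I : Type) (r : seq I) (P : pred I) (F : I -> C) :
  complex.Re (\sum_(i <- r | P i) F i) = \sum_(i <- r | P i) complex.Re (F i).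
Proof.
by apply: (big_morph (@complex.Re R)) => //; exact: ReD.
Qed.

Lemma Re_le (x y : C) : x <= y -> complex.Re x <= complex.Re y.
Proof. by rewrite lecE => /andP[]. Qed.

Lemma norm_Re (x : C) : `|complex.Re x|%:C <= `|x|.
Proof. exact: normc_ge_Re. Qed.

Lemma cvg_Re_le (T : Type) (F : set_system T) (PF : ProperFilter F) (g : T -> C)
    (l : C) (M : R) : g @ F --> (l : C^o) ->
  (\forall x \near F, complex.Re (g x) <= M) -> complex.Re l <= M.
Proof.
move=> gl gM; apply/ler_addgt0Pr => e e0.
near F => x.
have : `|l - g x| <= e%:C.
  by near: x; apply: (cvgr_dist_le (V := C^o)) gl _ _; rewrite ltcR.
move=> /(le_trans (norm_Re _)); rewrite lecR ReD ReN => /ler_normlW.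
rewrite lerBlDr => /le_trans; apply; rewrite addrC lerD2r.
by near: x.
Unshelve. all: by end_near. Qed.

Lemma cvg_sum (K : numFieldType) (V : normedModType K) (T I : Type)
    (F : set_system T) (FF : Filter F) (r : seq I) (g : I -> T -> V) (l : I -> V) :
  (forall i, g i @ F --> l i) ->
  (fun x => \sum_(i <- r) g i x) @ F --> \sum_(i <- r) l i.
Proof. by move=> gl; apply: cvg_big => // x; exact: add_continuous. Qed.

End ComplexLimits.

(** * Truncation of a positive operator and its trace *)

Section Trace.
Variables (R : realType) (H : hilbertSpace R).
Local Notation C := R[i].

Lemma cvg_hdot (T : Type) (F : set_system T) (FF : Filter F) (x y : T -> H) u v :
  x @ F --> u -> y @ F --> v -> (fun i => '[x i, y i] : C^o) @ F --> ('[u, v] : C^o).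
Proof.
move=> xu yv; apply/cvgrPdist_le => eps eps0.
have k0 : 0 < `|v| + `|u| + 1 by rewrite ltr_wpDl ?addr_ge0.
have e0 : 0 < eps / (`|v| + `|u| + 1) by rewrite divr_gt0.
near=> i.
have x1 : `|u - x i| <= eps / (`|v| + `|u| + 1).
  by near: i; exact: cvgr_dist_le xu _ _.
have x2 : `|u - x i| <= 1.
  by near: i; apply: cvgr_dist_le xu _ _; exact: ltr01.
have y1 : `|v - y i| <= eps / (`|v| + `|u| + 1).
  by near: i; exact: cvgr_dist_le yv _ _.
have -> : '[u, v] - '[x i, y i] = '[u - x i, v] + '[x i, v - y i].
  by rewrite hdotBl hdotBr addrA subrK.
have xi : `|x i| <= `|u| + 1.
  rewrite -[x i](subKr u) (le_trans (ler_normB _ _)) //.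
  by rewrite lerD2l.
rewrite (le_trans (ler_normD _ _)) //.
apply: (@le_trans _ _ (eps / (`|v| + `|u| + 1) * `|v| + (`|u| + 1) * (eps / (`|v| + `|u| + 1)))).
  by apply: lerD; rewrite (le_trans (CauchySchwarz_hdot _ _)) // ler_pM.
rewrite [X in _ + X]mulrC -mulrDr addrA divfK ?gt_eqF //.
Unshelve. all: by end_near. Qed.

Variable rho : {linear H -> H}.
Hypothesis pr : positive_op rho.

Let rsym u v : '[rho u, v] = '[u, rho v].
Proof. exact: positive_op_selfadjoint. Qed.

(** Positivity of the form at [u + s v] and [u - s v], divided by [2 s]. The free weight [s] later
    balances a small factor against a bounded one. *)
Lemma positive_amgm u v (s : R) : 0 < s ->
  `|complex.Re '[rho u, v]| <=
    (s^-1 * complex.Re '[rho u, u] + s * complex.Re '[rho v, v]) / 2.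
Proof.
move=> s0.
have sy : complex.Re '[rho v, u] = complex.Re '[rho u, v].
  by rewrite rsym hdotC Re_conj.
have pos (b : R) : 0 <= complex.Re '[rho u, u] + b ^+ 2 * complex.Re '[rho v, v]
    + 2 * b * complex.Re '[rho u, v].
  have := Re_le ((proj2 pr) (u + b%:C *: v)).
  rewrite [rho (_ + _)]linearD [rho (_ *: _)]linearZ /= hdotDl !hdotDr !hdotZl !hdotZr conj_rC.
  rewrite !ReD !Re_realM sy => /le_trans; apply; rewrite le_eqVlt; apply/orP; left.
  by apply/eqP => /=; ring.
have := pos s; have := pos (- s); rewrite sqrrN.
set p := complex.Re _; set q := complex.Re _; set r := complex.Re _ => h1 h2.
have -> : (s^-1 * p + s * q) / 2 = (p + s ^+ 2 * q) / (2 * s) by field; rewrite gt_eqF.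
rewrite ler_norml ler_pdivlMr ?mulr_gt0 // -mulNr ler_pdivrMr ?mulr_gt0 //.
apply/andP; split; lra.
Qed.

(** The Gram matrix of [rho] on the family factors through [Z], and the rows of [Z] give vectors
    [w m]: the compressed state is a mixture of these unnormalised pure states, with the same
    trace. *)
Lemma finite_rank_factor n (e : 'I_n -> H) :
  (forall i j, '[e i, e j] = (i == j)%:R) ->
  exists2 w : 'I_n -> H,
    forall u v, '[rho (oproj e u), oproj e v] = \sum_m '[u, w m] * '[w m, v] &
    \sum_m '[w m, w m] = \sum_k '[rho (e k), e k].
Proof.
move=> oe; pose M : 'M[C]_n := \matrix_(k, l) '[rho (e k), e l].
have pM : psd M.
  split=> [|u]; first by apply/matrixP => k l; rewrite !mxE rsym [RHS]hdotC.
  pose x := \sum_k (u k 0)^* *: e k.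
  suff -> : (u^t* *m M *m u) 0 0 = '[rho x, x] by exact: (proj2 pr).
  rewrite -mulmxA mxE [rho x]linear_sum hdot_suml; apply: eq_bigr => k _.
  rewrite !mxE [rho _]linearZ hdotZl hdot_sumr; congr (_ * _); apply: eq_bigr => l _.
  by rewrite mxE hdotZr conjCK mulrC.
have [Z MZ] := psd_factor pM.
have ME k l : '[rho (e k), e l] = \sum_m (Z m k)^* * Z m l.
  have := congr1 (fun N : 'M[C]_n => N k l) MZ; rewrite !mxE => ->.
  by apply: eq_bigr => m _; rewrite !mxE.
exists (fun m => \sum_k Z m k *: e k) => [u v|].
  have -> : '[rho (oproj e u), oproj e v] =
      \sum_k \sum_l \sum_m ('[u, e k] * (Z m k)^*) * (Z m l * '[e l, v]).
    rewrite /oproj [rho _]linear_sum hdot_suml; apply: eq_bigr => k _.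
    rewrite [rho _]linearZ hdotZl hdot_sumr mulr_sumr; apply: eq_bigr => l _.
    rewrite hdotZr ME mulr_sumr mulr_sumr; apply: eq_bigr => m _.
    by rewrite -(hdotC (e l) v) /=; ring.
  under eq_bigr do rewrite exchange_big.
  rewrite exchange_big; apply: eq_bigr => m _ /=.
  rewrite hdot_sumr hdot_suml mulr_suml; apply: eq_bigr => k _.
  rewrite mulr_sumr; apply: eq_bigr => l _.
  by rewrite hdotZr hdotZl; ring.
under [RHS]eq_bigr do rewrite ME.
rewrite exchange_big; apply: eq_bigr => m _.
rewrite hdot_suml; apply: eq_bigr => k _.
rewrite hdotZl hdot_sumr (bigD1 k) //= hdotZr oe eqxx mulr1 big1 ?addr0 1?mulrC //.
by move=> l lk; rewrite hdotZr oe eq_sym (negbTE lk) mulr0.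
Qed.

End Trace.

Section TruncatedTrace.
Variables (R : realType) (H : hilbertSpace R).
Local Notation C := R[i].
Variable rho : {linear H -> H}.
Hypothesis pr : positive_op rho.
Variables (I : choiceType) (e : I -> H).
Hypothesis be : orthonormal_basis e.

Lemma bproj_enum (L : {fset I}) u :
  bproj e L u = oproj (fun k : 'I_#|{: L}| => e (val (enum_val k))) u.
Proof.
rewrite /bproj /oproj.
by rewrite (reindex_onto enum_val enum_rank) => [|i _]; rewrite ?enum_rankK //=;
  apply: eq_bigl => k; rewrite enum_valK eqxx.
Qed.

Lemma bproj_factor (L : {fset I}) : exists2 w : 'I_#|{: L}| -> H,
    forall u v, '[rho (bproj e L u), bproj e L v] = \sum_m '[u, w m] * '[w m, v] &
    \sum_m '[w m, w m] = \sum_(i <- L) '[rho (e i), e i].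
Proof.
have oL (i j : 'I_#|{: L}|) : '[e (val (enum_val i)), e (val (enum_val j))] = (i == j)%:R.
  by rewrite (basis_fset be) (inj_eq enum_val_inj).
have [w w1 w2] := finite_rank_factor pr oL.
exists w => [u v|]; first by rewrite !bproj_enum w1.
rewrite w2 (big_seq_fsetE _ _ xpredT (fun i => '[rho (e i), e i])) /=.
by rewrite [RHS](reindex_onto enum_val enum_rank) => [|i _]; rewrite ?enum_rankK //=;
  apply: eq_bigl => k; rewrite enum_valK eqxx.
Qed.

Variables (S : {linear H -> H}) (K : R).
Hypothesis S_sym : forall u v, '[S u, v] = '[u, S v].
Hypothesis S_bound : forall u, `|S u| <= K%:C * `|u|.

Lemma norm2_bound u : '[S u, S u] <= (K ^+ 2)%:C * '[u, u].
Proof.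
rewrite !hdotE rmorphXn -exprMn ler_pXn2r ?nnegrE //.
exact: le_trans (normr_ge0 _) (S_bound u).
Qed.

Variables (J : finType) (f : J -> H).
Hypothesis fJ : forall i j, '[f i, f j] = (i == j)%:R.

(** In terms of the vectors [w m], the sum over [j] becomes a sum of squared coefficients of
    [S (w m)] along [f], which Bessel bounds by its norm. The bound is uniform in the orthonormal
    family [f], which has no relation to [e]. *)
Lemma trace_bproj_le (L : {fset I}) :
  \sum_j '[rho (bproj e L (S (f j))), bproj e L (S (f j))]
    <= (K ^+ 2)%:C * \sum_(i <- L) '[rho (e i), e i].
Proof.
have [w w1 w2] := bproj_factor L.
under eq_bigr do rewrite w1.
rewrite exchange_big -w2 mulr_sumr; apply: ler_sum => m _ /=.
rewrite (le_trans _ (norm2_bound _)) // (le_trans _ (bessel fJ _)) //.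
apply: ler_sum => j _.
by rewrite (hdotC (w m)) -normCK S_sym (hdotC (f j)) norm_conjC.
Qed.

Lemma trace_sub_bproj_le (N : {fset I}) (M : R) :
  (forall L : {fset I}, \sum_(i <- L) complex.Re '[rho (e i), e i] <= M) ->
  \sum_j complex.Re '[rho (S (f j) - bproj e N (S (f j))), S (f j) - bproj e N (S (f j))]
    <= K ^+ 2 * (M - \sum_(i <- N) complex.Re '[rho (e i), e i]).
Proof.
move=> LM; rewrite -Re_sum.
pose g (L : {fset I}) := \sum_j '[rho (bproj e L (S (f j)) - bproj e N (S (f j))),
   bproj e L (S (f j)) - bproj e N (S (f j))].
apply: (@cvg_Re_le _ _ totally _ g).
  rewrite /g; apply: (cvg_sum (V := C^o)) => j; apply: cvg_hdot.
    apply: continuous_cvg; first exact: (proj1 pr).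
    by apply: cvgB; [exact: bproj_cvg|exact: cvg_cst].
  by apply: cvgB; [exact: bproj_cvg|exact: cvg_cst].
exists N => //= L NL.
(* The complement of [N] is approached by the finite sets [L] minus [N], to which [trace_bproj_le]
   applies. *)
have dE u : bproj e L u - bproj e N u = bproj e (L `\` N)%fset u.
  rewrite !bprojE (big_fsetID _ (mem N)) /=.
  rewrite [X in X + _ - _](_ : _ = \sum_(i <- N) '[u, e i] *: e i); last first.
    by apply: eq_fbigl => i; rewrite !inE /= andbC; case: (boolP (i \in N)) => //= /(fsubsetP NL) ->.
  rewrite addrC addKr.
  by apply: eq_fbigl => i; rewrite !inE /= andbC.
have -> : g L = \sum_j '[rho (bproj e (L `\` N)%fset (S (f j))),
    bproj e (L `\` N)%fset (S (f j))] by apply: eq_bigr => j _; rewrite dE.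
rewrite (le_trans (Re_le (trace_bproj_le _))) // Re_realM Re_sum.
rewrite ler_wpM2l ?sqr_ge0 // lerBrDl (le_trans _ (LM L)) //.
rewrite [leRHS](big_fsetID _ (mem N)) /= le_eqVlt; apply/orP; left; apply/eqP.
congr (_ + _); apply: eq_fbigl => i; rewrite !inE /= andbC //.
by case: (boolP (i \in N)) => //= /(fsubsetP NL) ->.
Qed.

End TruncatedTrace.

Section TraceApproximation.
Variables (R : realType) (H : hilbertSpace R).
Local Notation C := R[i].
Variable rho : {linear H -> H}.
Hypothesis pr : positive_op rho.
Variables (I : choiceType) (e : I -> H).
Hypothesis be : orthonormal_basis e.
Hypothesis trle1 : forall L : {fset I}, \sum_(i <- L) complex.Re '[rho (e i), e i] <= 1.

(** The trace of [rho] after [S] is computed in a basis [f] unrelated to the basis [e] used for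
    truncation. Each partial sum over [f] is compared with the truncated model, with an error
    independent of the partial sum: one projection is inserted at a time, and each of the two
    differences pairs a tail of size [t ^+ 2] with a bounded factor. *)
Lemma trace_approx (S : {linear H -> H}) (K t : R) (N : {fset I}) n (w : 'I_n -> H)
    (I' : choiceType) (f : I' -> H) (z : C) :
  (forall u v, '[S u, v] = '[u, S v]) -> (forall u, `|S u| <= K%:C * `|u|) ->
  0 < t -> 1 - \sum_(i <- N) complex.Re '[rho (e i), e i] <= t ^+ 2 ->
  (forall u v, '[rho (bproj e N u), bproj e N v] = \sum_m '[u, w m] * '[w m, v]) ->
  orthonormal_basis f ->
  partial_sum (fun i => '[rho (S (f i)), f i] : C^o) @ totally --> (z : C^o) ->
  `|complex.Re z - \sum_m complex.Re '[S (w m), w m]| <= t * (1 + K ^+ 2).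
Proof.
move=> Ssym Sb t0 hN hw bf trz.
pose g (J : {fset I'}) := partial_sum (fun i => '[rho (S (f i)), f i] : C^o) J
  - \sum_m '[bproj f J (w m), S (w m)].
have gz : g @ totally --> (z - \sum_m '[w m, S (w m)] : C^o).
  apply: (cvgB (V := C^o)); first exact: trz.
  apply: (cvg_sum (V := C^o)) => m.
  by apply: cvg_hdot; [exact: bproj_cvg|exact: cvg_cst].
have idb u : `|(idfun : {linear H -> H}) u| <= 1%:C * `|u| by rewrite rmorph1 mul1r.
have tn0 : t != 0 by rewrite gt_eqF.
have bound J : `|complex.Re (g J)| <= t * (1 + K ^+ 2).
  pose x (j : J) := S (f (val j)).
  have -> : g J = \sum_(j : J) '[rho (x j - bproj e N (x j)), f (val j)] +
      \sum_(j : J) '[rho (bproj e N (x j)), f (val j) - bproj e N (f (val j))].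
    rewrite /g; have -> : \sum_m '[bproj f J (w m), S (w m)] =
        \sum_(j : J) '[rho (bproj e N (x j)), bproj e N (f (val j))].
      under [RHS]eq_bigr do rewrite hw.
      rewrite exchange_big; apply: eq_bigr => m _.
      by rewrite /bproj hdot_oprojE; apply: eq_bigr => j _; rewrite mulrC -Ssym.
    rewrite /partial_sum -sumrB -big_split; apply: eq_bigr => j _ /=.
    by rewrite [rho (_ - _)]linearB hdotBl hdotBr addrA subrK.
  rewrite ReD !Re_sum (le_trans (ler_normD _ _)) //.
  have oJ := @basis_fset _ _ _ _ bf J.
  have b1 := trace_sub_bproj_le pr be Ssym Sb oJ N trle1.
  have b2 := trace_sub_bproj_le pr be (S := idfun) (fun _ _ => erefl) idb oJ N trle1.
  (* With [fset0] the truncation is zero, so this bounds the partial traces of [rho] in the basis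
     [f] by 1. *)
  have b3 := trace_sub_bproj_le pr be (S := idfun) (fun _ _ => erefl) idb oJ fset0 trle1.
  have b4 := Re_le (trace_bproj_le pr be Ssym Sb oJ N).
  rewrite Re_realM Re_sum Re_sum in b4.
  have {}b4 := le_trans b4 (ler_wpM2l (sqr_ge0 K) (trle1 N)).
  have {}b1 := le_trans b1 (ler_wpM2l (sqr_ge0 K) hN).
  have {}b2 := le_trans b2 (ler_wpM2l (sqr_ge0 1) hN).
  rewrite big_seq_fset0 in b3.
  have b3' : \sum_(j : J) complex.Re '[rho (f (val j)), f (val j)] <= 1.
    move: b3; rewrite expr1n mul1r subr0 => /(le_trans _); apply.
    rewrite le_eqVlt; apply/orP; left; apply/eqP; apply: eq_bigr => j _.
    by rewrite bprojE big_seq_fset0 subr0.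
  have ti : 0 < t^-1 by rewrite invr_gt0.
  (* AM-GM with weights [t] and [t^-1] on the two sums. *)
  apply: (@le_trans _ _ ((t^-1 * (K ^+ 2 * t ^+ 2) + t * 1) / 2 +
                         (t * (K ^+ 2 * 1) + t^-1 * (1 ^+ 2 * t ^+ 2)) / 2)); last first.
    by rewrite le_eqVlt; apply/orP; left; apply/eqP; field.
  apply: lerD; rewrite (le_trans (ler_norm_sum _ _ _)) //.
    rewrite (le_trans (ler_sum _ (fun j _ => positive_amgm pr _ _ t0))) //.
    rewrite -mulr_suml big_split /= -!mulr_sumr ler_wpM2r ?invr_ge0 //.
    by apply: lerD; rewrite ler_wpM2l // ltW.
  rewrite (le_trans (ler_sum _ (fun j _ => positive_amgm pr _ _ ti))) //.
  rewrite -mulr_suml big_split /= -!mulr_sumr ler_wpM2r ?invr_ge0 // invrK.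
  by apply: lerD; rewrite ler_wpM2l // ltW.
have sumE : \sum_m complex.Re '[S (w m), w m] = complex.Re (\sum_m '[w m, S (w m)]).
  by rewrite Re_sum; apply: eq_bigr => m _; rewrite Ssym.
rewrite sumE -ReN -ReD ler_norml; apply/andP; split.
  rewrite lerNl -ReN; apply: (@cvg_Re_le _ _ totally _ (fun J => - g J)).
    exact: (cvgN (V := C^o)).
  apply: nearW => J; rewrite ReN; have := bound J.
  by rewrite ler_norml lerNl => /andP[].
apply: (@cvg_Re_le _ _ totally _ g _ _ gz).
by apply: nearW => J; have := bound J; rewrite ler_norml => /andP[].
Qed.

End TraceApproximation.

Section Orthonormalise.
Variables (R : realType) (H : hilbertSpace R).
Local Notation C := R[i].

(** Gram-Schmidt on a list that may be dependent: a vector already in the span adds nothing. Being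
    fixed by [oproj a] expresses membership in the span. *)
Lemma orthonormalise (s : seq H) : exists (n : nat) (a : 'I_n -> H),
  (forall i j, '[a i, a j] = (i == j)%:R) /\ forall x, x \in s -> oproj a x = x.
Proof.
elim: s => [|x s [n [a [oa as_]]]].
  by exists 0%N, (fun=> 0); split => [[]|].
pose w := x - oproj a x.
have [w0|w0] := eqVneq w 0.
  exists n, a; split => // y; rewrite inE => /orP[/eqP->|]; last exact: as_.
  by apply/esym/eqP; rewrite -subr_eq0 -/w w0.
have nw : `|w| != 0 by rewrite normr_eq0.
have wa i : '[w, a i] = 0 by rewrite hdotBl hdot_oproj // subrr.
have aw i : '[a i, w] = 0 by rewrite hdotC wa conjC0.
have nwr : (`|w|^-1)^* = `|w|^-1 by rewrite conj_Creal // realV normr_real.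
exists n.+1, (fun i => oapp a (`|w|^-1 *: w) (unlift ord0 i)); split.
  move=> i j; case: unliftP => [i'|] ->; case: unliftP => [j'|] -> /=.
  - by rewrite oa (inj_eq lift_inj).
  - by rewrite hdotZr aw mulr0.
  - by rewrite hdotZl wa mulr0.
  - by rewrite hdotZl hdotZr nwr hdotE; field.
move=> y; rewrite /oproj big_ord_recl unlift_none /=.
under eq_bigr do rewrite liftK /=.
rewrite inE hdotZr nwr -/(oproj a y) => /orP[/eqP->|ys].
  have -> : '[x, w] = `|w| ^+ 2.
    rewrite -hdotE -[X in '[X, _] = _](subrK (oproj a x)) -/w hdotDl hdot_oprojE.
    by rewrite big1 ?addr0 // => j _; rewrite aw mulr0.
  rewrite scalerA (_ : `|w|^-1 * `|w| ^+ 2 * `|w|^-1 = 1); last by field.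
  by rewrite scale1r /w subrK.
have -> : '[y, w] = 0.
  by rewrite -(as_ _ ys) hdot_oprojE big1 // => j _; rewrite aw mulr0.
by rewrite mulr0 scale0r add0r as_.
Qed.

End Orthonormalise.

(** * Compression to finitely many elementary tensors *)

Section TensorModel.
Variables (R : realType) (HA HB H : hilbertSpace R).
Local Notation C := R[i].
Variable tau : {bilinear HA -> HB -> H}.
Hypothesis ht : hilbert_tensor tau.

Lemma dense_eq0 (S : set H) (g : H -> C^o) : dense S -> continuous g ->
  (forall u, S u -> g u = 0) -> forall u, g u = 0.
Proof.
move=> dS cg gS u; apply/eqP; apply: contraT => gu.
have : nbhs u (g @^-1` [set z | z != 0]).
  apply: cg; apply: open_nbhs_nbhs; split => //.
  rewrite (_ : [set z | _] = ~` [set (0 : C^o)]); last first.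
    by apply/seteqP; split => z /= /eqP.
  apply: closed_openC; apply: accessible_closed_set1.
  exact/hausdorff_accessible/(@norm_hausdorff _ C^o).
rewrite nbhsE => -[U [oU Uu] Ug].
have [v [Uv Sv]] := dS U (ex_intro _ u Uu) oU.
by have := Ug _ Uv; rewrite /= gS // eqxx.
Qed.

(** [T] is known only on elementary tensors. Symmetry holds there through [E] and [F] and extends by
    density and continuity, one argument at a time. *)
Lemma tensor_op_selfadjoint (E : {linear HA -> HA}) (F : {linear HB -> HB})
    (T : {linear H -> H}) : positive_op E -> positive_op F -> tensor_op tau E F T ->
  forall u v, '[T u, v] = '[u, T v].
Proof.
move=> pE pF [cT TE].
have elem a b a' b' : '[T (tau a b), tau a' b'] = '[tau a b, T (tau a' b')].
  rewrite !TE !(proj1 ht).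
  by rewrite (positive_op_selfadjoint pE) (positive_op_selfadjoint pF).
have cl v : continuous (fun u => '[T u, v] - '[u, T v] : C^o).
  move=> u; apply: cvgB; last exact: hdot_continuousl.
  by apply: (@cvg_hdot _ _ _ (nbhs u)); [exact: cT|exact: cvg_cst].
have cr u : continuous (fun v => '[T u, v] - '[u, T v] : C^o).
  move=> v; apply: cvgB; first exact: hdot_continuousr.
  by apply: (@cvg_hdot _ _ _ (nbhs v)); [exact: cvg_cst|exact: cT].
have half a' b' u : '[T u, tau a' b'] - '[u, T (tau a' b')] = 0.
  apply: (dense_eq0 (proj2 ht) (cl _)) => _ [n [c [x [xS ->]]]].
  rewrite [T _]linear_sum !hdot_suml -sumrB big1 // => k _.
  have [a [b ->]] := xS k.
  by rewrite [T (_ *: _)]linearZ !hdotZl elem subrr.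
move=> u v; apply/eqP; rewrite -subr_eq0; apply/eqP.
apply: (dense_eq0 (proj2 ht) (cr _)) => _ [n [c [x [xS ->]]]].
rewrite [T (\sum_(_ < _) _)]linear_sum !hdot_sumr -sumrB big1 // => k _.
have [a [b ->]] := xS k.
by rewrite [T (_ *: _)]linearZ !hdotZr -mulrBr half mulr0.
Qed.

Definition opmx (K : hilbertSpace R) n (a : 'I_n -> K) (E : K -> K) : 'M[C]_n :=
  \matrix_(k, i) '[E (a i), a k].

(** The transpose is included because [corr] takes the second party's operators transposed. *)
Lemma psd_opmx (K : hilbertSpace R) n (a : 'I_n -> K) (E : {linear K -> K}) :
  positive_op E -> psd (opmx a E) /\ psd ((opmx a E)^T).
Proof.
move=> pE; split; split=> [|u].
- apply/matrixP => k l; rewrite !mxE (positive_op_selfadjoint pE).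
  by rewrite [RHS]hdotC.
- suff -> : (u^t* *m opmx a E *m u) 0 0 =
      '[E (\sum_k u k 0 *: a k), \sum_k u k 0 *: a k] by exact: (proj2 pE).
  rewrite -mulmxA mxE hdot_sumr; apply: eq_bigr => k _.
  rewrite !mxE [E _]linear_sum hdotZr hdot_suml; congr (_ * _); apply: eq_bigr => l _.
  by rewrite mxE [E (_ *: _)]linearZ hdotZl mulrC.
- apply/matrixP => k l; rewrite !mxE (positive_op_selfadjoint pE).
  by rewrite [RHS]hdotC.
- suff -> : (u^t* *m (opmx a E)^T *m u) 0 0 =
      '[E (\sum_k (u k 0)^* *: a k), \sum_k (u k 0)^* *: a k] by exact: (proj2 pE).
  rewrite -mulmxA mxE [E _]linear_sum hdot_suml; apply: eq_bigr => k _.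
  rewrite !mxE [E (_ *: _)]linearZ hdotZl hdot_sumr; congr (_ * _); apply: eq_bigr => l _.
  by rewrite !mxE hdotZr conjCK mulrC.
Qed.

Lemma corr_tensor n m (a : 'I_n -> HA) (b : 'I_m -> HB) (c : 'M[C]_(n, m))
    (E : {linear HA -> HA}) (F : {linear HB -> HB}) (T : {linear H -> H}) :
  (forall u v, T (tau u v) = tau (E u) (F v)) ->
  corr c (opmx a E) (opmx b F)^T =
    '[T (\sum_i \sum_j c i j *: tau (a i) (b j)), \sum_i \sum_j c i j *: tau (a i) (b j)].
Proof.
move=> TE; rewrite hdot_sumr; apply: eq_bigr => k _.
rewrite mxE hdot_sumr; apply: eq_bigr => l _.
rewrite !mxE hdotZr mulrC; congr (_ * _).
rewrite [T _]linear_sum hdot_suml.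
transitivity (\sum_j \sum_i '[E (a i), a k] * c i j * '[F (b j), b l]).
  apply: eq_bigr => j _; rewrite !mxE mulr_suml; apply: eq_bigr => i _.
  by rewrite !mxE.
rewrite exchange_big; apply: eq_bigr => i _.
rewrite [T _]linear_sum hdot_suml; apply: eq_bigr => j _.
by rewrite [T (_ *: _)]linearZ hdotZl TE (proj1 ht) mulrA [X in X * _]mulrC.
Qed.

Lemma opmx_id (K : hilbertSpace R) n (a : 'I_n -> K) :
  (forall i j, '[a i, a j] = (i == j)%:R) -> opmx a idfun = 1%:M.
Proof. by move=> oa; apply/matrixP => k i; rewrite !mxE oa eq_sym. Qed.

(** A finite sum of elementary tensors lives on the span of its left factors tensor the span of its
    right factors. Compressing the POVMs to these spans keeps them POVMs and leaves all expectations
    in [w] unchanged. *)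
Lemma tensor_fd_model (E : 'I_2 -> bool -> {linear HA -> HA})
    (F : 'I_2 -> bool -> {linear HB -> HB})
    (T : bool -> bool -> 'I_2 -> 'I_2 -> {linear H -> H}) (w : H) :
  (forall r, povm (E r)) -> (forall t, povm (F t)) ->
  (forall a b r t, tensor_op tau (E r a) (F t b) (T a b r t)) ->
  lin_span [set w | exists u v, w = tau u v] w ->
  fd_model (complex.Re '[w, w]) (fun a b r t => complex.Re '[T a b r t w, w]).
Proof.
move=> pE pF hT [N [c [x [xS wE]]]].
have /choice[uv xE] k : exists uv : HA * HB, x k = tau uv.1 uv.2.
  by have [u [v ->]] := xS k; exists (u, v).
have [n [a [oa aE]]] := orthonormalise [seq (uv k).1 | k <- enum 'I_N].
have [m [b [ob bE]]] := orthonormalise [seq (uv k).2 | k <- enum 'I_N].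
pose g : 'M[C]_(n, m) :=
  \matrix_(i, j) \sum_k c k * ('[(uv k).1, a i] * '[(uv k).2, b j]).
have {}wE : w = \sum_i \sum_j g i j *: tau (a i) (b j).
  transitivity (\sum_k \sum_i \sum_j
     (c k * ('[(uv k).1, a i] * '[(uv k).2, b j])) *: tau (a i) (b j)).
    rewrite wE; apply: eq_bigr => k _; rewrite xE.
    have ak : (uv k).1 \in [seq (uv k).1 | k <- enum 'I_N].
      by apply/mapP; exists k; rewrite ?mem_enum.
    have bk : (uv k).2 \in [seq (uv k).2 | k <- enum 'I_N].
      by apply/mapP; exists k; rewrite ?mem_enum.
    rewrite -[in LHS](aE _ ak) -[in LHS](bE _ bk).
    rewrite linear_sumlz scaler_sumr; apply: eq_bigr => i _.
    rewrite linear_sumr scaler_sumr; apply: eq_bigr => j _.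
    by rewrite linearZl_LR linearZr_LR /= !scalerA mulrA.
  rewrite exchange_big /=; apply: eq_bigr => i _.
  rewrite exchange_big /=; apply: eq_bigr => j _.
  by rewrite mxE scaler_suml.
have sum1 (K : hilbertSpace R) k (o : 'I_k -> K) (G : bool -> {linear K -> K}) :
    (forall i j, '[o i, o j] = (i == j)%:R) -> povm G ->
    opmx o (G true) + opmx o (G false) = 1%:M.
  move=> oo [_ G1]; apply/matrixP => i j; rewrite !mxE -hdotDl.
  by have := G1 (o j); rewrite big_bool /= => ->; rewrite oo eq_sym.
exists n, m, (fun r s => opmx a (E r s)), (fun t s => (opmx b (F t s))^T), g; split.
- by move=> r s; have [] := psd_opmx a (proj1 (pE r) s).
- by move=> t s; have [] := psd_opmx b (proj1 (pF t) s).
- by move=> r; exact: sum1.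
- by move=> t; have := congr1 trmx (sum1 _ _ _ _ ob (pF t)); rewrite linearD trmx1.
have realE X Y (z : C) : X^t* = X -> Y^t* = Y -> corr g X Y = z ->
    (complex.Re z)%:C = corr g X Y.
  by move=> hX hY <-; rewrite -corr_real.
split.
  apply: realE; rewrite ?adjmx1 //.
  have := corr_tensor a b g (E := idfun) (F := idfun) (T := idfun) (fun _ _ => erefl).
  by rewrite !opmx_id // trmx1 -wE.
move=> s s' r t; have [[hX _] _] := psd_opmx a (proj1 (pE r) s).
have [_ [hY _]] := psd_opmx b (proj1 (pF t) s').
apply: realE => //.
by rewrite (corr_tensor _ _ _ (proj2 (hT s s' r t))) -wE.
Qed.

End TensorModel.

Section QuantumApproximation.
Variable R : realType.
Local Notation C := R[i].

Lemma density_op_trace_le1 (H : hilbertSpace R) (rho : {linear H -> H})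
    (I : choiceType) (e : I -> H) : positive_op rho ->
  partial_sum (fun i => '[rho (e i), e i] : C^o) @ totally --> (1 : C^o) ->
  forall L : {fset I}, \sum_(i <- L) complex.Re '[rho (e i), e i] <= 1.
Proof.
move=> pr tr1 L; rewrite -lerN2.
have -> : - (1 : R) = complex.Re (- (1 : C)) by [].
apply: (@cvg_Re_le _ _ totally _ (fun J => - partial_sum (fun i => '[rho (e i), e i] : C^o) J)).
  exact: (cvgN (V := C^o)).
exists L => //= L' LL'; rewrite ReN lerN2 /partial_sum.
rewrite -(big_seq_fsetE _ _ xpredT (fun i => '[rho (e i), e i])) /= Re_sum.
rewrite [leRHS](big_fsetID _ (mem L)) /= -[leLHS]addr0; apply: lerD.
  rewrite le_eqVlt; apply/orP; left; apply/eqP; apply: eq_fbigl => i; rewrite !inE /= andbC.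
  by case: (boolP (i \in L)) => //= /(fsubsetP LL') ->.
by apply: sumr_ge0 => i _; exact: (Re_le ((proj2 pr) _)).
Qed.

Lemma quantum_cone_approx d (p : behaviour R) (delta : R) : (1 < d)%N -> 0 < delta ->
  quantum_behaviours R p ->
  exists (w : R) (q : behaviour R), [/\ cone (ball_behaviours d) w q,
    `|1 - w| <= delta & forall a b r t, `|p a b r t - q a b r t| <= delta].
Proof.
move=> d1 delta0 [HA [HB [H [tau [rho [E [F [ht [pr [I [e [be tr1]]]] pE pF pT]]]]]]]].
have [T HT] : exists T : bool -> bool -> 'I_2 -> 'I_2 -> {linear H -> H},
    forall a b r t, tensor_op tau (E r a) (F t b) (T a b r t) /\
      is_trace (fun u => rho (T a b r t u)) (p a b r t)%:C.
  have /choice[T TP] (x : bool * bool * 'I_2 * 'I_2) := pT x.1.1.1 x.1.1.2 x.1.2 x.2.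
  by exists (fun a b r t => T (a, b, r, t)) => a b r t; exact: (TP (a, b, r, t)).
pose TT (x : bool * bool * 'I_2 * 'I_2) := T x.1.1.1 x.1.1.2 x.1.2 x.2.
have TTc x : continuous (TT x) by have [[]] := HT x.1.1.1 x.1.1.2 x.1.2 x.2.
have TTsym x u v : '[TT x u, v] = '[u, TT x v].
  have [tT _] := HT x.1.1.1 x.1.1.2 x.1.2 x.2.
  exact: (tensor_op_selfadjoint ht (proj1 (pE _) _) (proj1 (pF _) _) tT).
have [K Kb] : exists K : R, forall x u, `|TT x u| <= K%:C * `|u|.
  have /choice[k kP] x : exists k : R, 0 < k /\ forall u, `|TT x u| <= k%:C * `|u|.
    by have [k k0 kb] := continuous_op_bounded (TTc x); exists k.
  exists (\sum_x k x) => x u; have [_ kx] := kP x.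
  rewrite (le_trans (kx u)) // ler_wpM2r // lecR (bigD1 x) //= lerDl.
  by apply: sumr_ge0 => y _; have [/ltW] := kP y.
have trle1 := density_op_trace_le1 pr tr1.
have K1 : 0 < 1 + K ^+ 2 by rewrite ltr_pwDl // sqr_ge0.
(* Chosen so that [t * (1 + K ^+ 2)], the error of [trace_approx], and [t ^+ 2], the weight lost by
   truncation, are both at most [delta / 2]. *)
pose t := Num.min 1 (delta / 2 / (1 + K ^+ 2)).
have t0 : 0 < t by rewrite lt_min ltr01 !divr_gt0.
have t1 : t <= 1 by rewrite ge_min lexx.
have tK : t * (1 + K ^+ 2) <= delta / 2 by rewrite -ler_pdivlMr // ge_min lexx orbT.
have t2 : t ^+ 2 <= delta / 2.
  rewrite (le_trans _ tK) // expr2 ler_pM2l // (le_trans t1) // lerDl sqr_ge0 //.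
have [N hN] : exists N : {fset I}, 1 - \sum_(i <- N) complex.Re '[rho (e i), e i] <= t ^+ 2.
  have t2C : 0 < (t ^+ 2)%:C by rewrite ltcR exprn_gt0.
  move: tr1 => /(cvgr_dist_le (V := C^o)) /(_ _ t2C) [L _ /(_ L)] /=.
  rewrite fsubset_refl => /(_ isT) hL; exists L.
  move: hL => /(le_trans (norm_Re _)); rewrite lecR ReD ReN => /ler_normlW.
  by rewrite /partial_sum -(big_seq_fsetE _ _ xpredT (fun i => '[rho (e i), e i])) /= Re_sum.
have [w w1 w2] := bproj_factor pr be N.
set n := #|_| in w w1 w2.
(* The other half of [delta], shared among the [n] vectors; [n.+1] keeps the division meaningful
   when [n = 0]. *)
pose eta : R := delta / 2 / n.+1%:R.
have eta0 : 0 < eta by rewrite !divr_gt0.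
(* One sum of elementary tensors must approximate [w m] for the norm and for all sixteen operators
   at once; finitely many open conditions meet a dense set. *)
have /choice[w' w'P] m : exists v, [/\ lin_span [set x | exists a b, x = tau a b] v,
    `|complex.Re '[w m, w m] - complex.Re '[v, v]| <= eta &
    forall x, `|complex.Re '[TT x (w m), w m] - complex.Re '[TT x v, v]| <= eta].
  have near_form (S : {linear H -> H}) : continuous S -> \forall v \near w m,
      `|complex.Re '[S (w m), w m] - complex.Re '[S v, v]| <= eta.
    move=> cS; have : (fun v => '[S v, v] : C^o) @ w m --> ('[S (w m), w m] : C^o).
      by apply: cvg_hdot; [exact: cS|exact: cvg_id].
    move=> /(cvgr_dist_le (V := C^o)) /(_ eta%:C).
    rewrite ltcR => /(_ eta0); apply: filterS => v.
    by move=> /(le_trans (norm_Re _)); rewrite lecR ReD ReN.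
  have : nbhs (w m) [set v | `|complex.Re '[w m, w m] - complex.Re '[v, v]| <= eta /\
    forall x, `|complex.Re '[TT x (w m), w m] - complex.Re '[TT x v, v]| <= eta].
    apply: filterI.
      by apply: (near_form idfun) => v; exact: cvg_id.
    by apply: filter_forall => x; exact: near_form.
  rewrite nbhsE => -[U [oU Uw] UP].
  have [v [Uv Sv]] := (proj2 ht) U (ex_intro _ _ Uw) oU.
  by have [v1 v2] := UP _ Uv; exists v.
pose q a b r s := \sum_m complex.Re '[T a b r s (w' m), w' m].
have sum_eta : \sum_(m < n) eta <= delta / 2.
  rewrite sumr_const card_ord /eta -[X in X <= _]mulr_natr mulrAC ler_pdivrMr //.
  by rewrite ler_wpM2l ?ler_nat // divr_ge0 // ltW.
exists (\sum_m complex.Re '[w' m, w' m]), q; split.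
- apply: (cone_sum (q := fun m a b r s => complex.Re '[T a b r s (w' m), w' m])) => m.
  apply: (fd_cone d1); have [wS _ _] := w'P m.
  by apply: (tensor_fd_model ht pE pF) => // a b r s; have [] := HT a b r s.
- have -> : 1 - \sum_m complex.Re '[w' m, w' m] =
      (1 - \sum_(i <- N) complex.Re '[rho (e i), e i]) +
      \sum_m (complex.Re '[w m, w m] - complex.Re '[w' m, w' m]).
    by rewrite sumrB -(Re_sum _ _ (fun m => '[w m, w m])) w2 Re_sum addrA subrK.
  rewrite (le_trans (ler_normD _ _)) // [leRHS](splitr delta); apply: lerD.
    by rewrite ger0_norm ?subr_ge0 ?trle1 // (le_trans hN).
  rewrite (le_trans (ler_norm_sum _ _ _)) // (le_trans _ sum_eta) //.
  by apply: ler_sum => m _; have [] := w'P m.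
- move=> a b r s; have [_ [I' [f [bf trf]]]] := HT a b r s.
  have := trace_approx pr be trle1 (TTsym (a, b, r, s)) (Kb (a, b, r, s)) t0 hN w1 bf trf.
  move=> /le_trans /(_ tK) /= h1.
  rewrite [leRHS](splitr delta) (le_trans (ler_distD
    (\sum_m complex.Re '[T a b r s (w m), w m]) _ _)) //; apply: lerD => //.
  rewrite /q -sumrB (le_trans (ler_norm_sum _ _ _)) // (le_trans _ sum_eta) //.
  by apply: ler_sum => m _; have [_ _ /(_ (a, b, r, s))] := w'P m.
Qed.

End QuantumApproximation.

(** * Closedness of the convex hull *)

Section Caratheodory.
Variables (R : realType) (X : finType) (K : set (X -> R)).

Definition convex_comb (n : nat) (p : X -> R) : Prop :=
  exists (w : 'I_n -> R) (k : 'I_n -> X -> R),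
    [/\ forall i, 0 <= w i, \sum_i w i = 1, forall i, K (k i) &
        forall x, p x = \sum_i w i * k i x].

(** The points, each extended by a coordinate 1, outnumber the dimension [#|X| + 1], so they have an
    affine dependence [v]. The weights are moved along [- v] until one of them vanishes. *)
Lemma caratheodory_step n p : (#|X| < n)%N -> convex_comb n.+1 p -> convex_comb n p.
Proof.
move=> Xn [w [k [w0 w1 Kk E]]].
pose M : 'M[R]_(n.+1, #|X| + 1) :=
  row_mx (\matrix_(i, j) k i (enum_val j)) (const_mx 1).
have kM0 : kermx M != 0.
  rewrite -mxrank_eq0 mxrank_ker subn_eq0 -ltnNge ltnS.
  by rewrite (leq_trans (rank_leq_col _)) // addn1.
have [v v0 vM] : exists2 v : 'rV_n.+1, v != 0 & v *m M = 0.
  exists (nz_row (kermx M)); first by rewrite nz_row_eq0.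
  by apply/sub_kermxP; exact: nz_row_sub.
have vk x : \sum_i v 0 i * k i x = 0.
  have := congr1 (fun A : 'rV[R]_(#|X| + 1) => A 0 (lshift 1 (enum_rank x))) vM.
  rewrite mxE [RHS]mxE => vM0; rewrite -[RHS]vM0; apply: eq_bigr => i _.
  by rewrite row_mxEl mxE enum_rankK.
have v1 : \sum_i v 0 i = 0.
  have := congr1 (fun A : 'rV[R]_(#|X| + 1) => A 0 (rshift #|X| 0)) vM.
  rewrite mxE [RHS]mxE => vM0; rewrite -[RHS]vM0; apply: eq_bigr => i _.
  by rewrite row_mxEr mxE mulr1.
have [i0 vi0] : exists i, 0 < v 0 i.
  apply: contrapT => nv; move/eqP: v0; apply; apply/rowP => i; rewrite mxE.
  have vle j : v 0 j <= 0 by rewrite leNgt; apply/negP => vj; apply: nv; exists j.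
  have : \sum_j - v 0 j == 0 by rewrite sumrN v1 oppr0.
  rewrite psumr_eq0; last by move=> j _; rewrite oppr_ge0.
  by move=> /allP /(_ i); rewrite mem_index_enum oppr_eq0 => /(_ isT) /eqP.
(* The first weight to reach zero; the smallest ratio keeps all the others nonnegative. *)
pose i1 := [arg min_(i < i0 | 0 < v 0 i) (w i / v 0 i)]%O.
have [vi1 i1min] : 0 < v 0 i1 /\ forall j, 0 < v 0 j -> w i1 / v 0 i1 <= w j / v 0 j.
  by rewrite /i1; case: arg_minP.
pose s := w i1 / v 0 i1.
have s0 : 0 <= s by rewrite divr_ge0 // ltW.
pose w' i := w i - s * v 0 i.
have w'0 i : 0 <= w' i.
  rewrite subr_ge0; have [vi|vi] := ltP 0 (v 0 i); last first.
    by rewrite (le_trans _ (w0 i)) // mulr_ge0_le0.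
  by rewrite -ler_pdivlMr // i1min.
have w'i1 : w' i1 = 0 by rewrite /w' /s divfK ?subrr // gt_eqF.
exists (fun i => w' (lift i1 i)), (fun i => k (lift i1 i)); split => //.
  have : \sum_i w' i = 1 by rewrite sumrB w1 -mulr_sumr v1 mulr0 subr0.
  by rewrite (bigD1_ord i1) //= w'i1 add0r.
move=> x; have : \sum_i w' i * k i x = p x.
  rewrite E; under eq_bigr do rewrite mulrBl -mulrA.
  by rewrite sumrB -mulr_sumr vk mulr0 subr0.
by rewrite (bigD1_ord i1) //= w'i1 mul0r add0r.
Qed.

(** The number of points is made exactly [#|X|.+1], by padding with zero weights if necessary, so
    that all mixtures share one parameter space. *)
Lemma caratheodory n p : convex_comb n p -> convex_comb #|X|.+1 p.
Proof.
have pad m q : convex_comb m q -> convex_comb m.+1 q.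
  case: m => [|m] [w [k [w0 w1 Kk E]]].
    by move: w1; rewrite big_ord0 => /eqP; rewrite eq_sym oner_eq0.
  exists (fun i => oapp w 0 (unlift ord0 i)), (fun i => oapp k (k ord0) (unlift ord0 i)).
  split.
  - by move=> i; case: unliftP => [j _|_] /=.
  - rewrite big_ord_recl unlift_none /= add0r -[RHS]w1.
    by apply: eq_bigr => i _; rewrite liftK.
  - by move=> i; case: unliftP => [j _|_] /=.
  - move=> x; rewrite big_ord_recl unlift_none /= mul0r add0r E.
    by apply: eq_bigr => i _; rewrite liftK.
elim: n => [|n IH] c.
  elim: #|X|.+1 => // m; exact: pad.
have [nX|Xn] := leqP n #|X|; last exact/IH/caratheodory_step.
rewrite -(subnK nX : (_ - n + n)%N = _) -addnS.
by elim: (_ - _)%N => // m IHm; rewrite addSn; exact: pad.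
Qed.

End Caratheodory.

(** * Compactness of the space of mixtures *)

Section HullClosed.
Variables (R : realType) (d : nat).

(** Positivity of the four outcomes at pairs of coordinate directions is a system of linear
    inequalities in single entries of [u], [v] and [T]. *)
Lemma ball_behaviour_bounds (u v : 'cV[R]_d) (T : 'M[R]_d) :
  (forall a b x y, sphere x -> sphere y -> 0 <= ball_box u v T a b x y) ->
  forall i j, [/\ `|u i 0| <= 1, `|v i 0| <= 1 & `|T i j| <= 1].
Proof.
move=> pos i j.
pose e k : 'cV[R]_d := delta_mx k 0.
have se k : sphere (e k).
  rewrite /sphere /= (bigD1 k) //= big1 => [|l lk]; rewrite mxE ?eqxx.
    by rewrite addr0 expr1n.
  by rewrite (negbTE lk) expr0n.
have dE (w : 'cV[R]_d) k : dotc w (e k) = w k 0.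
  rewrite /dotc (bigD1 k) //= big1 => [|l lk]; rewrite mxE ?eqxx.
    by rewrite addr0 mulr1.
  by rewrite (negbTE lk) mulr0.
have bE k l : bilc T (e k) (e l) = T k l.
  rewrite /bilc (bigD1 k) //= [X in _ + X]big1 => [|k' kk']; last first.
    by apply: big1 => l' _; rewrite mxE (negbTE kk') !mul0r.
  rewrite addr0 (bigD1 l) //= big1 => [|l' ll']; rewrite !mxE ?eqxx.
    by rewrite addr0 mulr1 mul1r.
  by rewrite (negbTE ll') mulr0.
have p k l a b := pos a b (e k) (e l) (se k) (se l).
rewrite /ball_box in p.
split; rewrite ler_norml; apply/andP; split.
all: have := p i j true true; have := p i j true false; have := p i j false true;
  have := p i j false false; have := p j i true true; have := p j i true false;
  have := p j i false true; have := p j i false false; rewrite !dE !bE /pm; lra.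
Qed.

Lemma closed_forall (V : topologicalType) (I : Type) (P : I -> V -> Prop) :
  (forall i, closed [set x | P i x]) -> closed [set x | forall i, P i x].
Proof.
move=> cP; rewrite (_ : [set x | _] = \bigcap_i [set x | P i x]).
  by apply: closed_bigI => i _.
by apply/seteqP; split => x /= Px => [i _|i]; apply: Px.
Qed.

Lemma closed_nonneg (V : topologicalType) (f : V -> R) : continuous f ->
  closed [set x | 0 <= f x].
Proof.
move=> cf; apply: (@closed_comp _ _ f [set z | 0 <= z]); last exact: closed_ge.
by move=> x _; exact: cf.
Qed.

Lemma closed_eqc (V : topologicalType) (f : V -> R) c : continuous f ->
  closed [set x | f x = c].
Proof.
move=> cf; apply: (@closed_comp _ _ f [set z | z = c]); last exact: closed_eq.
by move=> x _; exact: cf.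
Qed.

Lemma continuous_sumr (V : topologicalType) (I : finType) (f : I -> V -> R) :
  (forall i, continuous (f i)) -> continuous (fun x => \sum_i f i x).
Proof.
move=> cf x; apply: cvg_big => [y|i _]; first exact: add_continuous.
exact: cf.
Qed.

Lemma continuous_mulr (V : topologicalType) (f g : V -> R) :
  continuous f -> continuous g -> continuous (fun x => f x * g x).
Proof. by move=> cf cg x; apply: cvgM; [exact: cf|exact: cg]. Qed.

Lemma continuous_addr (V : topologicalType) (f g : V -> R) :
  continuous f -> continuous g -> continuous (fun x => f x + g x).
Proof. by move=> cf cg x; apply: cvgD; [exact: cf|exact: cg]. Qed.

Lemma continuous_ball_box (V : topologicalType) (u v x y : V -> 'cV[R]_d)
    (T : V -> 'M[R]_d) a b :
  (forall i, continuous (fun p => u p i 0)) -> (forall i, continuous (fun p => v p i 0)) ->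
  (forall i j, continuous (fun p => T p i j)) ->
  (forall i, continuous (fun p => x p i 0)) -> (forall i, continuous (fun p => y p i 0)) ->
  continuous (fun p => ball_box (u p) (v p) (T p) a b (x p) (y p)).
Proof.
move=> cu cv cT cx cy; rewrite /ball_box /dotc /bilc.
have cc (c : R) : continuous (fun _ : V => c) by move=> p; exact: cvg_cst.
by repeat first [exact: cc | apply: cu | apply: cv | apply: cT | apply: cx | apply: cy
  | apply: continuous_addr | apply: continuous_mulr | apply: continuous_sumr => ?].
Qed.

(* A mixture of [slots] boxes is encoded as one row vector listing the weights
   and all the parameters of the boxes, so that the admissible ones form a
   compact set. *)
Let X : finType := (bool * bool * 'I_2 * 'I_2)%type.
Let params : finType :=
  ('I_d + 'I_d + ('I_d * 'I_d) + ('I_2 * 'I_d) + ('I_2 * 'I_d))%type.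
Let slots := #|X|.+1.
Let index : finType := ('I_slots + 'I_slots * params)%type.
Let V := 'rV[R]_#|index|.

Let entry (p : V) (z : index) : R := p 0 (enum_rank z).
Let weight p k := entry p (inl k).
Let par_u p k : 'cV[R]_d := \col_i entry p (inr (k, inl (inl (inl (inl i))))).
Let par_v p k : 'cV[R]_d := \col_i entry p (inr (k, inl (inl (inl (inr i))))).
Let par_T p k : 'M[R]_d := \matrix_(i, j) entry p (inr (k, inl (inl (inr (i, j))))).
Let par_x p k r : 'cV[R]_d := \col_i entry p (inr (k, inl (inr (r, i)))).
Let par_y p k t : 'cV[R]_d := \col_i entry p (inr (k, inr (t, i))).
Let par_box p k a b x y := ball_box (par_u p k) (par_v p k) (par_T p k) a b x y.
Let mixture p (x : X) : R :=
  \sum_k weight p k * par_box p k x.1.1.1 x.1.1.2 (par_x p k x.1.2) (par_y p k x.2).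

(** The cube supplies boundedness, and [hull_admissible] shows that every mixture fits into it.
    Directions range over a subset type so that positivity is an intersection of closed
    conditions. *)
Let admissible : set V := [set p : V | forall i, `[-1, 1]%classic (p 0 i)] `&`
  ([set p : V | forall k, 0 <= weight p k] `&` [set p : V | \sum_k weight p k = 1] `&`
   [set p : V | forall k r, sphere (par_x p k r)] `&`
   [set p : V | forall k t, sphere (par_y p k t)] `&`
   [set p : V | forall k a b (x y : {x : 'cV[R]_d | sphere x}),
      0 <= par_box p k a b (proj1_sig x) (proj1_sig y)]).

Let entry_continuous z : continuous (fun p => entry p z).
Proof. exact: coord_continuous. Qed.

Let mixture_continuous x : continuous (fun p => mixture p x).
Proof.
apply: continuous_sumr => k; apply: continuous_mulr; first exact: entry_continuous.
by apply: continuous_ball_box => *; under eq_fun do rewrite mxE; exact: entry_continuous.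
Qed.

Let admissible_compact : compact admissible.
Proof.
apply: compact_closedI.
  by apply: (@rV_compact R _ (fun=> `[-1, 1]%classic)) => _; exact: segment_compact.
have cc (W : topologicalType) (c : R) : continuous (fun _ : W => c).
  by move=> p; exact: cvg_cst.
do 4?apply: closedI.
- by apply: closed_forall => k; apply: closed_nonneg; exact: entry_continuous.
- by apply: closed_eqc; apply: continuous_sumr => k; exact: entry_continuous.
- apply: closed_forall => k; apply: closed_forall => r; apply: closed_eqc.
  apply: continuous_sumr => i; under eq_fun do rewrite mxE expr2.
  by apply: continuous_mulr; exact: entry_continuous.
- apply: closed_forall => k; apply: closed_forall => r; apply: closed_eqc.
  apply: continuous_sumr => i; under eq_fun do rewrite mxE expr2.
  by apply: continuous_mulr; exact: entry_continuous.
- do 5![apply: closed_forall => ?]; apply: closed_nonneg.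
  apply: continuous_ball_box => *; try exact: cc.
  all: by under eq_fun do rewrite mxE; exact: entry_continuous.
Qed.

Let admissible_hull p : admissible p ->
  convex_hull (ball_behaviours d) (fun a b r t => mixture p (a, b, r, t)).
Proof.
move=> [_ [[[[w0 w1] sx] sy] pos]].
exists slots, (weight p),
  (fun k a b r t => par_box p k a b (par_x p k r) (par_y p k t)); split => // k.
exists (par_u p k), (par_v p k), (par_T p k), (par_x p k), (par_y p k); split => //.
move=> a b x y hx hy.
exact: (pos k a b (exist _ x hx) (exist _ y hy)).
Qed.

Let hull_admissible (q : behaviour R) : convex_hull (ball_behaviours d) q ->
  exists2 p, admissible p & forall x : X, mixture p x = q x.1.1.1 x.1.1.2 x.1.2 x.2.
Proof.
pose K : set (X -> R) := [set f | ball_behaviours d (fun a b r t => f (a, b, r, t))].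
move=> [n [w [k [w0 w1 Kk E]]]].
have /caratheodory : convex_comb K n (fun x : X => q x.1.1.1 x.1.1.2 x.1.2 x.2).
  by exists w, (fun i x => k i x.1.1.1 x.1.1.2 x.1.2 x.2).
move=> [w' [k' [w'0 w'1 Kk' E']]].
have /choice[g gP] i : exists g : 'cV[R]_d * 'cV[R]_d * 'M[R]_d *
    ('I_2 -> 'cV[R]_d) * ('I_2 -> 'cV[R]_d),
    [/\ forall r, sphere (g.1.2 r), forall t, sphere (g.2 t),
      forall a b x y, sphere x -> sphere y ->
         0 <= ball_box g.1.1.1.1 g.1.1.1.2 g.1.1.2 a b x y &
      forall a b r t, k' i (a, b, r, t) =
         ball_box g.1.1.1.1 g.1.1.1.2 g.1.1.2 a b (g.1.2 r) (g.2 t)].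
  by have [u [v [T [x [y H]]]]] := Kk' i; exists (u, v, T, x, y).
pose p : V := \row_z match enum_val z with
  | inl i => w' i
  | inr (i, inl (inl (inl (inl j)))) => (g i).1.1.1.1 j 0
  | inr (i, inl (inl (inl (inr j)))) => (g i).1.1.1.2 j 0
  | inr (i, inl (inl (inr (j, l)))) => (g i).1.1.2 j l
  | inr (i, inl (inr (r, j))) => (g i).1.2 r j 0
  | inr (i, inr (t, j)) => (g i).2 t j 0 end.
have wE i : weight p i = w' i by rewrite /weight /entry mxE enum_rankK.
have uE i : par_u p i = (g i).1.1.1.1.
  by apply/colP => j; rewrite mxE /entry mxE enum_rankK.
have vE i : par_v p i = (g i).1.1.1.2.
  by apply/colP => j; rewrite mxE /entry mxE enum_rankK.
have TE i : par_T p i = (g i).1.1.2.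
  by apply/matrixP => j l; rewrite mxE /entry mxE enum_rankK.
have xE i r : par_x p i r = (g i).1.2 r.
  by apply/colP => j; rewrite mxE /entry mxE enum_rankK.
have yE i t : par_y p i t = (g i).2 t.
  by apply/colP => j; rewrite mxE /entry mxE enum_rankK.
have sph_le1 (x : 'cV[R]_d) j : sphere x -> `|x j 0| <= 1.
  rewrite /sphere /= => sx; rewrite -(@ler_pXn2r _ 2) ?nnegrE // expr1n -sx.
  rewrite real_normK ?num_real // (bigD1 j) //= lerDl.
  by apply: sumr_ge0 => l _; exact: sqr_ge0.
exists p.
  split; last split; [|split; [split; [split|]|]|] => /=.
  - move=> z; rewrite in_itv /= -ler_norml mxE.
    case: (enum_val z) => [i|[i [[[[j|j]|[j l]]|[r j]]|[t j]]]]; have [s1 s2 pos _] := gP i.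
    + rewrite ger0_norm // -w'1 (bigD1 i) //= lerDl.
      by apply: sumr_ge0 => l _; exact: w'0.
    + by have [] := ball_behaviour_bounds pos j j.
    + by have [] := ball_behaviour_bounds pos j j.
    + by have [] := ball_behaviour_bounds pos j l.
    + exact: sph_le1.
    + exact: sph_le1.
  - by move=> i; rewrite wE.
  - by rewrite -w'1; apply: eq_bigr => i _; exact: wE.
  - by move=> i r; rewrite xE; have [] := gP i.
  - by move=> i r; rewrite yE; have [] := gP i.
  - move=> i a b x y; have [_ _ pos _] := gP i.
    by rewrite /par_box uE vE TE; apply: pos; [exact: (proj2_sig x)|exact: (proj2_sig y)].
move=> x; rewrite E'; apply: eq_bigr => i _; have [_ _ _ kE] := gP i.
by rewrite wE /par_box uE vE TE xE yE -kE; case: x => [[[? ?] ?] ?].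
Qed.

(** The distance [err] is continuous on a compact set and takes arbitrarily small values there, so
    its minimum is zero. *)
Lemma ball_hull_closed (p : behaviour R) :
  (forall delta, 0 < delta -> exists w q, [/\ cone (ball_behaviours d) w q,
    `|1 - w| <= delta & forall a b r t, `|p a b r t - q a b r t| <= delta]) ->
  convex_hull (ball_behaviours d) p.
Proof.
move=> approx.
pose px (x : X) := p x.1.1.1 x.1.1.2 x.1.2 x.2.
pose err v := \sum_x `|px x - mixture v x|.
have close eps : 0 < eps -> exists2 v, admissible v & err v <= eps.
  move=> eps0; pose S : R := \sum_x 2 * (`|px x| + 1).
  have S0 : 0 < S + 1.
    by rewrite ltr_wpDl // sumr_ge0 // => x _; rewrite mulr_ge0 // addr_ge0.
  (* The bound 1/2 keeps [w] away from zero, so that rescaling by [w^-1] at most doubles the error;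
     the other bound makes the total error at most [eps]. *)
  pose delta := Num.min (2^-1) (eps / (S + 1)).
  have delta0 : 0 < delta by rewrite lt_min invr_gt0 ltr0n divr_gt0.
  have [w [q [c w1 pq]]] := approx delta delta0.
  have d2 : delta <= 2^-1 by rewrite ge_min lexx.
  have w2 : 2^-1 <= w by move: (le_trans w1 d2); rewrite ler_norml; lra.
  have w0 : 0 < w by rewrite (lt_le_trans _ w2) // invr_gt0 ltr0n.
  have /cone1_convex_hull/hull_admissible[v Av vE] :
      cone (ball_behaviours d) 1 (fun a b r t => w^-1 * q a b r t).
    rewrite -(mulVf (lt0r_neq0 w0)); apply: (cone_scale _ c) => //.
    by rewrite invr_ge0 ltW.
  exists v => //; apply: (@le_trans _ _ (\sum_x (2 * (`|px x| + 1)) * delta)); last first.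
    rewrite -mulr_suml -/S (@le_trans _ _ ((S + 1) * delta)) //.
      by rewrite ler_wpM2r ?lerDl // ltW.
    by rewrite mulrC -ler_pdivlMr // ge_min lexx orbT.
  apply: ler_sum => x _; rewrite vE.
  have -> : px x - w^-1 * q x.1.1.1 x.1.1.2 x.1.2 x.2 =
     w^-1 * (px x * (w - 1) + (px x - q x.1.1.1 x.1.1.2 x.1.2 x.2)).
    by field; rewrite gt_eqF.
  rewrite normrM (gtr0_norm (_ : 0 < w^-1)) ?invr_gt0 //.
  have iw : w^-1 <= 2 by rewrite -[leRHS]invrK lef_pV2 ?posrE ?invr_gt0.
  rewrite -mulrA; apply: ler_pM => //; first by rewrite invr_ge0 ltW.
  rewrite (le_trans (ler_normD _ _)) // mulrDl mul1r; apply: lerD; last exact: pq.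
  by rewrite normrM ler_wpM2l // distrC.
have cerr : continuous err.
  apply: continuous_sumr => x.
  have cm : continuous (fun v => px x + (-1) * mixture v x).
    have cc (W : topologicalType) (c : R) : continuous (fun _ : W => c).
      by move=> u; exact: cvg_cst.
    exact: (continuous_addr (cc _ (px x)) (continuous_mulr (cc _ (-1)) (@mixture_continuous x))).
  rewrite (_ : (fun v => _) = (@Num.norm R R) \o (fun v => px x + (-1) * mixture v x)); last first.
    by apply/funext => v /=; rewrite mulN1r.
  by move=> v; apply: continuous_comp; [exact: cm|exact: norm_continuous].
have [v0 Av0 _] := close 1 ltr01.
have [v vA vmin] := EVT_min_rV (ex_intro _ v0 Av0) admissible_compact
  (continuous_subspaceT cerr).
have err0 : err v = 0.
  apply/eqP; rewrite eq_le; apply/andP; split; last exact: sumr_ge0.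
  apply/ler_addgt0Pr => eps /close[v' Av' v'e]; rewrite add0r.
  by rewrite (le_trans _ v'e) // vmin // inE.
rewrite (_ : p = fun a b r t => mixture v (a, b, r, t)).
  by apply: admissible_hull; rewrite inE in vA.
apply/funext => a; apply/funext => b; apply/funext => r; apply/funext => t.
move/eqP: err0; rewrite psumr_eq0 // => /allP /(_ (a, b, r, t)).
by rewrite mem_index_enum normr_eq0 subr_eq0 => /(_ isT) /eqP.
Qed.

End HullClosed.

(** * Ball boxes are boxes *)

Section HaarIntegrals.
Variables (R : realType) (d : nat) (mu : probability (borel_mx R d) R).

Lemma open_measurable_mx (A : set 'M[R]_d) : open A -> measurable (A : set (borel_mx R d)).
Proof. by move=> oA; apply: sub_sigma_algebra. Qed.

Lemma closed_measurable_mx (A : set 'M[R]_d) : closed A -> measurable (A : set (borel_mx R d)).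
Proof.
move=> cA; rewrite -(setCK A); apply: (@measurableC _ (borel_mx R d)).
by apply: open_measurable_mx; exact: closed_openC.
Qed.

Lemma continuous_measurable_mx (f : 'M[R]_d -> R) : continuous f ->
  measurable_fun setT (f : borel_mx R d -> R).
Proof.
move=> cf; apply: (measurability _ (RGenOpens.measurableE R)).
move=> _ [_ [a [b ->]] <-]; rewrite setTI; apply: open_measurable_mx.
by apply: open_comp => [x _|]; [exact: cf|exact: interval_open].
Qed.

Lemma continuous_mx (W : topologicalType) m n (f : W -> 'M[R]_(m, n)) :
  (forall i j, continuous (fun p => f p i j)) -> continuous f.
Proof.
move=> cf p; apply/cvg_mx_entourageP => A entA.
apply: filter_forall => i; apply: filter_forall => j.
move/cvg_app_entourageP : (cf i j p) => /(_ A entA).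
by apply: filterS => q Aq; apply/mem_set.
Qed.

Lemma continuous_mulmx_entry (x : 'cV[R]_d) i :
  continuous (fun Q : 'M[R]_d => (Q *m x) i 0).
Proof.
under eq_fun do rewrite mxE.
apply: continuous_sumr => j; apply: continuous_mulr; first exact: coord_continuous.
exact: cst_continuous.
Qed.

Lemma SO_entry_le1 (Q : 'M[R]_d) i j : SO Q -> `|Q i j| <= 1.
Proof.
move=> [QQ _]; rewrite -(@ler_pXn2r _ 2) ?nnegrE // expr1n real_normK ?num_real //.
have := congr1 (fun M : 'M[R]_d => M i i) QQ; rewrite !mxE eqxx /= => QQi.
rewrite -[leRHS](QQi : _ = 1) (bigD1 j) //= mxE -expr2 lerDl; apply: sumr_ge0 => k _.
by rewrite mxE -expr2 sqr_ge0.
Qed.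

Lemma SO_closed : closed (SO : set 'M[R]_d).
Proof.
rewrite (_ : SO = [set Q : 'M[R]_d | forall i j, (Q *m Q^T) i j = (1%:M : 'M[R]_d) i j] `&`
    [set Q | \det Q = 1]); last first.
  apply/seteqP; split => Q [QQ dQ]; split => //.
    by move=> i j; rewrite QQ.
  by apply/matrixP.
apply: closedI.
  apply: closed_forall => i; apply: closed_forall => j; apply: closed_eqc.
  rewrite (_ : (fun Q : 'M[R]_d => _) = (fun Q => \sum_k Q i k * Q j k)).
    apply: continuous_sumr => k; apply: continuous_mulr; exact: coord_continuous.
  by apply/funext => Q; rewrite mxE; apply: eq_bigr => k _; rewrite mxE.
apply: closed_eqc; rewrite /determinant; apply: continuous_sumr => s.
apply: continuous_mulr; first exact: cst_continuous.
elim: (index_enum _) => [|k r IH].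
  by under eq_fun do rewrite big_nil; exact: cst_continuous.
under eq_fun do rewrite big_cons.
by apply: continuous_mulr => //; exact: coord_continuous.
Qed.

Lemma SO_measurable : measurable (SO : set (borel_mx R d)).
Proof. by apply: closed_measurable_mx; exact: SO_closed. Qed.

Definition flip2 (i j : 'I_d) : 'M[R]_d :=
  diag_mx (\row_k (if (k == i) || (k == j) then -1 else 1)).

Lemma flip2_SO i j : i != j -> SO (flip2 i j).
Proof.
move=> ij; split.
  rewrite tr_diag_mx mulmx_diag -diag_const_mx; congr diag_mx.
  by apply/rowP => k; rewrite !mxE; case: ifP => _; rewrite ?mulrNN mulr1.
rewrite det_diag (bigD1 i) //= (bigD1 j) //= 1?eq_sym // big1 => [|k /andP[ki kj]].
  by rewrite !mxE !eqxx orbT mulr1 mulrNN mulr1.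
by rewrite mxE (negbTE ki) (negbTE kj).
Qed.

Lemma SO_mul (P Q : 'M[R]_d) : SO P -> SO Q -> SO (P *m Q).
Proof.
move=> [PP dP] [QQ dQ]; split; last by rewrite det_mulmx dP dQ mulr1.
by rewrite trmx_mul mulmxA -(mulmxA P) QQ mulmx1.
Qed.

Lemma SO_tr (Q : 'M[R]_d) : SO Q -> SO Q^T.
Proof.
move=> [QQ dQ]; split; last by rewrite det_tr.
by rewrite trmxK; exact: mulmx1C.
Qed.

Hypothesis hmu : haar_SO mu.
Hypothesis d1 : (1 < d)%N.

Lemma integrable_mulmx_entry (x : 'cV[R]_d) i :
  mu.-integrable SO (fun Q : borel_mx R d => ((Q *m x) i 0)%:E).
Proof.
apply: (measurable_bounded_integrable (f := fun Q : borel_mx R d => (Q *m x) i 0)).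
- exact: SO_measurable.
- by rewrite [X in (X < _)%E](_ : _ = 1%E) ?ltry //; exact: (proj1 hmu).
- apply: measurable_funTS; apply: continuous_measurable_mx.
  exact: continuous_mulmx_entry.
- exists (\sum_j `|x j 0|); split; first by rewrite num_real.
  move=> M /ltW hM Q SQ /=; rewrite (le_trans _ hM) // mxE (le_trans (ler_norm_sum _ _ _)) //.
  by apply: ler_sum => j _; rewrite normrM ler_piMl // SO_entry_le1.
Qed.

(** Left multiplication by the rotation [flip2 i j] preserves the measure and reverses the sign of
    the integrand. Reversing a second coordinate [j] as well keeps the determinant 1. *)
Lemma integral_mulmx_entry (x : 'cV[R]_d) i :
  (\int[mu]_(Q in SO) ((Q *m x) i 0)%:E = 0)%E.
Proof.
have [j ij] : exists j : 'I_d, i != j.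
  case: d d1 i => [|[|n]] // _ k.
  by exists (if k == 0 then 1 else 0); case: (eqVneq k 0) => [->|].
pose F := flip2 i j; have SF := flip2_SO ij.
pose phi (M : borel_mx R d) : borel_mx R d := F *m M.
have FE (M : 'M[R]_d) k l : (F *m M) k l = (if (k == i) || (k == j) then -1 else 1) * M k l.
  by rewrite mul_diag_mx !mxE.
have mphi : measurable_fun setT phi.
  apply: (measurability (@open 'M[R]_d : set (set (borel_mx R d))) erefl) => _ [A oA <-].
  rewrite setTI; apply: open_measurable_mx; apply: open_comp => // M _.
  apply: continuous_mx => k l; under eq_fun do rewrite FE.
  apply: continuous_mulr; last exact: coord_continuous.
  exact: cst_continuous.
pose f (Q : borel_mx R d) := ((Q *m x) i 0)%:E.
have SOphi : phi @^-1` SO = SO.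
  apply/seteqP; split => M SM; last exact: SO_mul.
  rewrite (_ : M = F^T *m (F *m M)); first by apply: SO_mul => //; exact: SO_tr.
  by rewrite mulmxA (mulmx1C (proj1 SF)) mul1mx.
have fphi M : f (phi M) = (- f M)%E.
  rewrite /f /phi -mulmxA mul_diag_mx; rewrite mxE -EFinN; congr EFin.
  by rewrite mxE eqxx mulN1r.
have intf := integrable_mulmx_entry x i.
have mf : measurable_fun setT f.
  apply/measurable_EFinP; apply: continuous_measurable_mx.
  exact: continuous_mulmx_entry.
have E : (\int[mu]_(Q in SO) f Q = - \int[mu]_(Q in SO) f Q)%E.
  rewrite -[RHS]integralN; last exact: (integrable_add_def SO_measurable intf).
  under [RHS]eq_integral do rewrite -fphi.
  have intfphi : mu.-integrable (phi @^-1` SO) (f \o phi).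
    rewrite SOphi; apply: (eq_integrable SO_measurable (fun Q => (- f Q)%E)).
      by move=> Q _; rewrite /= fphi.
    exact: integrableN.
  transitivity (\int[mu]_(Q in phi @^-1` SO) (f \o phi) Q)%E; last by rewrite SOphi.
  rewrite -(integral_pushforward mphi mf intfphi SO_measurable).
  apply: eq_measure_integral => A mA _.
  exact/esym/(proj2 hmu F A SF mA).
move: (integrable_fin_num SO_measurable intf) E; rewrite /f.
(* Integrability excludes infinite values, so the integral, being its own opposite, is zero. *)
by case: (integral _ _ _) => // r _ [] /eqP; rewrite -addr_eq0 -mulr2n mulrn_eq0 /= => /eqP ->.
Qed.

End HaarIntegrals.

Section BallBoxesAreBoxes.
Variables (R : realType) (d : nat) (mu : probability (borel_mx R d) R).
Hypothesis hmu : haar_SO mu.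
Hypothesis d1 : (1 < d)%N.

Lemma SO_sphere (Q : 'M[R]_d) (x : 'cV[R]_d) : SO Q -> sphere x -> sphere (Q *m x).
Proof.
move=> [QQ _]; have sphE (y : 'cV[R]_d) : \sum_i y i 0 ^+ 2 = (y^T *m y) 0 0.
  by rewrite mxE; apply: eq_bigr => i _; rewrite mxE expr2.
rewrite /sphere /= !sphE trmx_mul -mulmxA (mulmxA Q^T) (mulmx1C QQ) mul1mx.
by move=> ->.
Qed.

Lemma integral_affine (f : 'cV[R]_d -> R) (c : R) (xi y : 'cV[R]_d) :
  (forall x, sphere x -> f x = c + dotc xi x) -> sphere y ->
  (\int[mu]_(Q in SO) (f (Q *m y))%:E = c%:E)%E.
Proof.
move=> fE sy.
have mSO := @SO_measurable R d.
have muSO : mu SO = 1%E by exact: (proj1 hmu).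
have intg i : mu.-integrable SO
    (fun Q : borel_mx R d => ((xi i 0)%:E * ((Q *m y) i 0)%:E)%E).
  exact: integrableZl (integrable_mulmx_entry hmu y i).
transitivity (\int[mu]_(Q in SO) (c%:E +
    \sum_i ((xi i 0)%:E * ((Q *m y) i 0)%:E)))%E.
  apply: eq_integral => Q /set_mem SQ; rewrite fE; last exact: SO_sphere.
  by rewrite /dotc EFinD -sumEFin.
rewrite integralD //; last 2 first.
- by apply: finite_measure_integrable_cst.
- by apply: integrable_sum.
rewrite [X in (X + _)%E](_ : _ = (c%:E * mu SO)%E); last exact: integral_cst.
rewrite muSO mule1 integral_sum // big1 ?adde0 // => i _.
by rewrite integralZl ?integral_mulmx_entry ?mule0 //; exact: integrable_mulmx_entry.
Qed.

Lemma unbiased_affine (P : bool -> 'cV[R]_d -> R) (xi : 'cV[R]_d) :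
  (forall a x, P a x = 2^-1 + pm a * dotc xi x) -> unbiased mu P.
Proof.
move=> PE x sx; suff E b : (\int[mu]_(Q in SO) (P b (Q *m x))%:E = (2^-1)%:E)%E.
  by move=> a a'; rewrite !E.
apply: (integral_affine (xi := pm b *: xi)) => // y _; rewrite PE /dotc mulr_sumr.
by congr (_ + _); apply: eq_bigr => i _; rewrite mxE mulrA.
Qed.

Lemma transforms_affine (P : bool -> 'cV[R]_d -> R) (xi : 'cV[R]_d) :
  (forall a x, P a x = 2^-1 + pm a * dotc xi x) -> transforms_fundamentally P.
Proof.
move=> PE; pose i0 := Ordinal (ltnW d1).
exists (delta_mx i0 0).
  rewrite /sphere /= (bigD1 i0) //= big1 => [|k ki]; rewrite mxE ?eqxx.
    by rewrite addr0 expr1n.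
  by rewrite (negbTE ki) expr0n.
(* Rotating the base vector of axis [i0] yields column [i0] of [Q], so only that column carries
   coefficients. *)
exists (fun=> 2^-1), (fun a => \matrix_(i, j) (pm a * xi i 0 * (j == i0)%:R)) => a Q _.
rewrite PE /dotc mulr_sumr; congr (_ + _); apply: eq_bigr => i _.
rewrite mxE (bigD1 i0) //= [in RHS](bigD1 i0) //= !big1 => [|j ji|j ji].
- by rewrite !mxE !eqxx !addr0 !mulr1; ring.
- by rewrite mxE (negbTE ji) !mulr0.
- by rewrite mxE (negbTE ji) mulr0.
Qed.

Lemma ball_behaviours_boxes : ball_behaviours d `<=` box_behaviours mu.
Proof.
move=> p [u [v [T [x [y [sx sy pos pE]]]]]].
exists (ball_box u v T).
have mA a x' y' : marginalA (ball_box u v T) a x' y' = 2^-1 * (1 + pm a * dotc u x').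
  by rewrite /marginalA big_bool /ball_box /pm; case: a => /=; field.
have mB b x' y' : marginalB (ball_box u v T) b x' y' = 2^-1 * (1 + pm b * dotc v y').
  by rewrite /marginalB big_bool /ball_box /pm; case: b => /=; field.
have [i0 _] : exists i0 : 'I_d, True by exists (Ordinal (ltnW d1)).
have [e se] : exists e : 'cV[R]_d, sphere e by exists (x 0); exact: sx.
have cA b y' : sphere y' -> (forall x', sphere x' -> 0 < marginalB (ball_box u v T) b x' y') ->
    exists xi : 'cV[R]_d, forall a x',
      conditionalA (ball_box u v T) b y' a x' = 2^-1 + pm a * dotc xi x'.
  move=> sy' /(_ e se); rewrite mB pmulr_rgt0 ?invr_gt0 // => m0.
  (* For fixed [b] and [y'] the numerator is affine in [x'] with linear part [u + pm b T y'];
     dividing by the marginal leaves the constant term 1/2. *)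
  exists (\col_i ((u i 0 + pm b * \sum_j T i j * y' j 0) / (2 * (1 + pm b * dotc v y')))).
  move=> a x'; rewrite /conditionalA mB /ball_box.
  have -> : dotc (\col_i ((u i 0 + pm b * \sum_j T i j * y' j 0) /
      (2 * (1 + pm b * dotc v y')))) x' =
      (dotc u x' + pm b * bilc T x' y') / (2 * (1 + pm b * dotc v y')).
    rewrite [X in _ = X / _](_ : _ =
      \sum_i (u i 0 * x' i 0 + pm b * \sum_j x' i 0 * T i j * y' j 0)); last first.
      by rewrite big_split -mulr_sumr.
    rewrite mulr_suml; apply: eq_bigr => i _; rewrite mxE.
    under [in RHS]eq_bigr do rewrite -mulrA.
    by rewrite -[in RHS]mulr_sumr; ring.
  move: m0; move: (dotc v y') (bilc _ _ _) (dotc u x') (pm a) (pm b) => V B U sa sb m0.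
  by field; rewrite gt_eqF.
have cB a x' : sphere x' -> (forall y', sphere y' -> 0 < marginalA (ball_box u v T) a x' y') ->
    exists xi : 'cV[R]_d, forall b y',
      conditionalB (ball_box u v T) a x' b y' = 2^-1 + pm b * dotc xi y'.
  move=> sx' /(_ e se); rewrite mA pmulr_rgt0 ?invr_gt0 // => m0.
  exists (\col_j ((v j 0 + pm a * \sum_i x' i 0 * T i j) / (2 * (1 + pm a * dotc u x')))).
  move=> b y'; rewrite /conditionalB mA /ball_box.
  have -> : dotc (\col_j ((v j 0 + pm a * \sum_i x' i 0 * T i j) /
      (2 * (1 + pm a * dotc u x')))) y' =
      (dotc v y' + pm a * bilc T x' y') / (2 * (1 + pm a * dotc u x')).
    rewrite [X in _ = X / _](_ : _ =
      \sum_j (v j 0 * y' j 0 + pm a * \sum_i x' i 0 * T i j * y' j 0)); last first.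
      by rewrite big_split -mulr_sumr /bilc exchange_big.
    rewrite mulr_suml; apply: eq_bigr => j _; rewrite mxE.
    by rewrite -[in RHS]mulr_suml; ring.
  move: m0; move: (dotc v y') (bilc _ _ _) (dotc u x') (pm a) (pm b) => V B U sa sb m0.
  by field; rewrite gt_eqF.
split.
- move=> x' y' sx' sy'; split=> [a b|]; first exact: pos.
  by rewrite !big_bool /ball_box /pm /=; field.
- by split=> *; rewrite ?mA ?mB.
- by split=> [b y' sy' m0|a x' sx' m0]; [have [xi] := cA b y' sy' m0|have [xi] := cB a x' sx' m0];
    exact: transforms_affine.
- by split=> [b y' sy' m0|a x' sx' m0]; [have [xi] := cA b y' sy' m0|have [xi] := cB a x' sx' m0];
    exact: unbiased_affine.
- by exists x, y; split.
Qed.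

End BallBoxesAreBoxes.

(** * Boxes have finite-dimensional models *)

Section Affine.
Variables (R : realType).

(** A Householder reflection carries the first basis vector [e] to [x]; if the determinant is -1, it
    is preceded by the reflection [D], which fixes [e]. *)
Lemma SO_transitive d (x : 'cV[R]_d.+2) : sphere x ->
  exists2 U : 'M[R]_d.+2, SO U & U *m delta_mx 0 0 = x.
Proof.
move=> sx; pose e : 'cV[R]_d.+2 := delta_mx 0 0.
have ee : e^T *m e = 1%:M :> 'M[R]_1.
  by rewrite trmx_delta mul_delta_mx; apply/rowP => i; rewrite !ord1 !mxE !eqxx.
have xx : x^T *m x = 1%:M :> 'M[R]_1.
  apply/rowP => i; rewrite !ord1 !mxE eqxx -[RHS]sx.
  by apply: eq_bigr => k _; rewrite mxE expr2.
have xe : x^T *m e = (x 0 0)%:M :> 'M[R]_1.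
  by apply/rowP => i; rewrite !ord1 -colE !mxE eqxx.
have ex : e^T *m x = (x 0 0)%:M :> 'M[R]_1.
  by rewrite -[LHS]trmxK trmx_mul trmxK xe tr_scalar_mx.
pose D : 'M[R]_d.+2 := diag_mx (\row_k (if k == 1 then -1 else 1)).
have DD : D *m D^T = 1%:M.
  rewrite tr_diag_mx mulmx_diag -diag_const_mx; congr diag_mx.
  by apply/rowP => k; rewrite !mxE; case: ifP => _; rewrite ?mulrNN mulr1.
have dD : \det D = -1.
  rewrite det_diag (bigD1 1) //= big1 => [|k k1]; first by rewrite !mxE eqxx mulr1.
  by rewrite mxE (negbTE k1).
have De : D *m e = e.
  apply/colP => k; rewrite mul_diag_mx !mxE.
  by case: (eqVneq k 0) => [->|]; rewrite ?mulr0 ?mul1r.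
have [U UU Ue] : exists2 U : 'M[R]_d.+2, U *m U^T = 1%:M & U *m e = x.
  have [x1|x1] := eqVneq (x 0 0) 1.
    exists 1%:M; first by rewrite trmx1 mulmx1.
    rewrite mul1mx; apply/eqP; rewrite eq_sym -subr_eq0; apply/eqP.
    have w0 : (x - e)^T *m (x - e) = 0 :> 'M[R]_1.
      rewrite [_^T]linearB /= mulmxBl !mulmxBr xx xe ex ee x1 !subrr //.
    apply/colP => k; apply/eqP; rewrite [X in _ == X]mxE.
    have := congr1 (fun M : 'M[R]_1 => M 0 0) w0; rewrite mxE [RHS]mxE => /eqP.
    rewrite psumr_eq0 => [/allP /(_ k)|j _]; last by rewrite mxE -expr2 sqr_ge0.
    by rewrite mem_index_enum mxE -expr2 sqrf_eq0 => /(_ isT).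
  (* [k] is 2 over the squared length [2 * (1 - x 0 0)] of [w], the coefficient of the reflection
     that exchanges [e] and [x]. *)
  pose w := x - e; pose k := 1 / (1 - x 0 0).
  have k0 : 1 - x 0 0 != 0 by rewrite subr_eq0 eq_sym.
  have ww : w^T *m w = (2 * (1 - x 0 0))%:M :> 'M[R]_1.
    rewrite /w [_^T]linearB /= mulmxBl !mulmxBr xx xe ex ee -!raddfB /=.
    by congr (_%:M); ring.
  have we : w^T *m e = (x 0 0 - 1)%:M :> 'M[R]_1.
    by rewrite /w [_^T]linearB /= mulmxBl xe ee -raddfB.
  exists (1%:M - k *: (w *m w^T)); last first.
    rewrite mulmxBl mul1mx -scalemxAl -mulmxA we mul_mx_scalar scalerA.
    have -> : k * (x 0 0 - 1) = -1 by rewrite /k; field.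
    by rewrite scaleN1r opprK /w addrC subrK.
  have -> : (1%:M - k *: (w *m w^T))^T = 1%:M - k *: (w *m w^T).
    by rewrite [_^T]linearB /= [(_ *: _)^T]linearZ /= trmx_mul trmxK trmx1.
  rewrite mulmxBl mul1mx -scalemxAl mulmxBr mulmx1 -scalemxAr -mulmxA (mulmxA w^T).
  rewrite ww mul_scalar_mx -scalemxAr scalerBr !scalerA.
  rewrite -addrA -opprD; set W := w *m w^T.
  have -> : k * (k * (2 * (1 - x 0 0))) = 2 * k by rewrite /k; field.
  by rewrite addrA -scalerDl -scalerBl (_ : k + k - 2 * k = 0) ?scale0r ?subr0 //; ring.
have : (\det U) ^+ 2 = 1 by rewrite expr2 -{2}(det_tr U) -det_mulmx UU det1.
move=> /eqP; rewrite sqrf_eq1 => /orP[/eqP dU|/eqP dU]; first by exists U.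
exists (U *m D); last by rewrite -mulmxA De.
split; last by rewrite det_mulmx dU dD mulrNN mulr1.
by rewrite trmx_mul mulmxA -(mulmxA U) DD mulmx1.
Qed.

(** The squares of the two claimed differences add up to the sum of all squared entries minus twice
    the determinant, which is 2 - 2. *)
Lemma SO2_entries (U : 'M[R]_2) : SO U -> U 1 1 = U 0 0 /\ U 0 1 = - U 1 0.
Proof.
move=> [UU]; rewrite (expand_det_row _ 0) !big_ord_recl big_ord0 addr0 /cofactor !det_mx11.
rewrite !mxE /= => dU.
have e i j := congr1 (fun M : 'M[R]_2 => M i j) UU.
have := e 0 0; have := e 1 1; rewrite !mxE !big_ord_recl !big_ord0 !mxE /=.
rewrite (_ : lift ord0 ord0 = 1 :> 'I_2) in dU *; last exact/val_inj.
rewrite (_ : lift 1 0 = 0 :> 'I_2) in dU; last exact/val_inj.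
move: dU; rewrite expr0 (_ : (-1 : R) ^+ (0 + bump 0 0) = -1) // !addr0 => dU h1 h2.
have : (U 0 0 - U 1 1) ^+ 2 + (U 0 1 + U 1 0) ^+ 2 = 0.
  by rewrite (_ : ord0 = 0) in dU h1 h2; [move: dU h1 h2|exact/val_inj]; nra.
move/eqP; rewrite paddr_eq0 ?sqr_ge0 // !sqrf_eq0 subr_eq0 addr_eq0.
by move=> /andP[/eqP -> /eqP ->].
Qed.

(** The definition allows all entries of the rotation, whereas the box depends only on its first
    column once the base point is moved to [e]. The point is that the other columns contribute
    nothing new. *)
Lemma sphere_affine d (A : finType) (P : A -> 'cV[R]_d -> R) : (1 < d)%N ->
  transforms_fundamentally P ->
  exists (c0 : A -> R) (c : A -> 'cV[R]_d),
    forall a x, sphere x -> P a x = c0 a + dotc (c a) x.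
Proof.
case: d P => [|[|d]] // P _ [x0 sx0 [c0 [c' cE']]].
pose e : 'cV[R]_d.+2 := delta_mx 0 0.
have [U0 SU0 U0e] := SO_transitive sx0.
pose c a := c' a *m U0.
have cE a U : SO U -> P a (U *m e) = c0 a + \sum_j \sum_i U i j * c a i j.
  move=> SU; have -> : U *m e = (U *m U0^T) *m x0.
    by rewrite -U0e mulmxA -(mulmxA U) (mulmx1C (proj1 SU0)) mulmx1.
  rewrite cE'; last by apply: SO_mul => //; exact: SO_tr.
  congr (_ + _); rewrite [RHS]exchange_big; apply: eq_bigr => i _.
  transitivity (\sum_j \sum_k U i k * (c' a i j * U0 j k)).
    apply: eq_bigr => j _; rewrite mxE mulr_suml; apply: eq_bigr => k _.
    by rewrite mxE; ring.
  rewrite exchange_big; apply: eq_bigr => k _ /=.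
  by rewrite /c mxE mulr_sumr.
exists c0.
suff [v vE] : exists v : A -> 'cV[R]_d.+2, forall a U, SO U ->
    \sum_j \sum_i U i j * c a i j = dotc (v a) (U *m e).
  by exists v => a x /SO_transitive[U SU <-]; rewrite cE // vE.
have Ue U i : (U *m e) i 0 = U i 0 :> R by rewrite -colE mxE.
clearbody c; clear c' cE' sx0 U0e SU0 U0 x0.
case: d e P c cE Ue => [|d] e P c cE Ue.
  (* In the plane the second column of a rotation is the first one turned by a right angle, so its
     coefficients merge with those of the first. *)
  exists (fun a => \col_i (if i == 0 then c a 0 0 + c a 1 1 else c a 1 0 - c a 0 1)).
  move=> a U /SO2_entries[U11 U01].
  rewrite /dotc !big_ord_recl !big_ord0 !addr0 !Ue !mxE /=.
  rewrite (_ : lift ord0 ord0 = 1 :> 'I_2); last exact/val_inj.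
  rewrite (_ : ord0 = 0 :> 'I_2); last exact/val_inj.
  by rewrite U11 U01; ring.
exists (fun a => \col_i c a i 0) => a U SU.
pose f j := \sum_i U i j * c a i j.
(* Reversing two columns other than the first leaves [U e] unchanged, so their contributions cancel.
   With at least two such columns, cancellation in all pairs makes their total zero. *)
have flipE j k : j != k -> j != 0 -> k != 0 -> f j + f k = 0.
  move=> jk j0 k0; have SF := flip2_SO R jk.
  have : P a (U *m flip2 R j k *m e) = P a (U *m e).
    congr (P a _); apply/colP => i; rewrite !Ue mul_mx_diag !mxE.
    by rewrite eq_sym (negbTE j0) eq_sym (negbTE k0) mulr1.
  rewrite !cE //; last exact: SO_mul.
  move=> /addrI; have -> : \sum_l \sum_i (U *m flip2 R j k) i l * c a i l =
      \sum_l (if (l == j) || (l == k) then -1 else 1) * f l.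
    apply: eq_bigr => l _; rewrite mulr_sumr; apply: eq_bigr => i _.
    by rewrite mul_mx_diag !mxE mulrAC mulrC.
  rewrite -/(\sum_l f l) => E.
  have : \sum_l (1 - (if (l == j) || (l == k) then -1 else 1)) * f l = 0.
    by under eq_bigr do rewrite mulrBl mul1r; rewrite sumrB E subrr.
  rewrite (bigD1 j) //= (bigD1 k) 1?eq_sym //= big1 => [|l /andP[/negbTE -> /negbTE ->]].
    by rewrite !eqxx orbT /=; lra.
  by rewrite subrr mul0r.
have S0 : \sum_(j : 'I_d.+2) f (lift ord0 j) = 0.
  have pair (j k : 'I_d.+2) : j != k -> f (lift ord0 j) + f (lift ord0 k) = 0.
    by move=> jk; apply: flipE; rewrite ?(inj_eq lift_inj) // eq_sym neq_lift.
  rewrite (bigD1 0) //= (bigD1 1) //= big1 => [|j /andP[j0 j1]].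
    by rewrite addr0 pair.
  have := pair _ _ j0; have := pair _ _ j1; have := pair 0 1 isT; lra.
rewrite big_ord_recl S0 addr0; apply: eq_bigr => i _.
by rewrite Ue mxE mulrC.
Qed.

End Affine.

(** * Realising conditional states by measurements on an entangled vector *)

Section Steering.
Variable R : realType.
Local Notation C := R[i].

(** [Z] is the coefficient matrix of a purification of [rho]. Conjugation by its inverse turns the
    decompositions of [rho] into decompositions of the identity, and cyclicity of the trace cancels
    [Z] again in the probabilities. *)
Lemma steering_fd_model n (s : 'I_2 -> bool -> 'M[C]_n) (rho : 'M[C]_n)
    (F : 'I_2 -> bool -> 'M[C]_n) (q : behaviour R) :
  (forall r a, psd (s r a)) -> (forall r, s r true + s r false = rho) ->
  rho \in unitmx -> \tr rho = 1 ->
  (forall t b, psd (F t b)) -> (forall t, F t true + F t false = 1%:M) ->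
  (forall a b r t, (q a b r t)%:C = \tr (s r a *m F t b)) -> fd_model 1 q.
Proof.
move=> ps s1 rU tr1 pF F1 qE.
have [Z ZE] : exists Z : 'M[C]_n, rho = Z^t* *m Z.
  by apply: psd_factor; rewrite -(s1 0); exact: psdD.
have ZU : Z \in unitmx by move: rU; rewrite ZE unitmx_mul => /andP[].
pose W := invmx Z.
have ZW : Z *m W = 1%:M by rewrite mulmxV.
have WZ : W *m Z = 1%:M by rewrite mulVmx.
have WZ' : W^t* *m Z^t* = 1%:M by rewrite -adjmxM ZW adjmx1.
have ZW' : Z^t* *m W^t* = 1%:M by rewrite -adjmxM WZ adjmx1.
exists n, n, (fun r a => W^t* *m s r a *m W), F, Z; split => //.
- by move=> r a /=; apply: (psd_sandwich W (ps r a)).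
- by move=> r; rewrite -mulmxDl -mulmxDr s1 ZE mulmxA WZ' mul1mx.
split; first by rewrite /corr mul1mx mulmx1 mxtrace_mulC -ZE tr1 rmorph1.
move=> a b r t; rewrite qE /corr -!mulmxA (mulmxA W) WZ mul1mx.
by rewrite [RHS]mxtrace_mulC -!mulmxA ZW' mulmx1.
Qed.

Lemma product_fd_model (A : 'I_2 -> bool -> R) (B : 'I_2 -> bool -> R) (q : behaviour R) :
  (forall r a, 0 <= A r a) -> (forall r, A r true + A r false = 1) ->
  (forall t b, 0 <= B t b) -> (forall t, B t true + B t false = 1) ->
  (forall a b r t, q a b r t = A r a * B t b) -> fd_model 1 q.
Proof.
move=> A0 A1 B0 B1 qE.
have ps (z : R) : 0 <= z -> psd ((z%:C)%:M : 'M[C]_1).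
  move=> z0; split=> [|u]; first by rewrite tr_scalar_mx map_scalar_mx /= conj_rC.
  rewrite mul_mx_scalar -scalemxAl mxE mulr_ge0 ?ler0c // mxE big_ord1 !mxE.
  by rewrite mulrC -normCK exprn_ge0.
exists 1%N, 1%N, (fun r a => ((A r a)%:C)%:M), (fun t b => ((B t b)%:C)%:M), 1%:M; split.
- by move=> r a; exact: ps.
- by move=> t b; exact: ps.
- by move=> r; rewrite -raddfD -rmorphD A1.
- by move=> t; rewrite -raddfD -rmorphD B1.
split; first by rewrite /corr adjmx1 !mulmx1 mxtrace1 rmorph1.
move=> a b r t; rewrite qE /corr adjmx1 !mulmx1 -scalar_mxM mxtrace_scalar.
by rewrite rmorphM.
Qed.

(* [A + b1 sigma_z + b2 sigma_x] in terms of Pauli matrices. *)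
Definition bloch (A b1 b2 : R) : 'M[C]_2 :=
  \matrix_(i, j) (if i == j then (if i == 0 then A + b1 else A - b1) else b2)%:C.

Lemma bloch_mul A b1 b2 A' b1' b2' : \tr (bloch A b1 b2 *m bloch A' b1' b2') =
  (2 * (A * A' + b1 * b1' + b2 * b2'))%:C.
Proof.
rewrite /mxtrace !big_ord_recl big_ord0 !mxE !big_ord_recl !big_ord0 !mxE /=.
by rewrite -!rmorphM !addr0 -!rmorphD; congr (real_complex _ _); ring.
Qed.

Lemma bloch_sqr A b1 b2 : bloch A b1 b2 *m bloch A b1 b2 =
  bloch (A ^+ 2 + b1 ^+ 2 + b2 ^+ 2) (2 * A * b1) (2 * A * b2).
Proof.
apply/matrixP => -[[|[|//]] hi] [[|[|//]] hj]; rewrite !mxE !big_ord_recl big_ord0 !mxE /=.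
all: by rewrite -!rmorphM !addr0 -!rmorphD; congr (real_complex _ _); ring.
Qed.

Lemma blochD A b1 b2 A' b1' b2' : bloch A b1 b2 + bloch A' b1' b2' =
  bloch (A + A') (b1 + b1') (b2 + b2').
Proof.
apply/matrixP => i j; rewrite !mxE -rmorphD; congr (real_complex _ _).
by case: ifP => // _; case: ifP => // _; ring.
Qed.

Lemma blochZ z A b1 b2 : z%:C *: bloch A b1 b2 = bloch (z * A) (z * b1) (z * b2).
Proof.
apply/matrixP => i j; rewrite !mxE -rmorphM; congr (real_complex _ _).
by case: ifP => // _; case: ifP => // _; ring.
Qed.

Lemma bloch1 : bloch 1 0 0 = 1%:M.
Proof.
by apply/matrixP => i j; rewrite !mxE addr0 subr0 if_same; case: eqP.
Qed.

Lemma bloch_herm A b1 b2 : (bloch A b1 b2)^t* = bloch A b1 b2.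
Proof.
apply/matrixP => i j; rewrite !mxE conj_rC eq_sym.
by case: eqP => // ->.
Qed.

(** By Cayley-Hamilton, [2 A] times the matrix is its square plus [A ^+ 2 - (b1 ^+ 2 + b2 ^+ 2)], a
    sum of positive matrices; [A = 0] forces the zero matrix. *)
Lemma bloch_psd A b1 b2 : 0 <= A -> b1 ^+ 2 + b2 ^+ 2 <= A ^+ 2 -> psd (bloch A b1 b2).
Proof.
rewrite le_eqVlt => /orP[/eqP <-|A0 bA].
  rewrite expr0n => b0; have [-> ->] : b1 = 0 /\ b2 = 0.
    have : b1 ^+ 2 + b2 ^+ 2 == 0 by rewrite eq_le b0 addr_ge0 // sqr_ge0.
    by rewrite paddr_eq0 ?sqr_ge0 // !sqrf_eq0 => /andP[/eqP -> /eqP ->].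
  rewrite (_ : bloch 0 0 0 = (0 : 'M[C]_2)^t* *m 0); first exact: psd_mul_adj.
  by rewrite mulmx0; apply/matrixP => i j; rewrite !mxE addr0 subr0 !if_same.
have -> : bloch A b1 b2 = ((2 * A)^-1)%:C *: (bloch A b1 b2 *m bloch A b1 b2) +
    ((2 * A)^-1 * (A ^+ 2 - (b1 ^+ 2 + b2 ^+ 2)))%:C *: 1%:M.
  rewrite bloch_sqr -bloch1 !blochZ blochD; congr bloch; field; exact: lt0r_neq0.
apply: psdD; apply: psdZ.
- by rewrite ler0c invr_ge0 mulr_ge0 // ltW.
- by rewrite -{1}bloch_herm; exact: psd_mul_adj.
- by rewrite ler0c mulr_ge0 ?subr_ge0 // invr_ge0 mulr_ge0 // ltW.
- by rewrite -[1%:M]mulmx1 -{1}(adjmx1 _ 2); exact: psd_mul_adj.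
Qed.

Lemma bloch_unit A b1 b2 : b1 ^+ 2 + b2 ^+ 2 < A ^+ 2 -> bloch A b1 b2 \in unitmx.
Proof.
move=> bA; rewrite unitmxE unitfE.
suff -> : \det (bloch A b1 b2) = (A ^+ 2 - (b1 ^+ 2 + b2 ^+ 2))%:C.
  by rewrite (inj_eq (@complexI R) _ 0) subr_eq0 gt_eqF.
rewrite (expand_det_row _ 0) !big_ord_recl big_ord0 addr0 /cofactor !det_mx11 !mxE /=.
rewrite expr0 mul1r (_ : (-1 : C) ^+ (0 + bump 0 0) = -1) // mulN1r mulrN.
by rewrite -!rmorphM -rmorphB; congr (real_complex _ _); ring.
Qed.

Lemma le_of_sqr (x y : R) : 0 <= y -> x ^+ 2 <= y ^+ 2 -> x <= y.
Proof.
move=> y0 xy; rewrite leNgt; apply/negP => yx; move: xy; rewrite leNgt => /negP; apply.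
by rewrite ltr_pXn2r ?nnegrE // (le_trans y0) // ltW.
Qed.

Lemma planar_fd_model (A b1 b2 : 'I_2 -> bool -> R) (n1 n2 : 'I_2 -> R) (be1 be2 : R)
    (q : behaviour R) :
  (forall r a, 0 <= A r a) -> (forall r a, b1 r a ^+ 2 + b2 r a ^+ 2 <= A r a ^+ 2) ->
  (forall r, A r true + A r false = 1) ->
  (forall r, b1 r true + b1 r false = be1) -> (forall r, b2 r true + b2 r false = be2) ->
  (forall t, n1 t ^+ 2 + n2 t ^+ 2 = 1) ->
  (forall a b r t, q a b r t =
     2^-1 * (A r a + pm b * (b1 r a * n1 t + b2 r a * n2 t))) ->
  fd_model 1 q.
Proof.
move=> A0 bA A1 B1 B2 nn qE.
have Fp t b : psd (bloch 2^-1 (2^-1 * (pm b * n1 t)) (2^-1 * (pm b * n2 t))).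
  apply: bloch_psd; first by rewrite invr_ge0.
  have -> : (2^-1 * (pm b * n1 t)) ^+ 2 + (2^-1 * (pm b * n2 t)) ^+ 2 =
    2^-1 ^+ 2 * (n1 t ^+ 2 + n2 t ^+ 2) by case: b; rewrite /pm; ring.
  by rewrite nn mulr1.
(* The triples [(A, b1, b2)] lie in the forward light cone, which is closed under addition; [cs] is
   Cauchy-Schwarz for the spatial parts. *)
have be : be1 ^+ 2 + be2 ^+ 2 <= 1.
  have := bA 0 true; have := bA 0 false; have := A0 0 true; have := A0 0 false.
  rewrite -(B1 0) -(B2 0); have := A1 0.
  move: (A 0 true) (A 0 false) (b1 0 true) (b1 0 false) (b2 0 true) (b2 0 false).
  move=> p p' x x' y y' pp p'0 p0 h' h.
  have cs : x * x' + y * y' <= p * p'.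
    apply: le_of_sqr; first exact: mulr_ge0.
    have -> : (x * x' + y * y') ^+ 2 =
      (x ^+ 2 + y ^+ 2) * (x' ^+ 2 + y' ^+ 2) - (x * y' - y * x') ^+ 2 by ring.
    rewrite exprMn lerBlDr (le_trans (ler_pM _ _ h h')) ?addr_ge0 ?sqr_ge0 //.
    by rewrite lerDl sqr_ge0.
  have -> : (1 : R) = (p + p') ^+ 2 by rewrite pp expr1n.
  by nra.
have [be_lt|be_ge] := ltP (be1 ^+ 2 + be2 ^+ 2) 1.
  apply: (@steering_fd_model 2 (fun r a => 2^-1%:C *: bloch (A r a) (b1 r a) (b2 r a))
    (2^-1%:C *: bloch 1 be1 be2)
    (fun t b => bloch 2^-1 (2^-1 * (pm b * n1 t)) (2^-1 * (pm b * n2 t)))).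
  - move=> r a; apply: psdZ; first by rewrite ler0c invr_ge0.
    by apply: bloch_psd.
  - by move=> r; rewrite -scalerDr blochD A1 B1 B2.
  - rewrite blochZ; apply: bloch_unit; rewrite mulr1 !exprMn -mulrDr.
    by rewrite gtr_pMr // exprn_gt0 // invr_gt0.
  - rewrite mxtraceZ -[bloch _ _ _]mulmx1 -bloch1 bloch_mul -rmorphM -[RHS](rmorph1 (real_complex R)).
    by congr (real_complex _ _); field.
  - by [].
  - by move=> t; rewrite blochD -bloch1; congr bloch; rewrite /pm; lra.
  - move=> a b r t; rewrite qE -scalemxAl mxtraceZ bloch_mul -rmorphM.
    by congr (real_complex _ _); field.
have be_eq : be1 ^+ 2 + be2 ^+ 2 = 1 by apply/eqP; rewrite eq_le be.
(* When [be] is a unit vector, Cauchy-Schwarz bounds each term by [A r a], and the two bounds add up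
   to an equality; equality then makes [b1], [b2] proportional to [be]. *)
have dotb r a : b1 r a * be1 + b2 r a * be2 = A r a.
  have le1 a' : b1 r a' * be1 + b2 r a' * be2 <= A r a'.
    apply: le_of_sqr => //.
    have -> : (b1 r a' * be1 + b2 r a' * be2) ^+ 2 =
      (b1 r a' ^+ 2 + b2 r a' ^+ 2) * (be1 ^+ 2 + be2 ^+ 2) -
      (b1 r a' * be2 - b2 r a' * be1) ^+ 2 by ring.
    rewrite be_eq mulr1 lerBlDr (le_trans (bA r a')) //.
    by rewrite lerDl sqr_ge0.
  have sum1 : (b1 r true * be1 + b2 r true * be2) + (b1 r false * be1 + b2 r false * be2) = 1.
    transitivity ((b1 r true + b1 r false) * be1 + (b2 r true + b2 r false) * be2); first by ring.
    by rewrite B1 B2 -!expr2.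
  by have := le1 true; have := le1 false; have := A1 r; case: a; lra.
have par r a : b1 r a = A r a * be1 /\ b2 r a = A r a * be2.
  have : (b1 r a - A r a * be1) ^+ 2 + (b2 r a - A r a * be2) ^+ 2 <= 0.
    have -> : (b1 r a - A r a * be1) ^+ 2 + (b2 r a - A r a * be2) ^+ 2 =
      b1 r a ^+ 2 + b2 r a ^+ 2 - 2 * A r a * (b1 r a * be1 + b2 r a * be2) +
      A r a ^+ 2 * (be1 ^+ 2 + be2 ^+ 2) by ring.
    by rewrite dotb be_eq; have := bA r a; lra.
  move=> h0; have : (b1 r a - A r a * be1) ^+ 2 + (b2 r a - A r a * be2) ^+ 2 == 0.
    by rewrite eq_le h0 addr_ge0 ?sqr_ge0.
  by rewrite paddr_eq0 ?sqr_ge0 // !sqrf_eq0 !subr_eq0 => /andP[/eqP -> /eqP ->].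
apply: (@product_fd_model A (fun t b => 2^-1 * (1 + pm b * (be1 * n1 t + be2 * n2 t)))) => //.
- move=> t b; rewrite mulr_ge0 ?invr_ge0 //.
  have : (be1 * n1 t + be2 * n2 t) ^+ 2 <= 1.
    have -> : (be1 * n1 t + be2 * n2 t) ^+ 2 =
      (be1 ^+ 2 + be2 ^+ 2) * (n1 t ^+ 2 + n2 t ^+ 2) - (be1 * n2 t - be2 * n1 t) ^+ 2 by ring.
    by rewrite be_eq nn mulr1 lerBlDr lerDl sqr_ge0.
  rewrite -(expr1n _ 2) -ler_sqrt ?sqr_ge0 ?expr1n // sqrtr_sqr sqrtr1 ler_norml.
  by move=> /andP[? ?]; case: b; rewrite /pm; lra.
- by move=> t; rewrite /pm; field.
- by move=> a b r t; rewrite qE; have [-> ->] := par r a; ring.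
Qed.

End Steering.

(** * Conditional distributions of a box *)

Section BoxModel.
Variables (R : realType) (d : nat) (mu : probability (borel_mx R d) R).
Hypothesis hmu : haar_SO mu.
Hypothesis d1 : (1 < d)%N.
Implicit Types u v w : 'cV[R]_d.

Lemma dotcC u v : dotc u v = dotc v u.
Proof. by apply: eq_bigr => i _; rewrite mulrC. Qed.
Lemma dotcDl u v w : dotc (u + v) w = dotc u w + dotc v w.
Proof. by rewrite /dotc -big_split; apply: eq_bigr => i _ /=; rewrite mxE mulrDl. Qed.
Lemma dotcZl k u v : dotc (k *: u) v = k * dotc u v.
Proof. by rewrite /dotc mulr_sumr; apply: eq_bigr => i _; rewrite mxE mulrA. Qed.
Lemma dotcDr u v w : dotc w (u + v) = dotc w u + dotc w v.
Proof. by rewrite dotcC dotcDl !(dotcC w). Qed.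
Lemma dotcZr k u v : dotc v (k *: u) = k * dotc v u.
Proof. by rewrite dotcC dotcZl dotcC. Qed.
Lemma dotc_ge0 u : 0 <= dotc u u.
Proof. by apply: sumr_ge0 => i _; rewrite -expr2 sqr_ge0. Qed.
Lemma dotc_eq0 u : dotc u u = 0 -> u = 0.
Proof.
move/eqP; rewrite psumr_eq0 => [|i _]; last by rewrite -expr2 sqr_ge0.
move=> /allP u0; apply/colP => i; rewrite mxE; apply/eqP.
by have := u0 i; rewrite mem_index_enum -expr2 sqrf_eq0 => /(_ isT).
Qed.
Lemma sphere_dotc u : sphere u <-> dotc u u = 1.
Proof. by rewrite /sphere /= /dotc; split=> <-; apply: eq_bigr => i _; rewrite expr2. Qed.

Lemma sphere_dotc_inj u v : (forall y, sphere y -> dotc u y = dotc v y) -> u = v.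
Proof.
move=> uv; apply/colP => i.
have dE w : dotc w (delta_mx i 0) = w i 0.
  rewrite /dotc (bigD1 i) //= big1 => [|k ki]; rewrite mxE ?eqxx.
    by rewrite addr0 mulr1.
  by rewrite (negbTE ki) mulr0.
rewrite -!dE; apply: uv; apply/sphere_dotc; by rewrite dE mxE !eqxx.
Qed.

(** [z] is the normalised component of [y1] orthogonal to [y0]. It is zero when the two directions
    are parallel, hence only a bound on its length. *)
Lemma sphere_orthoplane (y0 y1 : 'cV[R]_d) : sphere y0 -> sphere y1 ->
  exists (z : 'cV[R]_d) (g h : R), [/\ y1 = g *: y0 + h *: z, g ^+ 2 + h ^+ 2 = 1,
    dotc z y0 = 0 & dotc z z <= 1].
Proof.
move=> /sphere_dotc s0 /sphere_dotc s1; pose g := dotc y1 y0.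
pose v := y1 + (- g) *: y0.
have vv : dotc v v = 1 - g ^+ 2.
  rewrite /v !(dotcDl, dotcDr, dotcZl, dotcZr) s0 s1 (dotcC y0) -/g; ring.
have vy : dotc v y0 = 0 by rewrite /v dotcDl dotcZl s0 -/g; ring.
have g2 : 0 <= 1 - g ^+ 2 by rewrite -vv dotc_ge0.
pose h := Num.sqrt (1 - g ^+ 2).
have h2 : h ^+ 2 = 1 - g ^+ 2 by rewrite sqr_sqrtr.
exists (h^-1 *: v), g, h; split.
- have [h0|h0] := eqVneq h 0; last first.
    by rewrite scalerA divff // scale1r /v scaleNr addrC subrK.
  have /dotc_eq0 v0 : dotc v v = 0 by rewrite vv -h2 h0 expr0n.
  rewrite v0 !scaler0 addr0; apply/eqP; rewrite -subr_eq0 -scaleNr.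
  by rewrite -/v v0.
- by rewrite h2; ring.
- by rewrite dotcZl vy mulr0.
- rewrite dotcZl dotcZr vv -h2; have [->|h0] := eqVneq h 0.
    by rewrite expr0n !mulr0 ler01.
  by rewrite (_ : h^-1 * (h^-1 * h ^+ 2) = 1) //; field.
Qed.

(** The Haar average of an affine function is its constant term, so unbiasedness equates the two
    constants. Normalisation at [y0] and at [- y0] makes them sum to 1. *)
Lemma unbiased_conditional (f : bool -> 'cV[R]_d -> R) (y0 : 'cV[R]_d) : sphere y0 ->
  transforms_fundamentally f -> unbiased mu f ->
  (forall y, sphere y -> f true y + f false y = 1) ->
  exists c : 'cV[R]_d, forall b y, sphere y -> f b y = 2^-1 + pm b * dotc c y.
Proof.
move=> sy0 tf uf f1; have [c0 [c cE]] := sphere_affine d1 tf.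
have c0E : c0 true = c0 false.
  have := uf y0 sy0 true false.
  have I b := integral_affine hmu d1 (cE b) sy0.
  by rewrite !I => -[].
have sN (y : 'cV[R]_d) : sphere y -> sphere (- y).
  by rewrite /sphere /=; under [X in _ -> X = _]eq_bigr do rewrite mxE sqrrN.
have dN b y : dotc (c b) (- y) = - dotc (c b) y by rewrite -scaleN1r dotcZr mulN1r.
have h : c0 false = 2^-1.
  have := f1 _ sy0; have := f1 _ (sN _ sy0).
  by rewrite !cE ?dN ?c0E //; [lra|exact: sN..].
exists (c true) => b y sy; have := f1 _ sy; rewrite !cE // c0E h => E.
by case: b; rewrite /pm ?c0E ?h; lra.
Qed.

Lemma box_fd_model (p : behaviour R) : box_behaviours mu p -> fd_model 1 p.
Proof.
move=> [P [bip [nsA nsB] [_ tB] [_ uB] [x [y [sx sy pE]]]]].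
have margE a x' y' : marginalA P a x' y' = P a true x' y' + P a false x' y'.
  by rewrite /marginalA big_bool.
have cond a x' : sphere x' -> exists AB : R * 'cV[R]_d, forall b y', sphere y' ->
    P a b x' y' = 2^-1 * (AB.1 + pm b * dotc AB.2 y').
  move=> sx'; pose m := marginalA P a x' (y 0).
  have mE y' : sphere y' -> marginalA P a x' y' = m by move=> sy'; exact: nsA.
  have P0 b y' : sphere y' -> 0 <= P a b x' y'.
    by move=> sy'; have [] := bip _ _ sx' sy'.
  have m0 : 0 <= m by rewrite /m margE addr_ge0 // P0.
  move: m0; rewrite le_eqVlt => /orP[/eqP m0|m0].
    (* An outcome of probability zero has no conditional box, but then all its joint probabilities
       vanish. *)
    exists (0, 0) => b y' sy' /=.
    have -> : dotc (0 : 'cV[R]_d) y' = 0 by rewrite -(scale0r y') dotcZl mul0r.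
    rewrite mulr0 addr0 mulr0; apply/eqP.
    have : P a true x' y' + P a false x' y' == 0 by rewrite -margE mE // m0.
    by rewrite paddr_eq0 ?P0 // => /andP[]; case: b.
  have pos y' : sphere y' -> 0 < marginalA P a x' y' by move=> sy'; rewrite mE.
  have s1 y' : sphere y' -> conditionalB P a x' true y' + conditionalB P a x' false y' = 1.
    by move=> sy'; rewrite /conditionalB -mulrDl -margE mE // divff // lt0r_neq0.
  have [c cE] := unbiased_conditional (sy 0) (tB a x' sx' pos) (uB a x' sx' pos) s1.
  exists (m, (2 * m) *: c) => b y' sy' /=.
  have := cE b y' sy'; rewrite /conditionalB mE // => E.
  have -> : P a b x' y' = m * (P a b x' y' / m) by field; exact: lt0r_neq0.
  rewrite E.
  by rewrite dotcZl; field.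
have /choice[AB ABE] (ra : 'I_2 * bool) := cond ra.2 (x ra.1) (sx ra.1).
pose A r a := (AB (r, a)).1; pose B r a := (AB (r, a)).2.
have PE r a b y' : sphere y' -> P a b (x r) y' = 2^-1 * (A r a + pm b * dotc (B r a) y').
  exact: (ABE (r, a)).
have pos r a b y' : sphere y' -> 0 <= A r a + pm b * dotc (B r a) y'.
  move=> sy'; have [/(_ a b)] := bip _ _ (sx r) sy'.
  by rewrite PE // pmulr_rge0 // invr_gt0.
have A0 r a : 0 <= A r a.
  have := pos r a true _ (sy 0); have := pos r a false _ (sy 0).
  by rewrite /pm; lra.
have A1 r : A r true + A r false = 1.
  have [_] := bip _ _ (sx r) (sy 0); rewrite !big_bool /= !PE // /pm; lra.
have Bsum r : B r true + B r false = B 0 true + B 0 false.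
  apply: sphere_dotc_inj => y' sy'; have := nsB true _ _ _ sy' (sx r) (sx 0).
  rewrite /marginalB !big_bool /= !PE // /pm !dotcDl; have := A1 r; have := A1 0; lra.
(* Positivity at the unit vector along [B r a], for the outcome with the negative sign, bounds its
   length by [A r a]. *)
have BA r a : dotc (B r a) (B r a) <= A r a ^+ 2.
  have [B0|B0] := eqVneq (dotc (B r a) (B r a)) 0; first by rewrite B0 sqr_ge0.
  have Bp : 0 < dotc (B r a) (B r a) by rewrite lt_def B0 dotc_ge0.
  pose N := Num.sqrt (dotc (B r a) (B r a)).
  have N2 : N ^+ 2 = dotc (B r a) (B r a) by rewrite sqr_sqrtr // ltW.
  have N0 : 0 < N by rewrite sqrtr_gt0.
  have sN : sphere (N^-1 *: B r a).
    apply/sphere_dotc; rewrite dotcZl dotcZr -N2; field; exact: lt0r_neq0.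
  have := pos r a false _ sN; rewrite dotcZr -N2 /pm => h.
  have NA : N <= A r a.
    by move: h; rewrite mulN1r subr_ge0 expr2 mulKf // lt0r_neq0.
  by rewrite ler_pXn2r ?nnegrE // ltW.
have [z [g [h [y1E gh zy zz]]]] := sphere_orthoplane (sy 0) (sy 1).
have /sphere_dotc y00 := sy 0.
apply: (@planar_fd_model R A (fun r a => dotc (B r a) (y 0)) (fun r a => dotc (B r a) z)
  (fun t => if t == 0 then 1 else g) (fun t => if t == 0 then 0 else h)
  (dotc (B 0 true + B 0 false) (y 0)) (dotc (B 0 true + B 0 false) z)) => //.
- move=> r a; apply: le_trans (BA r a).
  (* Bessel's inequality in the plane of the two directions, for a [z] of length at most 1. *)
  have := dotc_ge0 (B r a + (- dotc (B r a) (y 0)) *: y 0 + (- dotc (B r a) z) *: z).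
  rewrite !(dotcDl, dotcDr, dotcZl, dotcZr) y00 zy (dotcC (y 0) z) zy.
  rewrite (dotcC (y 0) (B r a)) (dotcC z (B r a)).
  move: (dotc (B r a) (y 0)) (dotc (B r a) z) (dotc (B r a) (B r a)) => b1 b2 bb.
  have := mulr_ge0 (sqr_ge0 b2) (_ : 0 <= 1 - dotc z z); rewrite subr_ge0 => /(_ zz).
  by move: (dotc z z) => k; lra.
- by move=> r; rewrite -dotcDl Bsum.
- by move=> r; rewrite -dotcDl Bsum.
- by move=> t; case: eqP => _ //; rewrite expr1n expr0n addr0.
- move=> a b r t; rewrite pE PE //; congr (_ * (_ + _ * _)).
  case: eqP => [->|/eqP t0]; first by rewrite mulr1 mulr0 addr0.
  have -> : t = 1 by apply/val_inj; case: t t0 => [[|[|]]].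
  by rewrite y1E dotcDr !dotcZr; ring.
Qed.

End BoxModel.

(** * Finite-dimensional models are quantum *)

Section L2Matrices.
Variable R : realType.
Local Notation C := R[i].

(* A copy of the matrix type, whose own norm is the sup norm. *)
Definition l2mx m n : Type := 'M[C]_(m, n).

HB.instance Definition _ m n := GRing.Lmodule.copy (l2mx m n) 'M[C]_(m, n).

Section Norm.
Variables m n : nat.
Implicit Types A B : 'M[C]_(m, n).

Definition l2dot A B : C := \tr (A *m B^t*).

Lemma l2dot_bilinear : bilinear_for
  (GRing.Scale.Law.clone _ _ *%R _) (GRing.Scale.Law.clone _ _ (Num.conj \; *%R) _) l2dot.
Proof.
split=> [B|A] a X Y; rewrite /l2dot /=.
  by rewrite mulmxDl -scalemxAl mxtraceD mxtraceZ.
by rewrite adjmxD adjmxZ mulmxDr -scalemxAr mxtraceD mxtraceZ.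
Qed.

HB.instance Definition _ := bilinear_isBilinear.Build C
  'M[C]_(m, n) 'M[C]_(m, n) C _ _ l2dot l2dot_bilinear.

Lemma l2dot_hermitian A B : l2dot A B = (-1) ^+ false * (l2dot B A)^*.
Proof.
by rewrite expr0 mul1r /l2dot -mxtrace_adj adjmxM trmxCK.
Qed.

HB.instance Definition _ := isHermitianSesquilinear.Build C 'M[C]_(m, n) false
  Num.conj l2dot l2dot_hermitian.

Lemma l2dot_gt0 A : A != 0 -> 0 < l2dot A A.
Proof.
move=> A0; rewrite lt_def trace_mulmx_adj_ge0 andbT.
by apply: contra A0 => /eqP/trace_mulmx_adj_eq0 ->.
Qed.

HB.instance Definition _ := isDotProduct.Build C 'M[C]_(m, n) l2dot l2dot_gt0.

Definition l2norm A : C := sqrtC (l2dot A A).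

Lemma l2normD A B : l2norm (A + B) <= l2norm A + l2norm B.
Proof. by have [] := @triangle_lerif C 'M[C]_(m, n) l2dot A B. Qed.

Lemma l2normZ a A : l2norm (a *: A) = `|a| * l2norm A.
Proof.
rewrite /l2norm dnormZ sqrtCM ?nnegrE ?exprn_ge0 ?trace_mulmx_adj_ge0 //.
by rewrite sqrCK.
Qed.

Lemma l2norm_eq0 A : l2norm A = 0 -> A = 0.
Proof.
by move=> /eqP; rewrite sqrtC_eq0 => /eqP; exact: trace_mulmx_adj_eq0.
Qed.

End Norm.

HB.instance Definition _ m n :=
  Lmodule_isNormed.Build C (l2mx m n) (@l2normD m n) (@l2normZ m n) (@l2norm_eq0 m n).

Lemma l2mx_normE m n (A : l2mx m n) : `|A| ^+ 2 = l2dot A A.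
Proof. exact: sqrtCK. Qed.

Section Completeness.
Variables m n : nat.
Implicit Types A B : l2mx m n.

Let coords : finType := ('I_m * 'I_n * bool)%type.
Let crd A (k : coords) : R :=
  if k.2 then complex.Re (A k.1.1 k.1.2) else complex.Im (A k.1.1 k.1.2).

Let crdB A B k : crd (A - B) k = crd A k - crd B k.
Proof.
have opE : A - B = (A : 'M[C]_(m, n)) - B by [].
rewrite /crd opE !mxE; case: k.2.
  by case: (A k.1.1 k.1.2) => ? ?; case: (B k.1.1 k.1.2).
by case: (A k.1.1 k.1.2) => ? ?; case: (B k.1.1 k.1.2).
Qed.

Let crd_le A k : `|crd A k|%:C <= `|A|.
Proof.
apply: (@le_trans _ _ `|A k.1.1 k.1.2|).
  rewrite /crd; case: k.2; first exact: normc_ge_Re.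
  by rewrite normc_def lecR -sqrtr_sqr ler_wsqrtr // lerDr sqr_ge0.
rewrite -(@ler_pXn2r _ 2) ?nnegrE // l2mx_normE /l2dot trace_mulmx_adj.
rewrite (bigD1 k.1.1) //= (bigD1 k.1.2) //= -addrA lerDl addr_ge0 //.
  by apply: sumr_ge0 => j _; rewrite exprn_ge0.
by apply: sumr_ge0 => i _; apply: sumr_ge0 => j _; rewrite exprn_ge0.
Qed.

Let norm_le_crd A : `|A| <= \sum_k `|crd A k|%:C.
Proof.
have -> : \sum_k `|crd A k|%:C = \sum_i \sum_j
    (`|complex.Re (A i j)|%:C + `|complex.Im (A i j)|%:C) :> C.
  rewrite pair_bigA /= [RHS](eq_bigr (fun p => \sum_b `|crd A (p, b)|%:C)).
    by rewrite pair_bigA; apply: eq_bigr => -[[i j] b].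
  by move=> [i j] _; rewrite big_bool.
have AE : A = \sum_i \sum_j A i j *: (delta_mx i j : l2mx m n) by exact: matrix_sum_delta.
rewrite {1}AE (le_trans (ler_norm_sum _ _ _)) //; apply: ler_sum => i _.
rewrite (le_trans (ler_norm_sum _ _ _)) //; apply: ler_sum => j _.
have d1 : `|(delta_mx i j : l2mx m n)| = 1.
  apply/eqP; rewrite -(@eqrXn2 _ 2) // expr1n l2mx_normE /l2dot.
  rewrite trmx_delta map_delta_mx mul_delta_mx /mxtrace (bigD1 i) //= big1.
    by rewrite mxE !eqxx addr0.
  by move=> k ki; rewrite mxE (negbTE ki).
rewrite normrZ d1 mulr1; case: (A i j) => x y.
rewrite normc_def /= -rmorphD lecR -(@ler_pXn2r _ 2) ?nnegrE ?addr_ge0 //.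
rewrite sqr_sqrtr ?addr_ge0 ?sqr_ge0 // sqrrD !real_normK ?num_real //.
by rewrite addrAC lerDl mulrn_wge0 // mulr_ge0.
Qed.

(** The norm dominates each of the finitely many real coordinates [crd] and is bounded by the sum of
    their absolute values, so completeness reduces to that of the reals. *)
Lemma l2mx_complete (F : set_system (l2mx m n)) : ProperFilter F -> cauchy F -> cvg F.
Proof.
move=> PF /cauchyP Fc; apply/cvg_ex.
have /choice[l lP] k : exists l : R, crd^~ k @ F --> l.
  apply/cvg_ex; apply: R_complete.
  apply: cauchy_exP => e e0.
  have [|A FA] := Fc e%:C; first by rewrite ltcR.
  exists (crd A k); rewrite /fmap /=; apply: filterS FA => B.
  rewrite -!ball_normE /ball_ /= -crdB => AB.
  by rewrite -ltcR (le_lt_trans (crd_le _ _)).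
exists (\matrix_(i, j) (l (i, j, true) +i* l (i, j, false))%C : 'M[C]_(m, n)).
set L := \matrix_(i, j) _.
apply/cvgrPdist_le => e e0.
have er : (complex.Re e)%:C = e by rewrite RRe_real // gtr0_real.
pose eta : R := complex.Re e / #|coords|.+1%:R.
have eta0 : 0 < eta by rewrite divr_gt0 // -ltcR er.
have near_k : \forall B \near F, forall k, `|l k - crd B k| <= eta.
  by apply: filter_forall => k; move: (lP k) => /cvgrPdist_le /(_ _ eta0).
apply: filterS near_k => B Bk.
rewrite (le_trans (norm_le_crd _)) // -rmorph_sum /= -er lecR.
apply: (@le_trans _ _ (\sum_(k : coords) eta)).
  apply: ler_sum => k _; rewrite crdB; apply: le_trans (Bk k).
  by rewrite /crd mxE; case: k => [[i j] []].
rewrite sumr_const /eta -[X in X <= _]mulr_natr mulrAC ler_pdivrMr //.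
by rewrite ler_wpM2l ?ler_nat // ltW // -ltcR er.
Qed.

End Completeness.

HB.instance Definition _ m n :=
  Uniform_isComplete.Build (l2mx m n) (@l2mx_complete m n).

Definition l2_dot m n : {dot (l2mx m n) for @Num.conj C} := @l2dot m n.

Definition l2_hilbert m n : hilbertSpace R :=
  @HilbertSpace R (l2mx m n) (@l2_dot m n) (fun A => esym (l2mx_normE A)).

End L2Matrices.

Section ModelQuantum.
Variable R : realType.
Local Notation C := R[i].
Local Notation l2 := (l2_hilbert R).

Lemma l2E m n (A B : l2 m n) : '[A, B] = \tr ((A : 'M[C]_(m, n)) *m (B : 'M[C]_(m, n))^t*).
Proof. by []. Qed.

Definition l2_linear m n m' n' (f : 'M[C]_(m, n) -> 'M[C]_(m', n')) (lf : linear f) :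
  {linear l2 m n -> l2 m' n'} := HB.pack f (GRing.isLinear.Build C _ _ _ f lf).

Lemma l2_linear_continuous m n (f : {linear l2 m n -> l2 m n}) : continuous f.
Proof.
apply/linear_bounded_continuous/linear_boundedP.
pose K : C := \sum_i \sum_j `|f (delta_mx i j : 'M[C]_(m, n))|.
have Kr : K \is Num.real by apply: rpred_sum => i _; apply: rpred_sum => j _; exact: normr_real.
exists K; split => // r Kr' A; apply: (@le_trans _ _ (K * `|A|)); last first.
  by rewrite ler_wpM2r // ltW.
have AE : A = \sum_i \sum_j (A : 'M[C]_(m, n)) i j *: ((delta_mx i j : 'M[C]_(m, n)) : l2 m n).
  exact: matrix_sum_delta.
rewrite {1}AE linear_sum (le_trans (ler_norm_sum _ _ _)) // mulr_suml; apply: ler_sum => i _.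
rewrite linear_sum (le_trans (ler_norm_sum _ _ _)) // mulr_suml; apply: ler_sum => j _.
rewrite linearZ normrZ mulrC ler_wpM2l //.
rewrite -(@ler_pXn2r _ 2) ?nnegrE // -hdotE l2E trace_mulmx_adj.
rewrite (bigD1 i) //= (bigD1 j) //= -addrA lerDl addr_ge0 //.
  by apply: sumr_ge0 => k _; rewrite exprn_ge0.
by apply: sumr_ge0 => k _; apply: sumr_ge0 => k' _; rewrite exprn_ge0.
Qed.

Definition l2_delta m n (k : 'I_m * 'I_n) : l2 m n := (delta_mx k.1 k.2 : 'M[C]_(m, n)).

Lemma l2_deltaE m n (A : l2 m n) k : '[A, l2_delta k] = (A : 'M[C]_(m, n)) k.1 k.2.
Proof.
rewrite l2E trmx_delta map_delta_mx /mxtrace (bigD1 k.1) //= big1 => [|i ik].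
  rewrite addr0 mxE (bigD1 k.2) //= big1 => [|j jk].
    by rewrite mxE !eqxx mulr1 addr0.
  by rewrite mxE (negbTE jk) mulr0.
by rewrite mxE big1 // => j _; rewrite mxE (negbTE ik) andbF mulr0.
Qed.

Lemma l2_delta_basis m n : orthonormal_basis (@l2_delta m n).
Proof.
split=> [[i j] [i' j']|].
  by rewrite l2_deltaE mxE /= xpair_eqE eq_sym (eq_sym j).
move=> U [A UA] _; exists A; split => //.
exists #|{: 'I_m * 'I_n}|, (fun k => (A : 'M[C]_(m, n)) (enum_val k).1 (enum_val k).2).
exists (fun k => l2_delta (enum_val k)); split; first by move=> k; exists (enum_val k).
rewrite [LHS](matrix_sum_delta (A : 'M[C]_(m, n))) pair_bigA /=.
by rewrite (reindex_onto enum_val enum_rank) => [|k _]; rewrite ?enum_rankK //=;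
  apply: eq_bigl => k; rewrite enum_valK eqxx.
Qed.

(** The index set is finite, so the net of partial sums is eventually constant. *)
Lemma l2_is_trace m n (T : l2 m n -> l2 m n) :
  is_trace T (\sum_k '[T (l2_delta k), l2_delta k]).
Proof.
exists ('I_m * 'I_n)%type, (@l2_delta m n); split; first exact: l2_delta_basis.
apply: cvg_near_cst; exists [fset k | k in {: 'I_m * 'I_n}]%fset => //= L hL.
rewrite /partial_sum.
rewrite -(big_seq_fsetE _ _ xpredT (fun k => '[T (l2_delta k), l2_delta k])) /=.
have hk k : k \in L by apply/(fsubsetP hL)/imfsetP; exists k.
by rewrite big_uniq ?fset_uniq //=; apply: eq_bigl => k; rewrite hk.
Qed.

Lemma psd_trmx n (X : 'M[C]_n) : psd X -> psd X^T.
Proof.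
move=> /psd_factor[Z ->]; rewrite trmx_mul.
have -> : (Z^t* )^T = ((Z^T)^t* )^T^T by rewrite !trmxK map_trmx trmxK.
rewrite trmxK.
have -> : Z^T *m (Z^T)^t* = ((Z^T)^t*)^t* *m (Z^T)^t* by rewrite trmxCK.
exact: psd_mul_adj.
Qed.

Lemma mulmx_linear n k (X : 'M[C]_n) : linear (fun A : 'M[C]_(n, k) => X *m A).
Proof. by move=> a A B; rewrite mulmxDr scalemxAr. Qed.

Definition l2_mul n (X : 'M[C]_n) : {linear l2 n 1 -> l2 n 1} :=
  l2_linear (mulmx_linear (k := 1) X).

Lemma l2_mul_positive n (X : 'M[C]_n) : psd X -> positive_op (l2_mul X).
Proof.
move=> [_ pX]; split; first exact: l2_linear_continuous.
move=> u; have := pX u.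
suff -> : '[l2_mul X u, u] = ((u : 'cV[C]_n)^t* *m X *m u) 0 0 by [].
rewrite l2E /= mxtrace_mulC /mxtrace big_ord1 mulmxA //.
Qed.

Lemma l2_mul_povm n (E : bool -> 'M[C]_n) : (forall a, psd (E a)) ->
  E true + E false = 1%:M -> povm (fun a => l2_mul (E a)).
Proof.
move=> pE E1; split=> [a|u]; first exact: l2_mul_positive.
rewrite big_bool; have := mul1mx (u : 'cV[C]_n).
by rewrite -E1 mulmxDl.
Qed.

(** Matrices form the tensor product of two column spaces, elementary tensors being the rank-one
    matrices; no conjugation enters, so the map is bilinear. *)
Definition l2_tau n m (u : l2 n 1) (v : l2 m 1) : l2 n m :=
  (u : 'cV[C]_n) *m (v : 'cV[C]_m)^T.

Lemma l2_tau_bilinear n m : bilinear_for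
  (GRing.Scale.Law.clone _ _ *:%R _) (GRing.Scale.Law.clone _ _ *:%R _) (@l2_tau n m).
Proof.
split=> [v|u] a x y; rewrite /l2_tau.
  by rewrite [LHS]mulmxDl -scalemxAl.
have -> : (a *: x + y)^T = a *: (x : 'cV[C]_m)^T + (y : 'cV[C]_m)^T.
  exact: (linearP (@trmx C m 1)).
by rewrite [LHS]mulmxDr -scalemxAr.
Qed.

HB.instance Definition _ n m := bilinear_isBilinear.Build C
  (l2 n 1) (l2 m 1) (l2 n m) _ _ (@l2_tau n m) (@l2_tau_bilinear n m).

Lemma l2_tau_tensor n m : hilbert_tensor (@l2_tau n m : {bilinear l2 n 1 -> l2 m 1 -> l2 n m}).
Proof.
split=> [u u' v v'|].
  rewrite !l2E /l2_tau adjmxM -mulmxA (mulmxA (_^T)).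
  have -> : (v : 'cV[C]_m)^T *m ((v' : 'cV[C]_m)^T)^t* =
      (\tr ((v : 'cV[C]_m) *m (v' : 'cV[C]_m)^t*))%:M.
    apply/rowP => i; rewrite !ord1 !mxE eqxx mulr1n; apply: eq_bigr => j _.
    by rewrite !mxE big_ord1 !mxE.
  by rewrite mul_scalar_mx -scalemxAr mxtraceZ mulrC.
move=> U [A UA] _; exists A; split => //.
exists #|{: 'I_n * 'I_m}|, (fun k => (A : 'M[C]_(n, m)) (enum_val k).1 (enum_val k).2).
exists (fun k => l2_delta (enum_val k)); split.
  move=> k; exists (delta_mx (enum_val k).1 0 : 'cV[C]_n), (delta_mx (enum_val k).2 0 : 'cV[C]_m).
  by rewrite /= /l2_tau trmx_delta; exact/esym/mul_delta_mx.
rewrite [LHS](matrix_sum_delta (A : 'M[C]_(n, m))) pair_bigA /=.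
by rewrite (reindex_onto enum_val enum_rank) => [|k _]; rewrite ?enum_rankK //=;
  apply: eq_bigl => k; rewrite enum_valK eqxx.
Qed.

(** The operator of the pure state [c] on the space of matrices, for the Hilbert-Schmidt product. *)
Lemma rank1_linear n m (c : 'M[C]_(n, m)) :
  linear (fun X : 'M[C]_(n, m) => \tr (X *m c^t*) *: c).
Proof. by move=> a X Y; rewrite mulmxDl -scalemxAl mxtraceD mxtraceZ scalerDl scalerA. Qed.

Lemma sandwich_linear n m (E : 'M[C]_n) (F : 'M[C]_m) :
  linear (fun X : 'M[C]_(n, m) => E *m X *m F).
Proof. by move=> a X Y; rewrite mulmxDr mulmxDl -scalemxAr -scalemxAl. Qed.

Lemma rank1_trace n m (c : 'M[C]_(n, m)) (T : {linear l2 n m -> l2 n m}) :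
  \sum_k '[l2_linear (rank1_linear c) (T (l2_delta k)), l2_delta k] =
  \tr ((T (c : l2 n m) : 'M[C]_(n, m)) *m c^t*).
Proof.
have cE : (c : l2 n m) = \sum_k c k.1 k.2 *: l2_delta k.
  by rewrite [LHS](matrix_sum_delta c) pair_bigA.
rewrite [in RHS]cE linear_sum [X in \tr X]mulmx_suml raddf_sum; apply: eq_bigr => k _.
rewrite linearZ /= [in RHS]/(_ *: _) -scalemxAl mxtraceZ l2_deltaE mxE mulrC.
by rewrite -cE.
Qed.

Lemma fd_quantum (p : behaviour R) : fd_model 1 p -> quantum_behaviours R p.
Proof.
move=> [n [m [E [F [c [pE pF E1 F1 [c1 pE']]]]]]].
exists (l2 n 1), (l2 m 1), (l2 n m), (@l2_tau n m : {bilinear l2 n 1 -> l2 m 1 -> l2 n m}).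
(* The second party measures the transposes: applying [E] to [u] and the transpose of [F] to [v]
   turns the matrix [X] of an elementary tensor into [E X F]. *)
exists (l2_linear (rank1_linear c)), (fun r a => l2_mul (E r a)),
  (fun t b => l2_mul (F t b)^T); split.
- exact: l2_tau_tensor.
- split; first split; first exact: l2_linear_continuous.
    move=> u; have -> : '[l2_linear (rank1_linear c) u, u] =
       '[u, (c : l2 n m)] * ('[u, (c : l2 n m)])^* by rewrite hdotZl -hdotC.
    by rewrite -normCK exprn_ge0.
  have -> : 1 = \sum_k '[l2_linear (rank1_linear c) (l2_delta k), l2_delta k].
    rewrite (rank1_trace c idfun) /=; transitivity ((1 : R)%:C) => //.
    by rewrite c1 /corr mulmx1 mul1mx.
  exact: l2_is_trace.
- by move=> r; exact: l2_mul_povm.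
- move=> t; apply: l2_mul_povm => [b|]; first exact: psd_trmx.
  by have := congr1 trmx (F1 t); rewrite linearD trmx1.
- move=> a b r t; exists (l2_linear (sandwich_linear (E r a) (F t b))); split.
    split; first exact: l2_linear_continuous.
    move=> u v; rewrite /= /l2_tau /= trmx_mul trmxK !mulmxA //.
  have -> : (p a b r t)%:C = \sum_k '[l2_linear (rank1_linear c)
      (l2_linear (sandwich_linear (E r a) (F t b)) (l2_delta k)), l2_delta k].
    by rewrite rank1_trace pE'.
  exact: l2_is_trace.
Qed.

End ModelQuantum.

(** * Mixtures of finite-dimensional models *)

Section ModelCone.
Variable R : realType.
Local Notation C := R[i].

Lemma psd_block n m (A : 'M[C]_n) (B : 'M[C]_m) : psd A -> psd B ->
  psd (block_mx A 0 0 B).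
Proof.
move=> /psd_factor[Z ->] /psd_factor[W ->].
have -> : block_mx (Z^t* *m Z) 0 0 (W^t* *m W) =
    (block_mx Z 0 0 W)^t* *m block_mx Z 0 0 W.
  rewrite tr_block_mx map_block_mx !adjmx0 mulmx_block.
  by rewrite !mulmx0 !mul0mx !addr0 !add0r.
exact: psd_mul_adj.
Qed.

(** Both parties take direct sums and the state is block diagonal, so the two labels always agree
    and act as shared randomness. *)
Lemma fd_model_add (w w' : R) (q q' : behaviour R) : fd_model w q -> fd_model w' q' ->
  fd_model (w + w') (fun a b r t => q a b r t + q' a b r t).
Proof.
move=> [n [m [E [F [c [pE pF E1 F1 [wE qE]]]]]]].
move=> [n' [m' [E' [F' [c' [pE' pF' E'1 F'1 [wE' qE']]]]]]].
have corrB (X : 'M[C]_n) (X' : 'M[C]_n') (Y : 'M[C]_m) (Y' : 'M[C]_m') :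
      corr (block_mx c 0 0 c') (block_mx X 0 0 X') (block_mx Y 0 0 Y') =
    corr c X Y + corr c' X' Y'.
  rewrite /corr tr_block_mx map_block_mx !adjmx0 !mulmx_block.
  by rewrite !(mulmx0, mul0mx, addr0, add0r) mxtrace_block.
exists (n + n')%N, (m + m')%N, (fun r a => block_mx (E r a) 0 0 (E' r a)),
  (fun t b => block_mx (F t b) 0 0 (F' t b)), (block_mx c 0 0 c'); split.
- by move=> r a; exact: psd_block.
- by move=> t b; exact: psd_block.
- by move=> r; rewrite add_block_mx !addr0 E1 E'1 -scalar_mx_block.
- by move=> t; rewrite add_block_mx !addr0 F1 F'1 -scalar_mx_block.
split; first by rewrite !scalar_mx_block corrB -wE -wE' rmorphD.
by move=> a b r t; rewrite corrB -qE -qE' rmorphD.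
Qed.

Lemma fd_model_scale (s w : R) (q : behaviour R) : 0 <= s -> fd_model w q ->
  fd_model (s * w) (fun a b r t => s * q a b r t).
Proof.
move=> s0 [n [m [E [F [c [pE pF E1 F1 [wE qE]]]]]]].
have corrS X Y : corr ((Num.sqrt s)%:C *: c) X Y = s%:C * corr c X Y.
  rewrite /corr adjmxZ conj_rC -!scalemxAr -!scalemxAl scalerA mxtraceZ.
  by rewrite -rmorphM -expr2 sqr_sqrtr.
exists n, m, E, F, ((Num.sqrt s)%:C *: c); split => //.
split; first by rewrite corrS -wE rmorphM.
by move=> a b r t; rewrite corrS -qE rmorphM.
Qed.

Lemma fd_model0 : fd_model 0 (fun _ _ _ _ => 0 : R).
Proof.
exists 0%N, 0%N, (fun _ _ => 0), (fun _ _ => 0), 0; split => [r a|t b|r|t|].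
- by split=> [|u]; [apply/matrixP => -[]|rewrite mulmx0 mul0mx mxE].
- by split=> [|u]; [apply/matrixP => -[]|rewrite mulmx0 mul0mx mxE].
- by apply/matrixP => -[].
- by apply/matrixP => -[].
- by split=> [|a b r t]; rewrite /corr /mxtrace big_ord0.
Qed.

Lemma fd_model_sum n (w : 'I_n -> R) (q : 'I_n -> behaviour R) :
  (forall i, fd_model (w i) (q i)) ->
  fd_model (\sum_i w i) (fun a b r t => \sum_i q i a b r t).
Proof.
move=> H; rewrite -big_enum.
rewrite (_ : (fun _ => _) = (fun a b r t => \sum_(i <- enum 'I_n) q i a b r t)); last first.
  by do 4!apply/funext => ?; rewrite big_enum.
elim: (enum 'I_n) => [|i s IH].
  rewrite big_nil (_ : (fun _ => _) = (fun _ _ _ _ => 0)); first exact: fd_model0.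
  by do 4!apply/funext => ?; rewrite big_nil.
rewrite big_cons.
rewrite (_ : (fun _ => _) = (fun a b r t => q i a b r t + \sum_(j <- s) q j a b r t)).
  exact: fd_model_add.
by do 4!apply/funext => ?; rewrite big_cons.
Qed.

End ModelCone.

Theorem theorem3 (R : realType) (d : nat) (hd : (2 <= d)%N)
    (mu : probability (borel_mx R d) R) (hmu : haar_SO mu) :
  quantum_behaviours R = convex_hull (box_behaviours mu).
Proof.
apply/seteqP; split => p.
  move=> qp; have [n [w [q [w0 w1 Bq pE]]]] : convex_hull (ball_behaviours d) p.
    by apply: ball_hull_closed => delta delta0; exact: quantum_cone_approx.
  exists n, w, q; split => // k.
  exact: (ball_behaviours_boxes hmu hd).
move=> [n [w [q [w0 w1 Bq pE]]]]; apply: fd_quantum.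
(* The weight 1 of the mixture is split into the weights [w i], and each box, a model of weight 1,
   is scaled accordingly. *)
rewrite -w1 (_ : p = fun a b r t => \sum_i w i * q i a b r t); last first.
  by do 4!apply/funext => ?; exact: pE.
apply: (fd_model_sum (q := fun i a b r t => w i * q i a b r t)) => i.
by rewrite -[X in fd_model X _]mulr1; apply: fd_model_scale => //; exact: (box_fd_model hmu hd).
Qed.
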